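(* Let $\alpha>-1$ and $\beta>0$, and let $T$, $a$, $b$ and $g$ be the first passage time of the geometric Brownian motion, its parameters and its density as defined in the context. Set $A=\frac{a}{b^2}-\beta$. If $$I=\int_0^\infty t^{-(\alpha+3)}\exp\left(-At-\frac{a}{t}\right)dt<\infty,$$ then for $t>0$ $$g(t)=f_{\alpha,\beta}(t)\left(1+\sum_{k\ge1}\mathcal{B}_k^{(\alpha)}L_k^{(\alpha)}(\beta t)\right),\qquad\text{with}\qquad \mathcal{B}_k^{(\alpha)}=1+\sum_{j=1}^k\binom{k}{j}\frac{(-\beta)^j\,\mathbb{E}[T^j]}{(\alpha+j)_j},$$ where $f_{\alpha,\beta}(t)=\beta(\beta t)^\alpha e^{-\beta t}/\Gamma(\alpha+1)$ is the gamma probability density.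
   Context: Setting: $W$ is a standard Brownian motion, $\sigma>0$, $\mu>\sigma^2/2$, $y_0>0$, and $Y(t)=y_0\,e^{(\mu-\sigma^2/2)t+\sigma W(t)}$, $t\ge 0$, is the geometric Brownian motion. $S$ is a constant with $S>y_0$, and $T=\inf\{t\ge 0: Y(t)>S\}$. Put $$a=\frac{(\ln S-\ln y_0)^2}{\sigma^2}>0,\qquad b=\frac{\ln S-\ln y_0}{\mu-\sigma^2/2}>0 .$$ $T$ has the inverse Gaussian probability density $g(t)=\sqrt{\frac{a}{2\pi t^3}}\exp\left(-\frac{a(t-b)^2}{2b^2t}\right)$, $t>0$. Notation: $(x)_n=\prod_{j=0}^{n-1}(x-j)$ is the lowering (falling) factorial. The generalized Laguerre polynomials are, for $\alpha>-1$, $L_0^{(\alpha)}(t)=1$ and $L_k^{(\alpha)}(t)=\sum_{i=0}^k\binom{k+\alpha}{k-i}\frac{(-t)^i}{i!}$ for $k\ge1$. *)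

(* Defs.v *)
From HB Require Import structures.
From mathcomp Require Import all_boot all_order all_algebra.
From mathcomp Require Import all_classical all_reals all_analysis.

Set Implicit Arguments.
Unset Strict Implicit.
Unset Printing Implicit Defensive.

Import Order.TTheory GRing.Theory Num.Theory.
Import numFieldNormedType.Exports.

Local Open Scope classical_set_scope.
Local Open Scope ring_scope.

Section BrownianMotion.
Context (d : measure_display) (Omega : measurableType d) (R : realType)
        (P : probability Omega R).

(* Processes are indexed by all of R, but only times t >= 0 are ever used. *)
Implicit Types W : R -> {RV P >-> R}.

Definition increment W (s t : R) (w : Omega) : R := W t w - W s w.

(* Mutual independence of the increments over consecutive intervals; as the
   A i may be setT, the product rule covers all subfamilies. *)
Definition independent_increments W : Prop :=
  forall (n : nat) (t : nat -> R) (A : nat -> set R),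
    0 <= t 0%N -> nondecreasing_seq t -> (forall i, measurable (A i)) ->
    P (\bigcap_(i in `I_n) (increment W (t i) (t i.+1) @^-1` A i)) =
    (\prod_(i < n) P (increment W (t i) (t i.+1) @^-1` A i))%E.

(* The second parameter of normal_prob is the standard deviation. *)
Definition gaussian_increments W : Prop :=
  forall s t : R, 0 <= s -> s < t ->
  forall A : set R, measurable A ->
    P (increment W s t @^-1` A) = normal_prob 0 (Num.sqrt (t - s)) A.

Definition standard_brownian_motion W : Prop :=
  [/\ {ae P, forall w, W 0 w = 0},
      independent_increments W,
      gaussian_increments W &
      {ae P, forall w, {within `[0, +oo[, continuous (fun t => W t w)}}].

Definition geometric_brownian_motion (y0 mu sigma : R) W (t : R) (w : Omega)
    : R :=
  y0 * expR ((mu - sigma ^+ 2 / 2) * t + sigma * W t w).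

(* Extended-real valued: +oo on the paths that never exceed S. *)
Definition first_passage_time (Y : R -> Omega -> R) (S : R) (w : Omega)
    : \bar R :=
  ereal_inf [set t%:E | t in [set t : R | 0 <= t /\ S < Y t w]].

(* fine maps +oo to 0; this is harmless here, as the first passage time of a
   geometric Brownian motion with mu > sigma^2 / 2 has finite moments. *)
Definition moment (T : Omega -> \bar R) (j : nat) : R :=
  fine (\int[P]_w (T w ^+ j))%E.

End BrownianMotion.

Section Densities.
Context (R : realType).
Implicit Types (a b alpha beta t x : R).

Definition ig_pdf a b t : R :=
  Num.sqrt (a / (2 * pi * t ^+ 3)) *
  expR (- (a * (t - b) ^+ 2 / (2 * b ^+ 2 * t))).

Definition Gamma x : R :=
  \int[@lebesgue_measure R]_(t in `]0, +oo[) (t `^ (x - 1) * expR (- t)).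

Definition gamma_pdf alpha beta t : R :=
  beta * (beta * t) `^ alpha * expR (- (beta * t)) / Gamma (alpha + 1).

End Densities.

Section Laguerre.
Context (R : realType).

Definition falling (x : R) (n : nat) : R := \prod_(j < n) (x - j%:R).

Definition gbinom (x : R) (n : nat) : R := falling x n / n`!%:R.

Definition laguerre (alpha : R) (k : nat) (t : R) : R :=
  \sum_(i < k.+1) gbinom (k%:R + alpha) (k - i)%N * (- t) ^+ i / i`!%:R.

Definition laguerre_coef (alpha beta : R) (m : nat -> R) (k : nat) : R :=
  1 + \sum_(1 <= j < k.+1)
        'C(k, j)%:R * ((- beta) ^+ j * m j / falling (alpha + j%:R) j).

End Laguerre.

(* Main.v *)
(** Write g for the inverse Gaussian density and w for the gamma weight.  Then h = g / w
    lies in a weighted Sobolev space on the half-line as soon as A >= 0, which the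
    finiteness of I forces.  Bessel's inequality for L_k and for the derivatives L_k'
    bounds the remainders v_n of the Laguerre expansion of h in L^2(w), and their
    derivatives in L^2(y w); by the second bound the v_n are equicontinuous.  By
    orthogonality the integrals of v_n y^j w tend to 0; expanding exponentials, the same
    holds for v_n y^j e^(-l y) w.  The kernels y^m e^(-m y / x) concentrate at x, so v_n
    must tend to 0 pointwise.  The k-th coefficient of h against L_k only involves the
    moments of g up to order k.

    It remains to see that these are the moments of T.  Stopping the exponential
    martingale exp (c X_t - psi(c) t) of the drifted Brownian motion
    X_t = (mu - sigma^2 / 2) t + sigma W_t when X exceeds ln (S / y0) gives the Laplace
    transform of T, which is that of g; differentiating and letting the
    parameter tend to 0 gives equality of all moments. *)

Require Import Defs.
From HB Require Import structures.
From mathcomp Require Import all_boot all_order all_algebra.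
From mathcomp Require Import all_classical all_reals all_analysis.
From mathcomp Require Import measurable_realfun ring lra.
Import Order.TTheory GRing.Theory Num.Theory.
Import numFieldNormedType.Exports.
Local Open Scope classical_set_scope.
Local Open Scope ring_scope.
Set Implicit Arguments.
Unset Strict Implicit.
Unset Printing Implicit Defensive.

(** * Calculus on the half-line *)

(** Up to a constant factor, h^2 w is t^(-(alpha+3)) e^(-A t - a/t), so I is the squared norm of h.
    When A = 0 no exponential decay is left at infinity, and alpha > -1 is what keeps y h'^2 w, of
    order y^(-alpha-2), integrable there.

    Convergence in L^2(w) alone gives no value at a prescribed t; this is why derivatives are
    controlled as well. The power series of e^(-l y) converges in L^2(w) only for small l, whereas
    the concentrating kernels need large l; the rate is therefore raised in steps of at most 1/8.

    The rate [beta] is removed by passing from T to beta T, which turns (a, b) into (beta a, beta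
    b).

    Stopping in continuous time is reached from discrete time: the martingale is stopped on a grid
    of mesh K / (m+1) over a horizon K, m tends to infinity, then K. Second moments, controlled
    through the martingale with parameter 2c, carry the mean value 1 through the first limit.
    Neither finiteness of T nor finiteness of its moments is presupposed: Laplace transforms are
    compared at positive rates, and the limit at rate 0 is monotone. *)

Section HalfLine.
Context {R : realType}.
Implicit Types (f F : R -> R) (x l : R).
Local Notation mu := (@lebesgue_measure R).
Local Notation Rp := (`]0%R, +oo[%classic : set R).

(** A compact exhaustion of the open half-line; starting at 2 keeps the two endpoints distinct. *)
Let I (n : nat) : set R := `[n.+2%:R^-1, n.+2%:R].

Let I_cover : `]0, +oo[%classic = \bigcup_n I n :> set R.
Proof.
apply/seteqP; split => [x|x [n _]]; rewrite /= ?in_itv /= ?andbT.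
  move=> x0; have [n xn] : exists n : nat, x + x^-1 < n%:R.
    exists (Num.truncn (x + x^-1)).+1; rewrite truncnS_gt //.
  have xi0 : 0 < x^-1 by rewrite invr_gt0.
  have nn2 : n%:R < n.+2%:R :> R by rewrite ltr_nat.
  exists n => //; rewrite /I /= in_itv /=; apply/andP; split; last lra.
  by rewrite invf_ple ?posrE//; lra.
by rewrite /I /= in_itv /= => /andP[nx _]; apply: lt_le_trans nx; rewrite invr_gt0.
Qed.

Let I_ndecr : nondecreasing_seq I.
Proof.
move=> m n mn; apply/subsetPset => x; rewrite /I /= !in_itv /= => /andP[mx xm].
apply/andP; split; last by apply: le_trans xm _; rewrite ler_nat.
by apply: le_trans mx; rewrite lef_pV2 ?posrE// ler_nat.
Qed.

Let I_pos n x : x \in `[n.+2%:R^-1, n.+2%:R] -> 0 < x.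
Proof. by rewrite in_itv /= => /andP[nx _]; apply: lt_le_trans nx; rewrite invr_gt0. Qed.

Let I_lt n : n.+2%:R^-1 < n.+2%:R :> R.
Proof. by apply: (@lt_trans _ _ 1); rewrite ?invf_lt1// ltr1n. Qed.

Lemma FTC_pos_interval f F (a b : R) : 0 < a -> a < b ->
  (forall x, 0 < x -> is_derive x 1 F (f x)) -> {in `]0, +oo[, continuous f} ->
  (\int[mu]_(x in `[a, b]) (f x)%:E = (F b - F a)%:E)%E.
Proof.
move=> a0 ab dF cf.
have pos x : x \in `[a, b] -> 0 < x by rewrite in_itv /= => /andP[ax _]; apply: lt_le_trans ax.
rewrite (@continuous_FTC2 R f F) ?EFinB//.
- apply: continuous_in_subspaceT => x /set_mem /= xI.
  by apply: cf; rewrite in_itv /= andbT (pos _ xI).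
- have cF x : 0 < x -> {for x, continuous F}.
    by move=> x0; apply/differentiable_continuous/derivable1_diffP; case: (dF _ x0).
  split.
  + by move=> x xI; have [] := dF _ (pos _ (subset_itv_oo_cc xI)).
  + exact/cvg_at_right_filter/(cF _ a0).
  + exact/cvg_at_left_filter/(cF _ (lt_trans a0 ab)).
- move=> x xI; rewrite derive1E.
  by have [_ <-] := dF _ (pos _ (subset_itv_oo_cc xI)).
Qed.

Lemma measurable_continuous_pos f :
  {in `]0, +oo[, continuous f} -> measurable_fun (`]0%R, +oo[%classic : set R) f.
Proof.
move=> cf; apply: open_continuous_measurable_fun => //.
by move=> x /set_mem; exact: cf.
Qed.

Section FTC.
Context (f F : R -> R) (l0 l1 : R).
Hypothesis dF : forall x, 0 < x -> is_derive x 1 F (f x).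
Hypothesis cf : {in `]0, +oo[, continuous f}.
Hypothesis F0 : F x @[x --> 0^'+] --> l0.
Hypothesis F1 : F x @[x --> +oo] --> l1.

Let integral_I n :
  (\int[mu]_(x in I n) (f x)%:E = (F n.+2%:R - F n.+2%:R^-1)%:E)%E.
Proof. by apply: FTC_pos_interval => //; rewrite ?invr_gt0. Qed.

Let cvg_integral_I :
  (\int[mu]_(x in I n) (f x)%:E @[n --> \oo] --> (l1 - l0)%:E)%E.
Proof.
have ny : (fun n => n.+2%:R : R) @ \oo --> +oo.
  have /cvgryPge h := @cvgr_idn R.
  apply/cvgryPge => A; near=> n.
  by apply: (@le_trans _ _ n%:R); [near: n; exact: h|rewrite ler_nat -addn2 leq_addr].
under eq_fun do rewrite integral_I.
apply: cvg_EFin; first exact: nearW.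
apply: (@cvgB _ _ _ _ _ (fun n => F n.+2%:R) (fun n => F n.+2%:R^-1)).
  exact: (cvg_comp _ _ ny F1).
move/cvg_at_rightP: F0; apply; split; first by move=> n; rewrite invr_gt0.
by apply/gtr0_cvgV0 => //; exact: nearW.
Unshelve. all: by end_near. Qed.

(** Monotone convergence along the exhaustion: integrability is not assumed, and the finite value
    obtained is later used to prove it. *)
Lemma ge0_FTC_pos : (forall x, 0 < x -> 0 <= f x) ->
  (\int[mu]_(x in Rp) (f x)%:E = (l1 - l0)%:E)%E.
Proof.
move=> f0; rewrite I_cover.
apply: (cvg_unique _ _ cvg_integral_I) => //; apply: ge0_nondecreasing_set_cvg_integral => //.
- by move=> n; exact: measurable_itv.
- move=> n; apply/measurable_EFinP.
  apply: (@measurable_funS _ _ _ _ Rp) (measurable_continuous_pos cf) => //.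
  by rewrite I_cover; exact: bigcup_sup.
- by move=> n x /I_pos x0; rewrite lee_fin f0.
Qed.

(** For an integrand without sign, dominated convergence with bound |f| replaces monotone
    convergence. *)
Lemma FTC_pos : mu.-integrable Rp (EFin \o f) ->
  \int[mu]_(x in Rp) f x = l1 - l0.
Proof.
move=> fi; have mf := measurable_continuous_pos cf.
pose f_ n (x : R) := ((f \_ (I n)) x)%:E.
have mf_ n : measurable_fun Rp (f_ n).
  apply/measurable_EFinP/measurable_restrict => //; first exact: measurable_itv.
  by apply: measurable_funS mf => //; exact: subIsetl.
have [| | |_ _] := @dominated_convergence _ _ R mu Rp (measurable_itv _) f_ (EFin \o f)
  (EFin \o (fun x => `|f x|)) mf_ (measurable_int _ fi).
- apply/aeW => x; rewrite I_cover => -[m _ Im].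
  apply: cvg_near_cst; near=> n.
  rewrite /f_ patchE mem_set//.
  have mn : (m <= n)%N by near: n; exact: nbhs_infty_ge.
  by have /subsetPset := I_ndecr mn; exact.
- exact: (integrable_abse fi).
- apply/aeW => x n x0; rewrite /f_ /= lee_fin patchE; case: ifPn => // _.
  by rewrite normr0.
move=> h; suff -> : (\int[mu]_(x in Rp) f x = fine (l1 - l0)%:E)%R by [].
rewrite /Rintegral; congr fine.
apply: (cvg_unique _ _ cvg_integral_I) => //.
move: h; apply: cvg_trans; apply: near_eq_cvg; apply: nearW => n /=.
rewrite /f_ -(setIidr (A := Rp) (B := I n)); last first.
  by rewrite I_cover; exact: bigcup_sup.
rewrite integral_mkcondr; apply: eq_integral => x _.
by rewrite setIidr ?restrict_EFin// I_cover; exact: bigcup_sup.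
Unshelve. all: by end_near. Qed.

End FTC.
End HalfLine.

(** * Functions of the form x^p e^(-k x - c/x) *)

Section PowExp.
Context {R : realType}.
Implicit Types (p k c x e : R).
Local Notation mu := (@lebesgue_measure R).
Local Notation Rp := (`]0%R, +oo[%classic : set R).

Lemma continuous_derivative_pos (f df : R -> R) :
  (forall x, 0 < x -> is_derive x 1 f (df x)) -> {in `]0, +oo[, continuous f}.
Proof.
move=> fdf x; rewrite in_itv /= andbT => x0.
by apply/differentiable_continuous/derivable1_diffP; case: (fdf _ x0).
Qed.

(** For x > 0 this is x^p e^(-k x - c/x). Weights, densities and kernels all have this shape, and
    with a single exponential their products just add parameters. *)
Definition powexp p k c x : R := expR (p * ln x - k * x - c / x).

Lemma powexp_gt0 p k c x : 0 < powexp p k c x.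
Proof. exact: expR_gt0. Qed.

Lemma powexp_ge0 p k c x : 0 <= powexp p k c x.
Proof. exact: expR_ge0. Qed.

Lemma powexpM p k c p' k' c' x :
  powexp p k c x * powexp p' k' c' x = powexp (p + p') (k + k') (c + c') x.
Proof. by rewrite /powexp -expRD; congr expR; ring. Qed.

Lemma powexpX n x : 0 < x -> powexp n%:R 0 0 x = x ^+ n.
Proof. by move=> x0; rewrite /powexp !mul0r !subr0 expRM_natl lnK. Qed.

Lemma powexpV x : 0 < x -> powexp (- 1) 0 0 x = x^-1.
Proof. by move=> x0; rewrite /powexp !mul0r !subr0 mulN1r expRN lnK. Qed.

Lemma powR_powexp p x : 0 < x -> x `^ p = powexp p 0 0 x.
Proof. by move=> x0; rewrite /powexp !mul0r !subr0 /powR gt_eqF. Qed.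

Lemma expR_powexp k x : expR (- (k * x)) = powexp 0 k 0 x.
Proof. by rewrite /powexp !mul0r subr0 sub0r. Qed.

Lemma powexp_divr p k c x : 0 < x -> powexp p k c x / x = powexp (p - 1) k c x.
Proof. by move=> x0; rewrite -powexpV// powexpM !addr0. Qed.

Lemma powexp_mulXr n p k c x : 0 < x ->
  powexp p k c x * x ^+ n = powexp (p + n%:R) k c x.
Proof. by move=> x0; rewrite -powexpX// powexpM !addr0. Qed.

Lemma is_derive_powexp p k c x : 0 < x ->
  is_derive x 1 (powexp p k c) ((p / x - k + c / x ^+ 2) * powexp p k c x).
Proof.
move=> x0; have xn0 : x != 0 by rewrite gt_eqF.
have dl := is_deriveZ p (is_derive1_ln x0).
have di := is_deriveZ c (is_deriveV xn0 (is_derive_id x 1)).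
have dk := is_deriveZ k (is_derive_id x 1).
have d := is_deriveB (is_deriveB dl dk) di.
apply: is_derive_eq (is_derive1_comp (is_derive_expR _) d) _.
by rewrite /powexp /GRing.scale /= mulrC; congr (_ * _); field.
Qed.

Lemma continuous_powexp p k c : {in `]0, +oo[, continuous (powexp p k c)}.
Proof.
apply: (continuous_derivative_pos (df := fun x => (p / x - k + c / x ^+ 2) * powexp p k c x)) => x.
exact: is_derive_powexp.
Qed.

Lemma measurable_powexp p k c : measurable_fun Rp (powexp p k c).
Proof. exact: measurable_continuous_pos (@continuous_powexp p k c). Qed.

Lemma ln_le_linear e : 0 < e -> exists C, forall x, 0 < x -> ln x <= e * x + C.
Proof.
move=> e0; exists (- ln e) => x x0.
have ex0 : 0 < e * x by rewrite mulr_gt0.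
have := @le_ln1Dx R (e * x - 1).
rewrite (_ : 1 + (e * x - 1) = e * x); last ring.
by rewrite lnM ?posrE//; lra.
Qed.

(** For p > 0 the linear term absorbs the logarithm at infinity; for p < 0 the same bound is applied
    at 1/x, and e'/x absorbs it at 0. *)
Lemma powexp_absorb p e e' : 0 < e -> 0 < e' ->
  exists C, forall x, 0 < x -> p * ln x <= e * x + e' / x + C.
Proof.
move=> e0 e'0; have [p0|p0|<-] := ltgtP 0 p; last first.
- exists 0 => x x0; rewrite mul0r addr0 addr_ge0// ?divr_ge0 ?mulr_ge0// ltW//.
- have ep : 0 < e' / - p by rewrite divr_gt0// oppr_gt0.
  have [C hC] := ln_le_linear ep.
  exists (- p * C) => x x0.
  have := hC x^-1; rewrite invr_gt0 lnV ?posrE// => /(_ x0) h.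
  have : - p * - ln x <= - p * (e' / - p / x + C) by rewrite ler_wpM2l//; lra.
  have -> : - p * (e' / - p / x + C) = e' / x - p * C.
    by field; rewrite gt_eqF//= lt_eqF.
  have : 0 < e * x by rewrite mulr_gt0.
  lra.
- have [C hC] := @ln_le_linear (e / p) (divr_gt0 e0 p0).
  exists (p * C) => x x0.
  have : p * ln x <= p * (e / p * x + C) by rewrite ler_wpM2l ?hC// ltW.
  have -> : p * (e / p * x + C) = e * x + p * C by field; rewrite gt_eqF.
  have : 0 < e' / x by rewrite divr_gt0.
  lra.
Qed.

Lemma integrable_dominated (f g : R -> R) (C : R) :
  measurable_fun Rp f -> mu.-integrable Rp (EFin \o g) ->
  (forall x, 0 < x -> `|f x| <= C * g x) -> mu.-integrable Rp (EFin \o f).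
Proof.
move=> mf ig fg; have iCg : mu.-integrable Rp (fun x => (C%:E * (EFin \o g) x)%E) by exact: integrableZl.
apply: le_integrable iCg => //; first exact/measurable_EFinP.
move=> x /=; rewrite in_itv /= andbT => x0; rewrite lee_fin.
exact: le_trans (fg _ x0) (ler_norm _).
Qed.

Lemma integrable_antiderivative (f F : R -> R) (l0 l1 : R) :
  (forall x, 0 < x -> 0 <= f x) ->
  (forall x, 0 < x -> is_derive x 1 F (f x)) -> {in `]0, +oo[, continuous f} ->
  F x @[x --> 0^'+] --> l0 -> F x @[x --> +oo] --> l1 ->
  mu.-integrable Rp (EFin \o f).
Proof.
move=> f0 dF cf F0 F1; apply/integrableP; split.
  by apply/measurable_EFinP; exact: measurable_continuous_pos.
under eq_integral => x /[!inE] /= /[!in_itv] /= /[!andbT] x0 do rewrite ger0_norm ?f0//.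
by rewrite (ge0_FTC_pos dF cf F0 F1 f0) ltry.
Qed.

Lemma cvg_pinfty_dominated (f g : R -> R) (C : R) :
  (forall x, 1 <= x -> `|f x| <= C * g x) -> g x @[x --> +oo] --> 0 ->
  f x @[x --> +oo] --> 0.
Proof.
move=> fg g0; apply/cvgr0Pnorm_lt => e e0.
have Cg : C * g x @[x --> +oo] --> 0.
  rewrite -[X in _ --> X](mulr0 C); apply: (cvg_comp g (fun y => C * y) g0).
  exact: mulrl_continuous.
move/cvgr0Pnorm_lt : Cg => /(_ _ e0) Cg; near=> x.
apply: le_lt_trans (fg x _) _; first by near: x; exact: nbhs_pinfty_ge.
by apply: le_lt_trans (ler_norm _) _; near: x.
Unshelve. all: by end_near. Qed.

Lemma cvg_at_right0_dominated (f g : R -> R) (C : R) :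
  (forall x, 0 < x -> x <= 1 -> `|f x| <= C * g x) -> g x @[x --> 0^'+] --> 0 ->
  f x @[x --> 0^'+] --> 0.
Proof.
move=> fg g0; apply/cvgr0Pnorm_lt => e e0.
have Cg : C * g x @[x --> 0^'+] --> 0.
  rewrite -[X in _ --> X](mulr0 C); apply: (cvg_comp g (fun y => C * y) g0).
  exact: mulrl_continuous.
move/cvgr0Pnorm_lt : Cg => /(_ _ e0) Cg; near=> x.
apply: le_lt_trans (fg x _ _) _ => //.
  by near: x; exact: nbhs_right_le.
by apply: le_lt_trans (ler_norm _) _; near: x.
Unshelve. all: by end_near. Qed.

Lemma expRNV_cvg0 c : 0 < c -> expR (- (c / x)) @[x --> 0^'+] --> (0 : R).
Proof.
move=> c0; apply: (@cvg_at_right0_dominated _ id c^-1); last exact: cvg_at_right_filter.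
move=> x x0 _; rewrite ger0_norm ?expR_ge0// expRN.
have cx : 0 < c / x by rewrite divr_gt0.
have -> : c^-1 * x = (c / x)^-1 by rewrite invfM invrK.
by rewrite lef_pV2 ?posrE ?expR_gt0//; have := expR_ge1Dx (c / x); lra.
Qed.

Lemma expRN_cvg0 c : 0 < c -> expR (- (c * x)) @[x --> +oo] --> (0 : R).
Proof.
move=> c0; apply: (cvg_comp (fun x => c * x) (fun x => expR (- x)) _ (@cvgr_expR R)).
exact: gt0_cvgMry.
Qed.

Lemma powexp_cvg_pinfty p k c : 0 < k -> 0 <= c -> powexp p k c x @[x --> +oo] --> 0.
Proof.
move=> k0 c0; have [C hC] := @powexp_absorb p (k / 2) 1 (divr_gt0 k0 (ltr0Sn _ 1)) ltr01.
apply: (@cvg_pinfty_dominated _ (fun x => expR (- ((k / 2) * x))) (expR (C + 1))); last first.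
  by apply: expRN_cvg0; rewrite divr_gt0.
move=> x x1; have x0 : 0 < x by lra.
rewrite ger0_norm ?powexp_ge0// /powexp -expRD ler_expR.
have := hC _ x0; have : 0 <= c / x by rewrite divr_ge0// ltW.
have : 1 / x <= 1 by rewrite ler_pdivrMr//; lra.
lra.
Qed.

Lemma powexp_cvg0_ess p k c : 0 <= k -> 0 < c -> powexp p k c x @[x --> 0^'+] --> 0.
Proof.
move=> k0 c0; have [C hC] := @powexp_absorb p 1 (c / 2) ltr01 (divr_gt0 c0 (ltr0Sn _ 1)).
apply: (@cvg_at_right0_dominated _ (fun x => expR (- ((c / 2) / x))) (expR (C + 1))); last first.
  by apply: expRNV_cvg0; rewrite divr_gt0.
move=> x x0 x1.
rewrite ger0_norm ?powexp_ge0// /powexp -expRD ler_expR.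
have := hC _ x0; have : 0 <= k * x by rewrite mulr_ge0// ltW.
lra.
Qed.

Lemma powexp_cvg0 p k : 0 < p -> 0 <= k -> powexp p k 0 x @[x --> 0^'+] --> 0.
Proof.
move=> p0 k0; apply: (@cvg_at_right0_dominated _ (fun x => x `^ p) 1); last first.
  exact: powR_cvg0.
move=> x x0 x1; rewrite ger0_norm ?powexp_ge0// powR_powexp// mul1r /powexp ler_expR.
have : 0 <= k * x by rewrite mulr_ge0// ltW.
lra.
Qed.

(** Comparison with (c/2) x^(-2) e^(-c/(2x)), the derivative of e^(-c/(2x)). The other half of c,
    together with k, absorbs the factor x^(p+2). *)
Lemma integrable_powexp_ess p k c : 0 < k -> 0 < c ->
  mu.-integrable Rp (EFin \o powexp p k c).
Proof.
move=> k0 c0.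
have i2 : mu.-integrable Rp (EFin \o (fun x => (c / 2) * powexp (- 2) 0 (c / 2) x)).
  apply: (@integrable_antiderivative (fun x => (c / 2) * powexp (- 2) 0 (c / 2) x) (powexp 0 0 (c / 2)) 0 1).
  - by move=> x x0; rewrite mulr_ge0 ?powexp_ge0//; lra.
  - move=> x x0; apply: is_derive_eq (is_derive_powexp 0 0 (c / 2) x0) _.
        have -> : powexp (- 2) 0 (c / 2) x = powexp 0 0 (c / 2) x / x / x.
      by rewrite 2!(powexp_divr _ _ _ x0) (_ : 0 - 1 - 1 = - 2 :> R); last ring.
    by field; rewrite gt_eqF.
  - move=> x xI; apply: cvgM; first exact: cvg_cst.
    exact: continuous_powexp.
  - by apply: powexp_cvg0_ess => //; lra.
  - rewrite /powexp; under eq_fun do rewrite !mul0r subr0 sub0r.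
    suff : expR (- (c / 2 / x)) @[x --> +oo] --> expR (- (c / 2 * 0)) by rewrite mulr0 oppr0 expR0.
    apply: (cvg_comp (fun x : R => - (c / 2 / x))); last exact: continuous_expR.
    apply: cvgN.
    apply: cvgM; first exact: cvg_cst.
    by apply/gtr0_cvgV0 => //; exact: nbhs_pinfty_gt.
have [C hC] := @powexp_absorb (p + 2) k (c / 2) k0 (divr_gt0 c0 (ltr0Sn _ 1)).
apply: (integrable_dominated (C := expR C * (c / 2)^-1) _ i2); first exact: measurable_powexp.
move=> x x0; rewrite ger0_norm ?powexp_ge0// -mulrA mulKf; last by rewrite gt_eqF//; lra.
rewrite /powexp -expRD ler_expR.
have := hC _ x0; lra.
Qed.

(** Comparison with the derivative of (x/(1+x))^s for s = p+1, which increases from 0 to 1. That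
    derivative has the right order x^p at 0, and e^(-k x) absorbs the missing factor (1+x)^(p+2). *)
Lemma integrable_powexp p k : -1 < p -> 0 < k -> mu.-integrable Rp (EFin \o powexp p k 0).
Proof.
move=> p1 k0; pose s := p + 1; have s0 : 0 < s by rewrite /s; lra.
pose D x : R := s * expR ((s - 1) * ln x - (s + 1) * ln (1 + x)).
have dln x : 0 < x -> is_derive x 1 (fun x : R => ln (1 + x)) (1 + x)^-1.
  move=> x0; have x10 : 0 < 1 + x by lra.
  have d1 := is_deriveD (@is_derive_cst R R R 1 x 1) (is_derive_id x 1).
  apply: is_derive_eq (is_derive1_comp (is_derive1_ln x10) d1) _.
  by rewrite add0r mulr1.
have iD : mu.-integrable Rp (EFin \o D).
  apply: (@integrable_antiderivative D (fun x => expR (s * (ln x - ln (1 + x)))) 0 1).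
  - by move=> x x0; rewrite mulr_ge0 ?expR_ge0 ?ltW.
  - move=> x x0; have d := is_deriveZ s (is_deriveB (is_derive1_ln x0) (dln _ x0)).
    apply: is_derive_eq (is_derive1_comp (is_derive_expR _) d) _.
    rewrite /D /GRing.scale /= mulrCA; congr (_ * _).
    have -> : (s - 1) * ln x - (s + 1) * ln (1 + x) = s * (ln x - ln (1 + x)) - ln x - ln (1 + x) by ring.
    rewrite !expRD !expRN !lnK ?posrE//; last lra.
    by field; lra.
  - apply: (@continuous_derivative_pos _ (fun x => s * (expR ((s - 1) * ln x - (s + 1) * ln (1 + x)) * ((s - 1) * x^-1 - (s + 1) * (1 + x)^-1)))).
    move=> x x0; have d := is_deriveB (is_deriveZ (s - 1) (is_derive1_ln x0)) (is_deriveZ (s + 1) (dln _ x0)).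
    exact: (is_deriveZ s (is_derive1_comp (is_derive_expR _) d)).
  - apply: (@cvg_at_right0_dominated _ (powexp s 0 0) 1); last exact: powexp_cvg0.
    move=> x x0 _; rewrite mul1r ger0_norm ?expR_ge0// ler_expR !mul0r !subr0 mulrBr.
    by rewrite gerBl mulr_ge0// ?ln_ge0 ?ltW//; lra.
  - suff : expR (s * (ln x - ln (1 + x))) @[x --> +oo] --> expR (s * 0) by rewrite mulr0 expR0.
    apply: (cvg_comp (fun x : R => s * (ln x - ln (1 + x)))); last exact: continuous_expR.
    apply: cvgM; first exact: cvg_cst.
    apply: (@cvg_pinfty_dominated _ (fun x => x^-1) 1); last first.
      by apply/gtr0_cvgV0 => //; exact: nbhs_pinfty_gt.
    move=> x x1; have x0 : 0 < x by lra.
    rewrite mul1r ler0_norm ?opprB; last by rewrite subr_le0 ler_ln ?posrE//; lra.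
    have xi0 : 0 < x^-1 by rewrite invr_gt0.
    have -> : 1 + x = x * (1 + x^-1) by rewrite mulrDr mulr1 divff ?gt_eqF// addrC.
    by rewrite lnM ?posrE//; [rewrite addrAC subrr add0r le_ln1Dx//|]; lra.
have kp : 0 < k / (p + 2) by rewrite divr_gt0//; lra.
have [C hC] := ln_le_linear kp.
apply: (integrable_dominated (C := s^-1 * expR ((p + 2) * C + k)) _ iD).
  exact: measurable_powexp.
move=> x x0; rewrite ger0_norm ?powexp_ge0// /D mulrACA mulVf ?gt_eqF// mul1r.
rewrite /powexp -expRD ler_expR /s mul0r subr0.
have : (p + 2) * ln (1 + x) <= (p + 2) * (k / (p + 2) * (1 + x) + C).
  by rewrite ler_wpM2l ?hC//; lra.
have -> : (p + 2) * (k / (p + 2) * (1 + x) + C) = k * (1 + x) + (p + 2) * C by field; lra.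
lra.
Qed.

(** Without exponential decay at infinity the power must be integrable there. The comparison is with
    the derivative of -(1+x)^(-q) for q = -p-1; the quotient is of order (1+1/x)^(q+1), which
    e^(-c/x) absorbs. *)
Lemma integrable_powexp_tail p c : p < -1 -> 0 < c -> mu.-integrable Rp (EFin \o powexp p 0 c).
Proof.
move=> p1 c0; pose q := - p - 1; have q0 : 0 < q by rewrite /q; lra.
pose D x : R := q * expR (- ((q + 1) * ln (1 + x))).
have dln x : 0 < x -> is_derive x 1 (fun x : R => ln (1 + x)) (1 + x)^-1.
  move=> x0; have x10 : 0 < 1 + x by lra.
  have d1 := is_deriveD (@is_derive_cst R R R 1 x 1) (is_derive_id x 1).
  apply: is_derive_eq (is_derive1_comp (is_derive1_ln x10) d1) _.
  by rewrite add0r mulr1.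
have iD : mu.-integrable Rp (EFin \o D).
  apply: (@integrable_antiderivative D (fun x => - expR (- (q * ln (1 + x)))) (- 1) 0).
  - by move=> x x0; rewrite mulr_ge0 ?expR_ge0 ?ltW.
  - move=> x x0; have d := is_deriveN (is_deriveZ q (dln _ x0)).
    apply: is_derive_eq (is_deriveN (is_derive1_comp (is_derive_expR _) d)) _.
    rewrite /D /GRing.scale /= mulrN opprK mulrCA; congr (_ * _).
    have -> : (- (q \*: (fun y => ln (1 + y)))) x = - (q * ln (1 + x)) by [].
    rewrite [in RHS]mulrDl opprD expRD mul1r.
    by congr (_ * _); rewrite expRN lnK// posrE; lra.
  - apply: (@continuous_derivative_pos _ (fun x => q * (expR (- ((q + 1) * ln (1 + x))) * (- ((q + 1) * (1 + x)^-1))))).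
    move=> x x0; have d := is_deriveN (is_deriveZ (q + 1) (dln _ x0)).
    exact: (is_deriveZ q (is_derive1_comp (is_derive_expR _) d)).
  - apply: cvgN; suff : expR (- (q * ln (1 + x))) @[x --> 0^'+] --> expR (- (q * ln (1 + 0))).
      by rewrite addr0 ln1 mulr0 oppr0 expR0.
    apply: (cvg_comp (fun x : R => - (q * ln (1 + x)))); last exact: continuous_expR.
    apply: cvgN; apply: cvgM; first exact: cvg_cst.
    apply: (cvg_comp (fun x : R => 1 + x)); last by apply: continuous_ln; lra.
    by apply: cvgD; [exact: cvg_cst|exact: cvg_at_right_filter].
  - rewrite -[X in _ --> X]oppr0; apply: cvgN.
    apply: (cvg_comp (fun x : R => q * ln (1 + x)) (fun x => expR (- x)) _ (@cvgr_expR R)).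
    apply: gt0_cvgMry => //; apply/cvgryPge => A; near=> x.
    rewrite -(expRK A) ler_ln ?posrE ?expR_gt0//; last first.
      by rewrite addr_gt0//; near: x; exact: nbhs_pinfty_gt.
    apply: (@le_trans _ _ x); last by rewrite lerDr.
    by near: x; exact: nbhs_pinfty_ge.
have cq : 0 < c / (q + 1) by rewrite divr_gt0//; lra.
have [C hC] := ln_le_linear cq.
apply: (integrable_dominated (C := q^-1 * expR ((q + 1) * C + c)) _ iD).
  exact: measurable_powexp.
move=> x x0; rewrite ger0_norm ?powexp_ge0// /D mulrACA mulVf ?gt_eqF// mul1r.
have xi0 : 0 < x^-1 by rewrite invr_gt0.
rewrite /powexp -expRD ler_expR mul0r subr0 /=.
have : (q + 1) * ln (1 + x^-1) <= (q + 1) * (c / (q + 1) * (1 + x^-1) + C).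
  by rewrite ler_wpM2l ?hC//; lra.
have -> : (q + 1) * (c / (q + 1) * (1 + x^-1) + C) = c + c / x + (q + 1) * C.
  by field; rewrite !gt_eqF//=; lra.
have -> : ln (1 + x^-1) = ln (1 + x) - ln x.
  have -> : 1 + x = x * (1 + x^-1) by rewrite mulrDr mulr1 divff ?gt_eqF// addrC.
  by rewrite lnM ?posrE// 1?addrC ?addKr//; lra.
rewrite /q; lra.
Unshelve. all: by end_near. Qed.
End PowExp.

(** * Real-valued integrals over the half-line *)

Section PosIntegral.
Context {R : realType}.
Implicit Types (f g : R -> R) (c x : R).
Local Notation mu := (@lebesgue_measure R).
Local Notation Rp := (`]0%R, +oo[%classic : set R).

Definition posint f : R := \int[mu]_(x in Rp) f x.

Definition posintegrable f : Prop := mu.-integrable Rp (EFin \o f).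

Lemma eq_posint f g : (forall x, 0 < x -> f x = g x) -> posint f = posint g.
Proof.
move=> fg; apply: eq_Rintegral => x; rewrite inE /= in_itv /= andbT => x0.
exact: fg.
Qed.

Lemma eq_posintegrable f g : (forall x, 0 < x -> f x = g x) ->
  posintegrable f -> posintegrable g.
Proof.
move=> fg; apply: eq_integrable => // x; rewrite inE /= in_itv /= andbT => x0.
by rewrite fg.
Qed.

Lemma posintegrableD f g : posintegrable f -> posintegrable g ->
  posintegrable (fun x => f x + g x).
Proof. by move=> jf jg; exact: (integrableD _ jf jg). Qed.

Lemma posintegrableZ c f : posintegrable f -> posintegrable (fun x => c * f x).
Proof. by move=> jf; exact: (integrableZl _ c jf). Qed.

Lemma posintegrableB f g : posintegrable f -> posintegrable g ->
  posintegrable (fun x => f x - g x).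
Proof. by move=> jf jg; exact: (integrableB _ jf jg). Qed.

Lemma posintegrable0 : posintegrable (fun=> 0).
Proof. exact: integrable0. Qed.

Lemma posintegrable_le f g : measurable_fun Rp f -> posintegrable g ->
  (forall x, 0 < x -> `|f x| <= g x) -> posintegrable f.
Proof.
move=> mf jg fg; apply: (integrable_dominated (C := 1) mf jg) => x x0.
by rewrite mul1r fg.
Qed.

Lemma posintD f g : posintegrable f -> posintegrable g ->
  posint (fun x => f x + g x) = posint f + posint g.
Proof. by move=> jf jg; exact: RintegralD. Qed.

Lemma posintB f g : posintegrable f -> posintegrable g ->
  posint (fun x => f x - g x) = posint f - posint g.
Proof. by move=> jf jg; exact: RintegralB. Qed.

Lemma posintZ c f : posintegrable f -> posint (fun x => c * f x) = c * posint f.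
Proof. by move=> jf; exact: RintegralZl. Qed.

Lemma posint_ge0 f : (forall x, 0 < x -> 0 <= f x) -> 0 <= posint f.
Proof.
move=> f0; apply: Rintegral_ge0 => x; rewrite /= in_itv /= andbT; exact: f0.
Qed.

Lemma le_posint f g : posintegrable f -> posintegrable g ->
  (forall x, 0 < x -> f x <= g x) -> posint f <= posint g.
Proof.
move=> jf jg fg; apply: le_Rintegral => // x; rewrite /= in_itv /= andbT; exact: fg.
Qed.

Lemma le_norm_posint f g : posintegrable f -> posintegrable g ->
  (forall x, 0 < x -> `|f x| <= g x) -> `|posint f| <= posint g.
Proof.
move=> jf jg fg.
have jn : posintegrable (fun x => `|f x|) by exact: (integrable_abse jf).
by apply: le_trans (le_normr_Rintegral _ jf) _ => //; exact: le_posint.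
Qed.

End PosIntegral.

(** * Laguerre expansions *)

Section Sobolev.
Context {R : realType}.
Implicit Types (f g h dh dg : R -> R) (p q : {poly R}) (alpha c x : R).
Local Notation mu := (@lebesgue_measure R).
Local Notation Rp := (`]0%R, +oo[%classic : set R).

(** The gamma weight of rate one, left unnormalised: its integral is Gamma(alpha+1). *)
Definition gweight alpha : R -> R := powexp alpha 1 0.

Lemma gweight_gt0 alpha x : 0 < gweight alpha x.
Proof. exact: powexp_gt0. Qed.

Lemma gweightS alpha x : 0 < x -> gweight (alpha + 1) x = x * gweight alpha x.
Proof. by move=> x0; rewrite mulrC /gweight -[X in _ * X]expr1 powexp_mulXr. Qed.

(* The last two fields make the boundary terms vanish when the product of [h] with a
   polynomial is integrated by parts. *)
Record sobolev alpha h dh : Prop := Sobolev {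
  sobolev_derive : forall x, 0 < x -> is_derive x 1 h (dh x);
  sobolev_continuous : {in `]0, +oo[, continuous dh};
  sobolev_sqr : posintegrable (fun x => h x ^+ 2 * gweight alpha x);
  sobolev_dsqr : posintegrable (fun x => x * dh x ^+ 2 * gweight alpha x);
  sobolev_0 : forall n, h x * x ^+ n.+1 * gweight alpha x @[x --> 0^'+] --> 0;
  sobolev_y : forall n, h x * x ^+ n.+1 * gweight alpha x @[x --> +oo] --> 0 }.

Lemma continuous_horner_pos p : {in `]0, +oo[, continuous (fun x => p.[x])}.
Proof.
by apply: (continuous_derivative_pos (df := fun x => p^`().[x])) => x _; exact: is_derive_poly.
Qed.

Lemma posintegrable_monomial alpha n : -1 < alpha ->
  posintegrable (fun x => x ^+ n * gweight alpha x).
Proof.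
move=> a1; apply: (@eq_posintegrable _ (powexp (alpha + n%:R) 1 0)).
  by move=> x x0; rewrite -powexp_mulXr// mulrC.
by apply: integrable_powexp => //; apply: ltr_wpDr.
Qed.

Lemma posintegrable_poly alpha p : -1 < alpha ->
  posintegrable (fun x => p.[x] * gweight alpha x).
Proof.
move=> a1; suff : forall n, posintegrable (fun x => x ^+ n * p.[x] * gweight alpha x).
  by move=> /(_ 0); apply: eq_posintegrable => x _; rewrite expr0 mul1r.
elim/poly_ind: p => [|p c IH] n.
  by apply: eq_posintegrable (@posintegrable0 R) => x _; rewrite horner0 mulr0 mul0r.
apply: eq_posintegrable (posintegrableD (IH n.+1) (posintegrableZ c (posintegrable_monomial n a1))).
by move=> x _; rewrite hornerMXaddC exprS; ring.
Qed.

Lemma near_cvg0 {T : Type} (F : set_system T) {FF : Filter F} (u v : T -> R) :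
  (\forall x \near F, u x = v x) -> v x @[x --> F] --> 0 -> u x @[x --> F] --> 0.
Proof.
move=> uv; apply: cvg_trans; apply: near_eq_cvg.
by apply: filterS uv => x /esym.
Qed.

Lemma cvg0_lin {T : Type} (F : set_system T) {FF : Filter F} (u v : T -> R) c :
  u x @[x --> F] --> 0 -> v x @[x --> F] --> 0 -> u x + c * v x @[x --> F] --> 0.
Proof.
move=> u0 v0; have cv0 : c * v x @[x --> F] --> c * 0.
  exact: (cvg_comp v (fun y => c * y) v0 (@mulrl_continuous _ c 0)).
by have := @cvgD _ _ _ _ FF _ _ _ _ u0 cv0; rewrite mulr0 addr0.
Qed.

Lemma cvg_poly_boundary (F : set_system R) {FF : Filter F} (u : R -> R) p :
  (forall n, u x * x ^+ n.+1 @[x --> F] --> 0) -> u x * (x * p.[x]) @[x --> F] --> 0.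
Proof.
move=> u0; suff : forall n, u x * (x ^+ n.+1 * p.[x]) @[x --> F] --> 0 by move=> /(_ 0).
elim/poly_ind: p => [|p c IH] n.
  by apply: (near_cvg0 (v := cst 0)); [apply: nearW => x; rewrite horner0 !mulr0|exact: cvg_cst].
apply: near_cvg0 (cvg0_lin c (IH n.+1) (u0 n)); apply: nearW => x.
by rewrite hornerMXaddC [x ^+ n.+2]exprS; ring.
Qed.

Lemma sobolev_poly alpha p : -1 < alpha ->
  sobolev alpha (fun x => p.[x]) (fun x => p^`().[x]).
Proof.
move=> a1; split.
- by move=> x _; exact: is_derive_poly.
- exact: continuous_horner_pos.
- apply: eq_posintegrable (posintegrable_poly (p ^+ 2) a1) => x _.
  by rewrite horner_exp.
- apply: eq_posintegrable (posintegrable_poly ('X * p^`() ^+ 2) a1) => x _.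
  by rewrite hornerM hornerX horner_exp.
- move=> n; apply: (@near_cvg0 _ _ _ _ (fun x => gweight alpha x * (x * (p * 'X^n).[x]))).
    by apply: nearW => x; rewrite hornerM hornerXn exprS; ring.
  apply: cvg_poly_boundary => m.
  apply: (@near_cvg0 _ _ _ _ (powexp (alpha + m.+1%:R) 1 0)); last first.
    by apply: powexp_cvg0 => //; rewrite -natr1; have := ler0n R m; lra.
  by near=> x; rewrite -powexp_mulXr.
- move=> n; apply: (@near_cvg0 _ _ _ _ (fun x => gweight alpha x * (x * (p * 'X^n).[x]))).
    by apply: nearW => x; rewrite hornerM hornerXn exprS; ring.
  apply: cvg_poly_boundary => m.
  apply: (@near_cvg0 _ _ _ _ (powexp (alpha + m.+1%:R) 1 0)); last exact: powexp_cvg_pinfty.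
  by near=> x; rewrite -powexp_mulXr//; near: x; exact: nbhs_pinfty_gt.
Unshelve. all: by end_near. Qed.

Lemma measurable_sobolev alpha h dh : sobolev alpha h dh ->
  measurable_fun Rp h /\ measurable_fun Rp dh.
Proof.
move=> sh; split; apply: measurable_continuous_pos; last exact: sobolev_continuous sh.
exact: continuous_derivative_pos (sobolev_derive sh).
Qed.

Lemma posintegrable_mul alpha f g : measurable_fun Rp f -> measurable_fun Rp g ->
  posintegrable (fun x => f x ^+ 2 * gweight alpha x) ->
  posintegrable (fun x => g x ^+ 2 * gweight alpha x) ->
  posintegrable (fun x => f x * g x * gweight alpha x).
Proof.
move=> mf mg jf jg; apply: (posintegrable_le _ (posintegrableD jf jg)).
  by do 2?[apply: measurable_funM => //]; exact: measurable_powexp.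
move=> x x0; rewrite normrM (ger0_norm (ltW (gweight_gt0 _ _))) -mulrDl.
rewrite ler_wpM2r ?(ltW (gweight_gt0 _ _))// normrM.
have := sqr_ge0 (`|f x| - `|g x|); rewrite sqrrB !real_normK ?num_real// -mulr_natl.
have := sqr_ge0 (f x); have := sqr_ge0 (g x); lra.
Qed.

Lemma posintegrable_dmul alpha f g : measurable_fun Rp f -> measurable_fun Rp g ->
  posintegrable (fun x => x * f x ^+ 2 * gweight alpha x) ->
  posintegrable (fun x => x * g x ^+ 2 * gweight alpha x) ->
  posintegrable (fun x => x * (f x * g x) * gweight alpha x).
Proof.
have wS u : posintegrable (fun x => x * u x * gweight alpha x) <->
    posintegrable (fun x => u x * gweight (alpha + 1) x).
  by split; apply: eq_posintegrable => x x0; rewrite gweightS//; ring.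
by move=> mf mg /wS jf /wS jg; apply/wS; exact: posintegrable_mul.
Qed.

Lemma sobolevB alpha h dh g dg : sobolev alpha h dh -> sobolev alpha g dg ->
  sobolev alpha (fun x => h x - g x) (fun x => dh x - dg x).
Proof.
move=> sh sg.
have [mh mdh] := measurable_sobolev sh; have [mg mdg] := measurable_sobolev sg.
split.
- by move=> x x0; exact: is_deriveB (sobolev_derive sh x0) (sobolev_derive sg x0).
- by move=> x xI; apply: cvgB; [exact: sobolev_continuous sh _ _|exact: sobolev_continuous sg _ _].
- have j1 := posintegrable_mul mh mg (sobolev_sqr sh) (sobolev_sqr sg).
  apply: eq_posintegrable (posintegrableD (posintegrableB (sobolev_sqr sh)
    (posintegrableZ 2 j1)) (sobolev_sqr sg)) => x _; ring.
- have j1 := posintegrable_dmul mdh mdg (sobolev_dsqr sh) (sobolev_dsqr sg).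
  apply: eq_posintegrable (posintegrableD (posintegrableB (sobolev_dsqr sh)
    (posintegrableZ 2 j1)) (sobolev_dsqr sg)) => x _; ring.
- move=> n; apply: near_cvg0 (cvg0_lin (- 1) (sobolev_0 sh n) (sobolev_0 sg n)).
  by apply: nearW => x; ring.
- move=> n; apply: near_cvg0 (cvg0_lin (- 1) (sobolev_y sh n) (sobolev_y sg n)).
  by apply: nearW => x; ring.
Qed.

(* The Laguerre polynomial of degree [k] is an eigenvector for the eigenvalue [-k]. *)
Definition laguerre_op alpha p : {poly R} := 'X * p^`()^`() + ((alpha + 1)%:P - 'X) * p^`().

Lemma posintegrable_sobolev_poly alpha h dh p : -1 < alpha -> sobolev alpha h dh ->
  posintegrable (fun x => h x * p.[x] * gweight alpha x) /\
  posintegrable (fun x => x * (dh x * p.[x]) * gweight alpha x).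
Proof.
move=> a1 sh; have [mh mdh] := measurable_sobolev sh.
have mp : measurable_fun Rp (fun x => p.[x]).
  by apply: measurable_continuous_pos; exact: continuous_horner_pos.
split.
  by apply: posintegrable_mul (sobolev_sqr sh) (sobolev_sqr (sobolev_poly p a1)).
apply: posintegrable_dmul (sobolev_dsqr sh) _ => //.
apply: eq_posintegrable (posintegrable_poly ('X * p ^+ 2) a1) => x _.
by rewrite hornerM hornerX horner_exp.
Qed.

(** Since w' = (alpha/x - 1) w, the Laguerre operator has the Sturm-Liouville form (x w p')' = w L
    p. The integrand of the difference is thus the derivative of h x p' w, which vanishes at both
    ends. *)
Lemma laguerre_by_parts alpha h dh p : -1 < alpha -> sobolev alpha h dh ->
  posint (fun x => x * (dh x * p^`().[x]) * gweight alpha x) =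
  - posint (fun x => h x * (laguerre_op alpha p).[x] * gweight alpha x).
Proof.
move=> a1 sh.
have [j1 _] := posintegrable_sobolev_poly (laguerre_op alpha p) a1 sh.
have [_ j2] := posintegrable_sobolev_poly p^`() a1 sh.
apply/eqP; rewrite -addr_eq0 -posintD//.
pose F x := h x * (x * p^`().[x]) * gweight alpha x.
have ch : {in `]0, +oo[, continuous h} by exact: continuous_derivative_pos (sobolev_derive sh).
have cdh := sobolev_continuous sh.
have dF x : 0 < x -> is_derive x 1 F (x * (dh x * p^`().[x]) * gweight alpha x +
    h x * (laguerre_op alpha p).[x] * gweight alpha x).
  move=> x0; have dq := is_derive_poly ('X * p^`()) x.
  have d := is_deriveM (is_deriveM (sobolev_derive sh x0) dq) (is_derive_powexp alpha 1 0 x0).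
  have -> : F = ((h : R -> R) * (fun x : R => ('X * p^`()).[x]) * gweight alpha)%R.
    by apply/funext => y; rewrite !fctE hornerM hornerX.
  apply: is_derive_eq d _.
  rewrite /GRing.scale /= !fctE derivM derivX /laguerre_op !(hornerD, hornerM, hornerX, hornerN, hornerC) mul1r.
  by rewrite /gweight; field; rewrite gt_eqF.
rewrite /posint (FTC_pos dF (l0 := 0) (l1 := 0)) ?subrr//.
- move=> x xI; apply: cvgD; apply: cvgM; try exact: continuous_powexp.
    apply: cvgM; first exact: cvg_id.
    by apply: cvgM; [exact: cdh|exact: continuous_horner_pos].
  by apply: cvgM; [exact: ch|exact: continuous_horner_pos].
- have b := @cvg_poly_boundary (0^'+) _ (fun x => h x * gweight alpha x) p^`().
  rewrite /F; under eq_fun do rewrite mulrAC; apply: b => n.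
  under eq_fun do rewrite mulrAC; exact: sobolev_0 sh n.
- have b := @cvg_poly_boundary (pinfty_nbhs R) _ (fun x => h x * gweight alpha x) p^`().
  rewrite /F; under eq_fun do rewrite mulrAC; apply: b => n.
  under eq_fun do rewrite mulrAC; exact: sobolev_y sh n.
- exact: posintegrableD j2 j1.
Qed.

End Sobolev.

(** * Algebra of the Laguerre polynomials *)

Section LaguerrePolynomials.
Context {R : realType}.
Implicit Types (alpha x : R) (p q : {poly R}).

Definition lagpoly alpha (k : nat) : {poly R} :=
  \poly_(i < k.+1) (gbinom (k%:R + alpha) (k - i) * (- 1) ^+ i / i`!%:R).

Lemma laguerreE alpha k x : laguerre alpha k x = (lagpoly alpha k).[x].
Proof.
rewrite /laguerre horner_poly; apply: eq_bigr => i _.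
by rewrite (exprNn x i) mulrA (mulrAC _ (x ^+ i)).
Qed.

Lemma coef_derivE p i : p^`()`_i = i.+1%:R * p`_i.+1.
Proof. by rewrite coef_deriv mulr_natl. Qed.

Lemma fallingS x n : falling x n.+1 = falling x n * (x - n%:R).
Proof. by rewrite /falling big_ord_recr. Qed.

Lemma lagpoly0 alpha : lagpoly alpha 0 = 1.
Proof.
apply/polyP => -[|i]; rewrite coef_poly coef1 //=.
by rewrite /gbinom /falling big_ord0 fact0 expr0 !mulr1 !divr1.
Qed.

(** Laguerre's differential equation read on coefficients. At i = k the left side vanishes by degree
    and the right side by its factor, which is how the recurrence stops. *)
Lemma coef_lagpolyS alpha k i :
  (i.+1%:R * (i%:R + alpha + 1)) * (lagpoly alpha k)`_i.+1 =
  (i%:R - k%:R) * (lagpoly alpha k)`_i.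
Proof.
rewrite !coef_poly !ltnS; have [ik|ki|->] := ltngtP i k.
- have -> : (k - i = (k - i.+1).+1)%N by rewrite subnSK.
  rewrite /gbinom fallingS !factS !natrM exprS subnSK//.
  have -> : k%:R + alpha - (k - i.+1)%:R = i%:R + alpha + 1.
    by rewrite natrB// -natr1; ring.
  have -> : i%:R - k%:R = - (k - i)%:R :> R by rewrite natrB 1?ltnW// opprB.
  have f1 : (k - i.+1)`!%:R != 0 :> R by rewrite pnatr_eq0 -lt0n fact_gt0.
  have f2 : i`!%:R != 0 :> R by rewrite pnatr_eq0 -lt0n fact_gt0.
  have f3 : (k - i)%:R != 0 :> R by rewrite pnatr_eq0 subn_eq0 -ltnNge.
  have f4 : i.+1%:R != 0 :> R by rewrite pnatr_eq0.
  move: i.+1%:R f4 => u f4; field; by rewrite f1 f2 f3 f4.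
- by rewrite !mulr0.
- by rewrite subrr mul0r mulr0.
Qed.

Lemma coef_laguerre_op alpha p i : (laguerre_op alpha p)`_i =
  i.+1%:R * (i%:R + alpha + 1) * p`_i.+1 - i%:R * p`_i.
Proof.
rewrite /laguerre_op mulrBl !coefD coefN coefCM !coefXM.
case: i => [|i] /=; rewrite !coef_derivE; first by ring.
by rewrite -[i.+2%:R]natr1 -[i.+1%:R]natr1; ring.
Qed.

Lemma laguerre_op_lagpoly alpha k :
  laguerre_op alpha (lagpoly alpha k) = - k%:R *: lagpoly alpha k.
Proof.
by apply/polyP => i; rewrite coef_laguerre_op coef_lagpolyS coefZ; ring.
Qed.

Lemma size_laguerre_op alpha p : (size (laguerre_op alpha p) <= size p)%N.
Proof.
apply/leq_sizeP => j pj.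
by rewrite coef_laguerre_op !nth_default ?mulr0 ?subr0//; exact: leqW.
Qed.

Lemma deriv_lagpoly alpha k : (lagpoly alpha k.+1)^`() = - lagpoly (alpha + 1) k.
Proof.
apply/polyP => i; rewrite coef_derivE coefN !coef_poly !ltnS; case: ifP => _; last first.
  by rewrite mulr0 oppr0.
rewrite subSS exprS factS natrM.
have -> : k.+1%:R + alpha = k%:R + (alpha + 1) by rewrite -natr1; ring.
have f2 : i`!%:R != 0 :> R by rewrite pnatr_eq0 -lt0n fact_gt0.
have f4 : i.+1%:R != 0 :> R by rewrite pnatr_eq0.
by move: i.+1%:R f4 => u f4; field; rewrite f2 f4.
Qed.

Lemma coef_lagpoly_diag alpha k : (lagpoly alpha k)`_k != 0.
Proof.
rewrite coef_poly ltnSn subnn /gbinom /falling big_ord0 fact0 divr1 mul1r.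
by rewrite mulf_neq0 ?signr_eq0// invr_eq0 pnatr_eq0 -lt0n fact_gt0.
Qed.

Lemma size_lagpoly alpha k : (size (lagpoly alpha k) <= k.+1)%N.
Proof. exact: size_poly. Qed.

(** The Laguerre polynomials form a triangular basis: the coefficient of degree k of the k-th one is
    nonzero, so subtracting a multiple of it lowers the size. Linear properties need only be checked
    on this basis. *)
Lemma poly_lagpoly_ind (A : {poly R} -> Prop) alpha n :
  A 0 -> (forall p q c, A p -> A q -> A (p + c *: q)) ->
  (forall k, (k < n)%N -> A (lagpoly alpha k)) ->
  forall p, (size p <= n)%N -> A p.
Proof.
move=> A0 Alin; elim: n => [|n IH] AL p.
  by rewrite leqn0 size_poly_eq0 => /eqP ->.
move=> pn; pose c := p`_n / (lagpoly alpha n)`_n.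
have -> : p = (p - c *: lagpoly alpha n) + c *: lagpoly alpha n by rewrite subrK.
apply: Alin; last exact: AL.
apply: IH; first by move=> k kn; apply: AL; rewrite ltnS ltnW.
apply/leq_sizeP => j; rewrite leq_eqVlt => /predU1P[<-|nj].
  by rewrite coefB coefZ /c divfK ?subrr// coef_lagpoly_diag.
by rewrite coefB coefZ !nth_default ?mulr0 ?subr0// (leq_trans _ nj)// size_lagpoly.
Qed.

End LaguerrePolynomials.

(** * Linearity and orthogonality in the weighted space *)

Section LaguerreProjection.
Context {R : realType}.
Implicit Types (f g h dh dg : R -> R) (p q : {poly R}) (alpha c x : R).
Variables (alpha : R) (a1 : -1 < alpha).

Lemma posint_sobolev_polyD g dg p q c : sobolev alpha g dg ->
  posint (fun x => g x * (p + c *: q).[x] * gweight alpha x) =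
  posint (fun x => g x * p.[x] * gweight alpha x) +
  c * posint (fun x => g x * q.[x] * gweight alpha x).
Proof.
move=> sg; have [jp _] := posintegrable_sobolev_poly p a1 sg.
have [jq _] := posintegrable_sobolev_poly q a1 sg.
rewrite -posintZ// -posintD//; last exact: posintegrableZ.
by apply: eq_posint => x _; rewrite hornerD hornerZ; ring.
Qed.

Lemma posint_sobolev_polyZ g dg q c : sobolev alpha g dg ->
  posint (fun x => g x * (c *: q).[x] * gweight alpha x) =
  c * posint (fun x => g x * q.[x] * gweight alpha x).
Proof.
move=> sg; have [jq _] := posintegrable_sobolev_poly q a1 sg.
by rewrite -posintZ//; apply: eq_posint => x _; rewrite hornerZ; ring.
Qed.

(** The form with integrand x p' q' w is symmetric; integrating it by parts both ways gives j u = k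
    u, as the two polynomials are eigenvectors with different eigenvalues. *)
Lemma lagpoly_orthogonal j k : j != k ->
  posint (fun x => (lagpoly alpha j).[x] * (lagpoly alpha k).[x] * gweight alpha x) = 0.
Proof.
move=> jk; have sj := sobolev_poly (lagpoly alpha j) a1.
have sk := sobolev_poly (lagpoly alpha k) a1.
have ej := laguerre_by_parts (lagpoly alpha k) a1 sj.
have ek := laguerre_by_parts (lagpoly alpha j) a1 sk.
rewrite !laguerre_op_lagpoly in ej ek.
rewrite (posint_sobolev_polyZ _ _ sj) in ej; rewrite (posint_sobolev_polyZ _ _ sk) in ek.
set u := posint (fun x => (lagpoly alpha j).[x] * _ * _) in ej *.
have eu : posint (fun x => (lagpoly alpha k).[x] * (lagpoly alpha j).[x] * gweight alpha x) = u.
  by apply: eq_posint => x _; ring.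
have ed : posint (fun x => x * ((lagpoly alpha j)^`().[x] * (lagpoly alpha k)^`().[x]) * gweight alpha x) =
   posint (fun x => x * ((lagpoly alpha k)^`().[x] * (lagpoly alpha j)^`().[x]) * gweight alpha x).
  by apply: eq_posint => x _; ring.
rewrite eu in ek; rewrite ed ek in ej.
have : (k%:R - j%:R) * u = 0 by lra.
move/eqP; rewrite mulf_eq0 subr_eq0 => /orP[|/eqP//].
by rewrite eqr_nat eq_sym (negbTE jk).
Qed.

End LaguerreProjection.

(** * Norms of the Laguerre polynomials *)

Section LaguerreNorm.
Context {R : realType}.
Implicit Types (alpha x : R).

(** The square of the norm in L^2(w). *)
Definition lagnorm alpha k : R :=
  posint (fun x => (lagpoly alpha k).[x] ^+ 2 * gweight alpha x).

(** By parts, the eigenvalue times the squared norm is the integral of x L'^2 w; here L' is, up to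
    sign, the Laguerre polynomial of parameter alpha+1, and x w is its weight. *)
Lemma lagnormS alpha k : -1 < alpha ->
  k.+1%:R * lagnorm alpha k.+1 = lagnorm (alpha + 1) k.
Proof.
move=> a1; have sk := sobolev_poly (lagpoly alpha k.+1) a1.
have := laguerre_by_parts (lagpoly alpha k.+1) a1 sk.
rewrite laguerre_op_lagpoly (posint_sobolev_polyZ a1 _ _ sk) mulNr opprK deriv_lagpoly.
rewrite /lagnorm => e; transitivity (k.+1%:R *
  posint (fun x => (lagpoly alpha k.+1).[x] * (lagpoly alpha k.+1).[x] * gweight alpha x)).
  by congr (_ * _); apply: eq_posint => x _; rewrite expr2.
by rewrite -e; apply: eq_posint => x x0; rewrite gweightS// hornerN; ring.
Qed.

(** The functional equation of the Gamma function, read off from integration by parts with h = 1 and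
    p = X: the operator sends X to alpha + 1 - X. *)
Lemma posint_gweightS alpha : -1 < alpha ->
  posint (gweight (alpha + 1)) = (alpha + 1) * posint (gweight alpha).
Proof.
move=> a1; have s1 := sobolev_poly 1 a1.
have := laguerre_by_parts 'X a1 s1; rewrite /laguerre_op derivX.
have jw := posintegrable_poly 1 a1; have jxw := posintegrable_poly 'X a1.
rewrite (_ : posint _ = 0); last first.
  transitivity (posint (fun=> 0 * 0 : R)); last by rewrite (posintZ 0 (@posintegrable0 R)) mul0r.
  by apply: eq_posint => x _; rewrite derivC horner0 !mul0r mulr0 mul0r.
rewrite -(posintZ (alpha + 1)) => [e|]; last first.
  by apply: eq_posintegrable jw => x _; rewrite hornerC mul1r.
apply/eqP; rewrite eq_sym -subr_eq0 -posintB; last 2 first.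
- by apply: eq_posintegrable (posintegrableZ (alpha + 1) jw) => x _; rewrite hornerC mul1r.
- by apply: eq_posintegrable jxw => x x0; rewrite hornerX gweightS.
move/eqP: e; rewrite eq_sym oppr_eq0 => /eqP <-; apply/eqP.
by apply: eq_posint => x x0; rewrite gweightS// derivC !(hornerD, hornerM, hornerN, hornerX, hornerC); ring.
Qed.

Lemma lagnormE alpha k : -1 < alpha ->
  lagnorm alpha k = gbinom (k%:R + alpha) k * posint (gweight alpha).
Proof.
elim: k alpha => [|k IH] alpha a1.
  rewrite /lagnorm /gbinom /falling big_ord0 fact0 divr1 mul1r.
  by apply: eq_posint => x _; rewrite lagpoly0 hornerC expr1n mul1r.
have k0 : k.+1%:R != 0 :> R by rewrite pnatr_eq0.
apply: (mulfI k0); rewrite lagnormS// IH; last by apply: ltr_wpDr.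
rewrite posint_gweightS// /gbinom fallingS factS natrM.
have -> : k.+1%:R + alpha = k%:R + (alpha + 1) by rewrite -natr1; ring.
have f1 : k`!%:R != 0 :> R by rewrite pnatr_eq0 -lt0n fact_gt0.
by move: k.+1%:R k0 => u k0; field; rewrite f1 k0.
Qed.

Lemma falling_gt0 alpha k : -1 < alpha -> 0 < falling (k%:R + alpha) k.
Proof.
move=> a1; apply: prodr_gt0 => i _.
have : i.+1%:R <= k%:R :> R by rewrite ler_nat.
by rewrite -natr1; lra.
Qed.

Lemma posint_indic_itv (a b : R) : 0 < a -> a <= b ->
  posintegrable (\1_(`[a, b]) : R -> R) /\ posint (\1_(`[a, b]) : R -> R) = b - a.
Proof.
move=> a0 ab; pose mu := @lebesgue_measure R.
have iI : (\int[mu]_(x in (`]0%R, +oo[%classic : set R)) (\1_(`[a, b]) x)%:E = (b - a)%:E)%E.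
  rewrite integral_indic//.
  rewrite setIidl; last by move=> x /=; rewrite !in_itv /= andbT => /andP[ax _]; apply: lt_le_trans ax.
  transitivity ((@lebesgue_measure R) `[a, b]%classic); first by [].
  by rewrite lebesgue_measure_itv /= lte_fin; case: ltgtP ab => // -> _; rewrite subrr.
split; last by rewrite /posint /Rintegral iI.
apply/integrableP; split; first by apply/measurable_EFinP; exact: measurable_indic.
under eq_integral do rewrite /= ger0_norm ?indicE ?ler0n//.
by under eq_integral do rewrite -indicE; rewrite iI ltry.
Qed.

Lemma posint_ge_itv (f : R -> R) (m a b : R) : posintegrable f -> 0 < a -> a <= b ->
  (forall x, 0 < x -> 0 <= f x) -> (forall x, x \in `[a, b] -> m <= f x) ->
  m * (b - a) <= posint f.
Proof.
move=> jf a0 ab f0 fm; have [jI eI] := posint_indic_itv a0 ab.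
rewrite -eI -posintZ//; apply: le_posint => //; first exact: posintegrableZ.
move=> x x0; rewrite indicE.
have [|_] := boolP (x \in `[a, b]%classic); last by rewrite mulr0 f0.
by rewrite inE /= => xab; rewrite mulr1 fm.
Qed.

Lemma powexp_lower_bound (p k c a b : R) : 0 < a ->
  exists2 m, 0 < m & forall x, x \in `[a, b] -> m <= powexp p k c x.
Proof.
move=> a0; exists (expR (- (`|p| * (`|ln a| + `|ln b|)) - `|k| * b - `|c| / a)).
  exact: expR_gt0.
move=> x; rewrite in_itv /= => /andP[ax xb]; rewrite /powexp ler_expR.
have x0 : 0 < x by lra.
have lx : `|ln x| <= `|ln a| + `|ln b|.
  have l1 : ln a <= ln x by rewrite ler_ln.
  have l2 : ln x <= ln b by rewrite ler_ln// posrE; lra.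
  have := ler_norm (- ln a); have := ler_norm (ln b); rewrite normrN => h1 h2.
  have := normr_ge0 (ln a); have := normr_ge0 (ln b) => h3 h4.
  by rewrite ler_norml; apply/andP; split; lra.
have h1 : - (p * ln x) <= `|p| * (`|ln a| + `|ln b|).
  apply: le_trans (ler_norm _) _; rewrite normrN normrM.
  by apply: ler_wpM2l.
have h2 : k * x <= `|k| * b.
  apply: le_trans (ler_norm _) _; rewrite normrM.
  by apply: ler_wpM2l => //; rewrite gtr0_norm.
have h3 : c / x <= `|c| / a.
  apply: le_trans (ler_norm _) _; rewrite normrM.
  by apply: ler_wpM2l => //; rewrite gtr0_norm ?invr_gt0// lef_pV2.
lra.
Qed.

Lemma posint_gweight_gt0 alpha : -1 < alpha -> 0 < posint (gweight alpha).
Proof.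
move=> a1; have jw : posintegrable (gweight alpha) by exact: integrable_powexp.
have [m m0 hm] := @powexp_lower_bound alpha 1 0 1 2 ltr01.
apply: lt_le_trans (posint_ge_itv jw ltr01 _ _ hm).
- by rewrite mulr_gt0//; lra.
- lra.
- by move=> x _; exact: powexp_ge0.
Qed.

Lemma lagnorm_gt0 alpha k : -1 < alpha -> 0 < lagnorm alpha k.
Proof.
by move=> a1; rewrite lagnormE// mulr_gt0 ?posint_gweight_gt0// divr_gt0 ?falling_gt0// ltr0n fact_gt0.
Qed.

End LaguerreNorm.

(** * Bessel inequalities for the remainder and its derivative *)

Section Bessel.
Context {R : realType}.
Implicit Types (p q : {poly R}).
Variables (alpha : R) (h dh : R -> R).
Hypotheses (a1 : -1 < alpha) (sh : sobolev alpha h dh).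

Definition laguerre_proj n : {poly R} := \sum_(k < n)
  (posint (fun x => h x * (lagpoly alpha k).[x] * gweight alpha x) / lagnorm alpha k)
    *: lagpoly alpha k.

Let v n x := h x - (laguerre_proj n).[x].
Let dv n x := dh x - (laguerre_proj n)^`().[x].

Let sobolev_v n : sobolev alpha (v n) (dv n).
Proof. exact: sobolevB sh (sobolev_poly _ a1). Qed.

Let v_orthogonal_lagpoly n k : (k < n)%N ->
  posint (fun x => v n x * (lagpoly alpha k).[x] * gweight alpha x) = 0.
Proof.
move=> kn; have [jh _] := posintegrable_sobolev_poly (lagpoly alpha k) a1 sh.
have sk := sobolev_poly (lagpoly alpha k) a1.
have [js _] := posintegrable_sobolev_poly (laguerre_proj n) a1 sk.
transitivity (posint (fun x => h x * (lagpoly alpha k).[x] * gweight alpha x -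
    (lagpoly alpha k).[x] * (laguerre_proj n).[x] * gweight alpha x)).
  by apply: eq_posint => x _; rewrite /v; ring.
rewrite posintB//; apply/eqP; rewrite subr_eq0; apply/eqP.
set u := posint (fun x => h x * _ * _).
suff : forall m, posint (fun x => (lagpoly alpha k).[x] * (laguerre_proj m).[x] * gweight alpha x) =
    if (k < m)%N then u else 0 by move=> ->; rewrite kn.
elim=> [|m IH].
  rewrite /laguerre_proj big_ord0 ltn0 -[0 in LHS](scale0r 1) (posint_sobolev_polyZ a1 _ _ sk).
  by rewrite mul0r.
rewrite /laguerre_proj big_ord_recr /= (posint_sobolev_polyD a1 _ _ _ sk) IH ltnS.
have [km|mk|<-] := ltngtP k m.
- by rewrite lagpoly_orthogonal// ?mulr0 ?addr0// ltn_eqF.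
- by rewrite lagpoly_orthogonal// ?mulr0 ?addr0// gtn_eqF.
- have e2 : posint (fun x => (lagpoly alpha k).[x] * (lagpoly alpha k).[x] * gweight alpha x) =
      lagnorm alpha k by apply: eq_posint => x _; rewrite expr2.
  by rewrite add0r e2 divfK// gt_eqF// lagnorm_gt0.
Qed.

Lemma laguerre_proj_orthogonal n p : (size p <= n)%N ->
  posint (fun x => (h x - (laguerre_proj n).[x]) * p.[x] * gweight alpha x) = 0.
Proof.
move: p; apply: (poly_lagpoly_ind (alpha := alpha)) => [|p q c IHp IHq|k kn].
- by rewrite -(scale0r 1) (posint_sobolev_polyZ a1 _ _ (sobolev_v n)) mul0r.
- by rewrite (posint_sobolev_polyD a1 _ _ _ (sobolev_v n)) IHp IHq mulr0 addr0.
- exact: v_orthogonal_lagpoly.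
Qed.

Lemma size_laguerre_proj n : (size (laguerre_proj n) <= n)%N.
Proof.
apply: (leq_trans (size_sum _ _ _)); apply/bigmax_leqP => i _.
by apply: leq_trans (size_scale_leq _ _) _; apply: leq_trans (size_lagpoly _ _) _.
Qed.

Lemma sobolev_laguerre_proj_err n :
  sobolev alpha (fun x => h x - (laguerre_proj n).[x]) (fun x => dh x - (laguerre_proj n)^`().[x]).
Proof. exact: sobolev_v. Qed.

(** Pythagoras: the partial sum has size at most n, hence is orthogonal to the remainder. *)
Lemma laguerre_bessel n :
  posint (fun x => (h x - (laguerre_proj n).[x]) ^+ 2 * gweight alpha x) <=
  posint (fun x => h x ^+ 2 * gweight alpha x).
Proof.
set S := laguerre_proj n.
have sv : sobolev alpha (v n) (dv n) := sobolev_v n.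
have sS := sobolev_poly S a1.
have [jvS _] := posintegrable_sobolev_poly S a1 sv.
have := laguerre_proj_orthogonal (size_laguerre_proj n); rewrite -/S => e.
have -> : posint (fun x => h x ^+ 2 * gweight alpha x) =
   posint (fun x => v n x ^+ 2 * gweight alpha x) +
   (2 * posint (fun x => v n x * S.[x] * gweight alpha x) +
   posint (fun x => S.[x] ^+ 2 * gweight alpha x)).
  rewrite -posintZ// -posintD//; [|exact: posintegrableZ|exact: sobolev_sqr sS].
  rewrite -posintD//; [|exact: sobolev_sqr sv|]; last first.
    by apply: posintegrableD; [exact: posintegrableZ|exact: sobolev_sqr sS].
  by apply: eq_posint => x _; rewrite /v -/S; ring.
rewrite [X in 2 * X]e mulr0 add0r lerDl.
by apply: posint_ge0 => x _; rewrite mulr_ge0 ?sqr_ge0 ?ltW ?gweight_gt0.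
Qed.

(** Pythagoras again, for derivatives with weight x w. The cross term becomes, by parts, the
    integral of the remainder against the Laguerre operator of the partial sum, and that operator
    does not raise the degree. *)
Lemma laguerre_bessel_deriv n :
  posint (fun x => x * (dh x - (laguerre_proj n)^`().[x]) ^+ 2 * gweight alpha x) <=
  posint (fun x => x * dh x ^+ 2 * gweight alpha x).
Proof.
set S := laguerre_proj n.
have sv : sobolev alpha (v n) (dv n) := sobolev_v n.
have sS := sobolev_poly S a1.
have [_ jvS] := posintegrable_sobolev_poly S^`() a1 sv.
have e : posint (fun x => x * (dv n x * S^`().[x]) * gweight alpha x) = 0.
  rewrite (laguerre_by_parts S a1 sv) laguerre_proj_orthogonal ?oppr0//.
  exact: leq_trans (size_laguerre_op _ _) (size_laguerre_proj n).
have -> : posint (fun x => x * dh x ^+ 2 * gweight alpha x) =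
   posint (fun x => x * dv n x ^+ 2 * gweight alpha x) +
   (2 * posint (fun x => x * (dv n x * S^`().[x]) * gweight alpha x) +
   posint (fun x => x * S^`().[x] ^+ 2 * gweight alpha x)).
  rewrite -posintZ// -posintD//; [|exact: posintegrableZ|exact: sobolev_dsqr sS].
  rewrite -posintD//; [|exact: sobolev_dsqr sv|]; last first.
    by apply: posintegrableD; [exact: posintegrableZ|exact: sobolev_dsqr sS].
  by apply: eq_posint => x _; rewrite /dv -/S; ring.
rewrite e mulr0 add0r lerDl.
by apply: posint_ge0 => x x0; rewrite mulr_ge0 ?(ltW (gweight_gt0 _ _))// mulr_ge0 ?sqr_ge0// ltW.
Qed.

End Bessel.

(** * Equicontinuity and concentrating kernels *)

Section Localization.
Context {R : realType}.
Implicit Types (x y t e r : R).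
Local Notation mu := (@lebesgue_measure R).
Local Notation Rp := (`]0%R, +oo[%classic : set R).

(* The factor [(1/2) ^+ q] comes from comparing [t ^+ i] with [(2 * t) ^+ i] for [i >= q]. *)
Lemma expR_taylor_tail t q : 0 <= t ->
  `|expR (- t) - \sum_(0 <= i < q) (- t) ^+ i / i`!%:R| <= (1 / 2) ^+ q * expR (2 * t).
Proof.
move=> t0.
have e2 n : \sum_(0 <= i < n) (2 * t) ^+ i / i`!%:R <= expR (2 * t).
  have ec := @is_cvg_series_exp_coeff R (2 * t).
  have := nondecreasing_cvgn_le (u_ := series (exp_coeff (2 * t))) _ ec n; apply.
  apply: nondecreasing_series => i _ _; apply: exp_coeff_ge0; lra.
have tailn n : (q <= n)%N ->
    `|\sum_(0 <= i < n) (- t) ^+ i / i`!%:R - \sum_(0 <= i < q) (- t) ^+ i / i`!%:R| <=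
    (1 / 2) ^+ q * expR (2 * t).
  move=> qn; rewrite (big_cat_nat (n := q))//= addrAC subrr add0r.
  apply: le_trans (ler_norm_sum _ _ _) _.
  apply: le_trans (_ : \sum_(q <= i < n) (1 / 2) ^+ q * ((2 * t) ^+ i / i`!%:R) <= _).
    rewrite big_nat [leRHS]big_nat; apply: ler_sum => i /andP[qi _].
    rewrite normrM normrX normrN (ger0_norm t0) ger0_norm ?invr_ge0//.
    rewrite [leRHS]mulrA ler_wpM2r ?invr_ge0// [(2 * t) ^+ i]exprMn mulrA ler_peMl ?exprn_ge0//.
    rewrite -(subnK qi) exprD mulrCA -exprMn div1r mulVf ?expr1n ?mulr1 ?exprn_ege1//.
    by rewrite ler1n.
  rewrite -big_distrr /=; apply: ler_wpM2l; first by apply: exprn_ge0; lra.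
  apply: le_trans (e2 n).
  rewrite [leRHS](big_cat_nat (n := q))//= lerDr sumr_ge0// => i _.
  by rewrite divr_ge0 ?exprn_ge0//; lra.
have ec := @is_cvg_series_exp_coeff R (- t).
have cv : `|series (exp_coeff (- t)) n - \sum_(0 <= i < q) (- t) ^+ i / i`!%:R| @[n --> \oo] -->
    `|expR (- t) - \sum_(0 <= i < q) (- t) ^+ i / i`!%:R|.
  by apply: cvg_norm; apply: cvgB; [exact: ec|exact: cvg_cst].
rewrite -(cvg_lim _ cv)//; apply: limr_le; first by apply/cvg_ex; eexists; exact: cv.
by near=> n; apply: tailn; near: n; exact: nbhs_infty_ge.
Unshelve. all: by end_near. Qed.

(** The radius is chosen before [v] and depends on it only through [H]: this is equicontinuity. The
    increment of [v] is the integral of its derivative, split by weighted AM-GM into a multiple of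
    the energy and a multiple of the length of the interval. *)
Lemma sobolev_modulus (alpha x e H : R) : -1 < alpha -> 0 < x -> 0 < e -> 0 <= H ->
  exists d : R, [/\ 0 < d, d < x & forall v dv, sobolev alpha v dv ->
    posint (fun y => y * dv y ^+ 2 * gweight alpha y) <= H ->
    forall y, `|y - x| <= d -> `|v y - v x| <= e].
Proof.
move=> a1 x0 e0 H0; have x20 : 0 < x / 2 by lra.
have [m m0 hm] := @powexp_lower_bound R (alpha + 1) 1 0 (x / 2) (2 * x) x20.
(* [eta] makes the energy part at most e/2, with H + 1 to keep the denominator positive; [d] then
   makes the length part at most e/2. The constant [m] bounds y w from below on [x/2, 2x]. *)
pose eta := e / (2 * (H + 1)).
have eta0 : 0 < eta by rewrite /eta divr_gt0//; lra.
pose d : R := Num.min (x / 2) (2 * eta * m * e).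
have eme : 0 < 2 * eta * m * e by do 3?[apply: mulr_gt0 => //].
have d0 : 0 < d by rewrite /d lt_min x20 eme.
have em0 : 0 < 4 * eta * m by do 2?[apply: mulr_gt0 => //].
have dx : d <= x / 2 by rewrite /d ge_min lexx.
have de : d <= 2 * eta * m * e by rewrite /d ge_min lexx orbT.
exists d; split => //; first lra.
move=> v dv sv hH.
have key (a b : R) : x / 2 <= a -> a < b -> b <= 2 * x -> b - a <= d -> `|v b - v a| <= e.
  move=> xa ab bx bad; have a0 : 0 < a by lra.
  have [jI eI] := posint_indic_itv a0 (ltW ab).
  have [_ mdv] := measurable_sobolev sv.
  have jb : posintegrable (fun y => eta * (y * dv y ^+ 2 * gweight alpha y) +
      (4 * eta * m)^-1 * \1_(`[a, b]) y).
    by apply: posintegrableD; apply: posintegrableZ => //; exact: sobolev_dsqr sv.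
  have fb y : 0 < y -> `|(dv \_ `[a, b]) y| <= eta * (y * dv y ^+ 2 * gweight alpha y) +
      (4 * eta * m)^-1 * \1_(`[a, b]) y.
    move=> y0; rewrite patchE indicE.
    have t0 : 0 <= eta * (y * dv y ^+ 2 * gweight alpha y).
      apply: mulr_ge0; first exact: ltW.
      by apply: mulr_ge0; [apply: mulr_ge0; [exact: ltW|exact: sqr_ge0]|exact: ltW (gweight_gt0 _ _)].
    have [|_] := boolP (y \in `[a, b]%classic); last by rewrite normr0 mulr0 addr0.
    rewrite inE /= in_itv /= => /andP[ay yb]; rewrite mulr1.
    have yx : y \in `[x / 2, 2 * x] by rewrite in_itv /=; apply/andP; split; lra.
    have := hm _ yx; rewrite -/(gweight (alpha + 1) y) gweightS// => mw.
    have mdw : m * dv y ^+ 2 <= y * dv y ^+ 2 * gweight alpha y.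
      by rewrite mulrAC [y * gweight _ _ * _]mulrC [m * _]mulrC ler_wpM2l// sqr_ge0.
    apply: le_trans (_ : eta * (m * dv y ^+ 2) + (4 * eta * m)^-1 <= _); last first.
      by rewrite lerD2r ler_wpM2l// ltW.
    (* AM-GM: [z <= eta m z^2 + 1 / (4 eta m)] *)
    have : 0 <= (4 * eta * m)^-1 * (2 * eta * m * `|dv y| - 1) ^+ 2.
      by rewrite mulr_ge0 ?sqr_ge0// invr_ge0 ltW.
    rewrite -[dv y ^+ 2]real_normK ?num_real//; move: (`|dv y|) => z.
    have -> : (4 * eta * m)^-1 * (2 * eta * m * z - 1) ^+ 2 = eta * (m * z ^+ 2) + (4 * eta * m)^-1 - z.
      by field; rewrite !gt_eqF.
    lra.
  have mf : measurable_fun Rp (dv \_ `[a, b]).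
    by apply/measurable_restrict => //; apply: measurable_funS mdv => //; exact: subIsetl.
  have jf := posintegrable_le mf jb fb.
  have := le_norm_posint jf jb fb.
  have -> : posint (dv \_ `[a, b]) = v b - v a.
    rewrite /posint -Rintegral_mkcondr setIidr; last first.
      by move=> y /=; rewrite !in_itv /= andbT => /andP[ay _]; apply: lt_le_trans ay.
    by rewrite /Rintegral (FTC_pos_interval a0 ab (sobolev_derive sv) (sobolev_continuous sv)).
  rewrite posintD ?posintZ ?eI//; [|exact: sobolev_dsqr sv|by apply: posintegrableZ; exact: sobolev_dsqr sv|exact: posintegrableZ].
  move=> h; apply: le_trans h _.
  have h1 : eta * posint (fun y => y * dv y ^+ 2 * gweight alpha y) <= e / 2.
    apply: le_trans (ler_wpM2l (ltW eta0) hH) _.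
    have -> : e / 2 = eta * (H + 1) by rewrite /eta; field; lra.
    by rewrite ler_wpM2l ?(ltW eta0)//; lra.
  have h2 : (4 * eta * m)^-1 * (b - a) <= e / 2.
    rewrite mulrC ler_pdivrMr//.
    have -> : e / 2 * (4 * eta * m) = 2 * eta * m * e by field.
    lra.
  lra.
move=> y; rewrite ler_distl => /andP[y1 y2].
have [yx|xy|->] := ltgtP y x; last by rewrite subrr normr0 ltW.
- by rewrite distrC; apply: key; lra.
- by apply: key; lra.
Qed.

(* The logarithm of [(y / x) * expR (1 - y / x)], a kernel with a strict maximum at [x]. *)
Lemma peak_kernel (x d : R) : 0 < x -> 0 < d -> d < x ->
  exists r d' : R, [/\ 0 < r, 0 < d', d' <= d & forall y, 0 < y ->
    (`|y - x| <= d' -> - (r / 2) <= ln y - ln x + 1 - y / x) /\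
    (d < `|y - x| -> ln y - ln x + 1 - y / x <= - r)].
Proof.
move=> x0 d0 dx; pose e : R := d / x.
have e0 : 0 < e by rewrite divr_gt0.
have e1 : e < 1 by rewrite ltr_pdivrMr// mul1r.
have lne (s : R) : 0 < s -> s != 1 -> ln s + 1 - s < 0.
  move=> s0 s1; have := @expR_gt1Dx R (ln s); rewrite lnK ?posrE// ln_eq0//.
  by move=> /(_ s1); lra.
(* Concavity: ln t, for t = y/x, lies below its tangent at s. With s = 1 + e and s = 1 - e this
   bounds ln t + 1 - t beyond distance e from 1 by its value at s. *)
have tangent (s y : R) : 0 < s -> 0 < y -> ln y - ln x + 1 - y / x <= ln s + (y / x) * (1 - s) / s.
  move=> s0 y0; have q0 : 0 < y / x / s by rewrite !divr_gt0.
  have := @expR_ge1Dx R (ln (y / x / s)); rewrite lnK ?posrE//.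
  rewrite !lnM ?posrE ?invr_gt0 ?divr_gt0// !lnV ?posrE//.
  have -> : y / x * (1 - s) / s = y / x / s - y / x by field; rewrite !gt_eqF.
  lra.
(* The smaller of the two drops of ln t + 1 - t below its maximum 0, at t = 1 + e and t = 1 - e. *)
pose r := Num.min (- (ln (1 + e) - e)) (- (ln (1 - e) + e)).
have r0 : 0 < r.
  rewrite /r lt_min; apply/andP; split.
    by have := lne (1 + e); rewrite gt_eqF ?ltrDl// => /(_ _ isT); lra.
  have := lne (1 - e); rewrite lt_eqF ?gtrBl// => /(_ _ isT); lra.
pose e' := Num.min (Num.min e (1 / 2)) (r / 4).
have e'0 : 0 < e' by rewrite /e' !lt_min e0 /=; apply/andP; split; lra.
have e'e : e' <= e by rewrite /e' !ge_min lexx.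
have e'2 : e' <= 1 / 2 by rewrite /e' !ge_min lexx orbT.
have e'r : e' <= r / 4 by rewrite /e' !ge_min lexx orbT.
exists r, (e' * x); split => //; first by rewrite mulr_gt0.
  by apply: le_trans (_ : e * x <= _); [rewrite ler_wpM2r// ltW|rewrite /e divfK// gt_eqF].
move=> y y0; pose t := y / x; have t0 : 0 < t by rewrite divr_gt0.
have ytx : y = t * x by rewrite /t divfK// gt_eqF.
have -> : ln y - ln x + 1 - y / x = ln t + 1 - t.
  by rewrite /t lnM ?posrE ?invr_gt0// lnV ?posrE.
have -> : `|y - x| = `|t - 1| * x.
  by rewrite ytx -{2}[x]mul1r -mulrBl normrM (gtr0_norm x0).
split.
- rewrite ler_pM2r// ler_distl => /andP[t1 t2].
  (* From ln (1/t) <= 1/t - 1, the drop near the peak is at most t + 1/t - 2 = (t-1)^2 / t,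
     quadratic in the distance to 1. *)
  have := @expR_ge1Dx R (ln t^-1); rewrite lnK ?posrE ?invr_gt0// lnV ?posrE// => h.
  have h2 : t + t^-1 - 2 <= r / 2.
    have -> : t + t^-1 - 2 = (t - 1) ^+ 2 / t by field; rewrite gt_eqF.
    rewrite ler_pdivrMr//.
    have : (t - 1) ^+ 2 <= e' * e'.
      rewrite -expr2 -ler_sqrt ?exprn_ge0//; last by rewrite ltW.
      by rewrite !sqrtr_sqr (gtr0_norm e'0) ler_distl; apply/andP; split; lra.
    have : e' * e' <= r / 4 * (1 / 2) by apply: ler_pM => //; exact: ltW.
    have : r / 2 * (1 / 2) <= r / 2 * t by rewrite ler_wpM2l//; lra.
    lra.
  lra.
- rewrite -ltr_pdivrMr// -/e => et.
  have [t1|t1] := leP 1 t.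
    rewrite ger0_norm in et; last lra.
    have := tangent (1 + e) y; rewrite -/t => /(_ ltac:(lra) y0).
    have -> : ln y - ln x + 1 - t = ln t + 1 - t by rewrite /t lnM ?posrE ?invr_gt0// lnV ?posrE.
    have : t * (1 - (1 + e)) / (1 + e) <= - e.
      by rewrite ler_pdivrMr; [nra|lra].
    have : r <= - (ln (1 + e) - e) by rewrite /r ge_min lexx.
    lra.
  rewrite ltr0_norm in et; last lra.
  have := tangent (1 - e) y; rewrite -/t => /(_ ltac:(lra) y0).
  have -> : ln y - ln x + 1 - t = ln t + 1 - t by rewrite /t lnM ?posrE ?invr_gt0// lnV ?posrE.
  have : t * (1 - (1 - e)) / (1 - e) <= e.
    by rewrite ler_pdivrMr; [nra|lra].
  have : r <= - (ln (1 - e) + e) by rewrite /r ge_min lexx orbT.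
  lra.
Qed.

End Localization.

(** * Pointwise convergence of the expansion *)

Section PointwiseConvergence.
Context {R : realType}.
Implicit Types (x y c d : R).
Local Notation Rp := (`]0%R, +oo[%classic : set R).
Variables (alpha : R) (h dh : R -> R).
Hypotheses (a1 : -1 < alpha) (sh : sobolev alpha h dh).

Let v n y := h y - (laguerre_proj alpha h n).[y].
Let dv n y := dh y - (laguerre_proj alpha h n)^`().[y].

Let sobolev_v n : sobolev alpha (v n) (dv n).
Proof. exact: sobolev_laguerre_proj_err. Qed.

Let test n (p l : R) := posint (fun y => v n y * powexp p l 0 y * gweight alpha y).

Lemma posintegrable_test u du (p l : R) : sobolev alpha u du -> 0 <= p -> 0 <= l ->
  posintegrable (fun y => u y * powexp p l 0 y * gweight alpha y).
Proof.
move=> su p0 l0; have [mu _] := measurable_sobolev su.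
apply: posintegrable_mul (sobolev_sqr su) _ => //; first exact: measurable_powexp.
apply: (@eq_posintegrable _ (powexp (p + p + alpha) (l + l + 1) 0)).
  by move=> y y0; rewrite expr2 powexpM powexpM !addr0.
by have := @integrable_powexp R (p + p + alpha) (l + l + 1); have := a1; move=> ? h0; apply: h0; lra.
Qed.

Lemma posint_sum (f : nat -> R -> R) q : (forall i, posintegrable (f i)) ->
  posintegrable (fun y => \sum_(0 <= i < q) f i y) /\
  posint (fun y => \sum_(0 <= i < q) f i y) = \sum_(0 <= i < q) posint (f i).
Proof.
move=> jf; elim: q => [|q [jq eq]].
  have e0 y : 0 < y -> \sum_(0 <= i < 0) f i y = 0 by rewrite big_nil.
  split; first by apply: eq_posintegrable (@posintegrable0 R) => y y0; rewrite e0.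
  rewrite (eq_posint (g := fun=> 0 * 0)) => [|y y0]; last by rewrite e0 ?mul0r.
  by rewrite (posintZ 0 (@posintegrable0 R)) mul0r big_nil.
have er y : 0 < y -> \sum_(0 <= i < q) f i y + f q y = \sum_(0 <= i < q.+1) f i y.
  by rewrite big_nat_recr.
split; first exact: eq_posintegrable er (posintegrableD jq (jf q)).
by rewrite -(eq_posint er) posintD// eq [RHS]big_nat_recr.
Qed.

Lemma cvg0_sum (u : nat -> nat -> R) (c : nat -> R) q :
  (forall i, u i n @[n --> \oo] --> 0) ->
  \sum_(0 <= i < q) c i * u i n @[n --> \oo] --> 0.
Proof.
move=> u0; elim: q => [|q IH].
  by apply: (near_cvg0 (v := cst 0)); [apply: nearW => n; rewrite big_nil|exact: cvg_cst].
apply: near_cvg0 (cvg0_lin (c q) IH (u0 q)); apply: nearW => n.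
by rewrite big_nat_recr.
Qed.

Let H0 := posint (fun y => h y ^+ 2 * gweight alpha y).

(* Passes from the rate [l] to [l + d] by expanding [expR (- d * y)]; the tail of the
   expansion grows like [expR (2 * d * y)], which the weight absorbs for [d <= 1 / 8]. *)
Let test_step n j l d q : 0 <= l -> 0 <= d -> d <= 1 / 8 ->
  `|test n j%:R (l + d) - \sum_(0 <= i < q) ((- d) ^+ i / i`!%:R) * test n (j + i)%:R l| <=
  (1 / 2) ^+ q * (H0 + posint (powexp (2 * j%:R + alpha) (2 * l + 1 / 2) 0)).
Proof.
move=> l0 d0 d8; have sv := sobolev_v n.
have ja := posintegrable_test sv (ler0n R j) (addr_ge0 l0 d0).
have jt i := posintegrable_test sv (ler0n R (j + i)) l0.
have [jsum esum] := posint_sum (f := fun i y => (- d) ^+ i / i`!%:R *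
    (v n y * powexp (j + i)%:R l 0 y * gweight alpha y)) q
    (fun i => posintegrableZ _ (jt i)).
have -> : \sum_(0 <= i < q) ((- d) ^+ i / i`!%:R) * test n (j + i)%:R l =
    posint (fun y => \sum_(0 <= i < q) (- d) ^+ i / i`!%:R *
      (v n y * powexp (j + i)%:R l 0 y * gweight alpha y)).
  by rewrite esum; apply: eq_bigr => i _; rewrite posintZ.
rewrite /test -posintB//.
have jP : posintegrable (powexp (2 * j%:R + alpha) (2 * l + 1 / 2) 0).
  have := @integrable_powexp R (2 * j%:R + alpha) (2 * l + 1 / 2); apply; last lra.
  by have := ler0n R j; have := a1; lra.
have jV := sobolev_sqr sv.
apply: le_trans (_ : posint (fun y => (1 / 2) ^+ q * (v n y ^+ 2 * gweight alpha y +
    powexp (2 * j%:R + alpha) (2 * l + 1 / 2) 0 y)) <= _); last first.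
  rewrite posintZ; last exact: posintegrableD.
  rewrite posintD//; apply: ler_wpM2l; first by apply: exprn_ge0; lra.
  by rewrite lerD2r; exact: (laguerre_bessel a1 sh).
apply: le_norm_posint.
- exact: posintegrableB.
- by apply: posintegrableZ; exact: posintegrableD.
move=> y y0.
have -> : v n y * powexp j%:R (l + d) 0 y * gweight alpha y -
    \sum_(0 <= i < q) (- d) ^+ i / i`!%:R * (v n y * powexp (j + i)%:R l 0 y * gweight alpha y) =
    v n y * powexp j%:R l 0 y * gweight alpha y *
    (expR (- (d * y)) - \sum_(0 <= i < q) (- (d * y)) ^+ i / i`!%:R).
  rewrite mulrBr expR_powexp; congr (_ - _).
    have -> : powexp j%:R (l + d) 0 y = powexp j%:R l 0 y * powexp 0 d 0 y.
      by rewrite powexpM !addr0.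
    by rewrite mulrA mulrAC.
  rewrite big_distrr /=; apply: eq_bigr => i _.
  rewrite natrD -powexp_mulXr// -mulNr exprMn.
  by move: (powexp _ _ _ _) (gweight _ _) (v n y) => A C D; ring.
rewrite normrM.
have tail := @expR_taylor_tail R (d * y) q (mulr_ge0 d0 (ltW y0)).
have P0 : 0 <= powexp j%:R l 0 y * gweight alpha y by rewrite mulr_ge0// powexp_ge0.
apply: le_trans (ler_wpM2l (normr_ge0 _) tail) _.
rewrite mulrCA; apply: ler_wpM2l; first by apply: exprn_ge0; lra.
rewrite -mulrA normrM (ger0_norm P0) -mulrA.
(* [z] is all that multiplies |v n| apart from the weight. After |v n| z <= v^2 + z^2, the term z^2
   w decays at rate 2l + 1 - 4d, and d <= 1/8 leaves at least 2l + 1/2. *)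
pose z := powexp j%:R (l - 2 * d) 0 y.
have -> : powexp j%:R l 0 y * gweight alpha y * expR (2 * (d * y)) = z * gweight alpha y.
  have -> : expR (2 * (d * y)) = powexp 0 (- (2 * d)) 0 y.
    by rewrite -expR_powexp; congr expR; ring.
  by rewrite mulrAC powexpM !addr0.
have zz : z ^+ 2 * gweight alpha y <= powexp (2 * j%:R + alpha) (2 * l + 1 / 2) 0 y.
  rewrite expr2 !powexpM /powexp ler_expR !mul0r !subr0.
  have : d * y <= 1 / 8 * y by rewrite ler_wpM2r// ltW.
  lra.
apply: le_trans (_ : v n y ^+ 2 * gweight alpha y + z ^+ 2 * gweight alpha y <= _); last first.
  by rewrite lerD2l.
rewrite mulrA -mulrDl ler_wpM2r ?(ltW (gweight_gt0 _ _))//.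
rewrite -[v n y ^+ 2]real_normK ?num_real//.
have := sqr_ge0 (`|v n y| - z); have := sqr_ge0 (`|v n y|); have := sqr_ge0 z.
by rewrite sqrrB; move: (`|v n y|) => u; lra.
Qed.

(** Induction on the number of steps. At rate 0 the integral is exactly 0 as soon as n > j, by
    orthogonality. In the step the Taylor tail is small uniformly in n, by Bessel, and the finitely
    many terms left tend to 0 by induction; hence all powers j are treated together. *)
Lemma laplace_moments_vanish d N j : 0 <= d -> d <= 1 / 8 ->
  posint (fun y => (h y - (laguerre_proj alpha h n).[y]) * powexp j%:R (N%:R * d) 0 y *
     gweight alpha y) @[n --> \oo] --> 0.
Proof.
move=> d0 d8; elim: N j => [|N IH] j.
  apply: (near_cvg0 (v := cst 0)); last exact: cvg_cst.
  near=> n; have jn : (size ('X^j : {poly R}) <= n)%N.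
    by rewrite size_polyXn; near: n; exact: nbhs_infty_ge.
  rewrite -[RHS](laguerre_proj_orthogonal a1 sh jn); apply: eq_posint => y y0.
  by rewrite mul0r powexpX// hornerXn.
have l0 : 0 <= N%:R * d by rewrite mulr_ge0.
apply/cvgr0Pnorm_lt => e e0.
set C := H0 + posint (powexp (2 * j%:R + alpha) (2 * (N%:R * d) + 1 / 2) 0).
have C0 : 0 <= C.
  apply: addr_ge0; apply: posint_ge0 => y _; last exact: powexp_ge0.
  by rewrite mulr_ge0 ?sqr_ge0// ltW// gweight_gt0.
have [q hq] : exists q, (1 / 2) ^+ q * C < e / 2.
  have g0 : (1 / 2 : R) ^+ n @[n --> \oo] --> 0 by apply: cvg_expr; rewrite ger0_norm; lra.
  have C1 : 0 < e / 2 / (C + 1) by rewrite !divr_gt0//; lra.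
  move/cvgr0Pnorm_lt : g0 => /(_ _ C1) [q _ /(_ q (leqnn q))] /= hq; exists q.
  move: hq; rewrite ger0_norm; last by apply: exprn_ge0; lra.
  rewrite ltr_pdivlMr; last lra.
  have : 0 <= (1 / 2 : R) ^+ q by apply: exprn_ge0; lra.
  by rewrite mulrDr mulr1; lra.
have S0 := cvg0_sum (fun i => (- d) ^+ i / i`!%:R) q (fun i => IH (j + i)%N).
have e20 : 0 < e / 2 by lra.
move/cvgr0Pnorm_lt : S0 => /(_ _ e20) S0; near=> n.
have := test_step n j q l0 d0 d8; rewrite -/C.
have -> : N%:R * d + d = N.+1%:R * d by rewrite -natr1 mulrDl mul1r.
rewrite -/(test n j%:R (N.+1%:R * d)).
have : `|\sum_(0 <= i < q) (- d) ^+ i / i`!%:R * test n (j + i)%:R (N%:R * d)| < e / 2.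
  by near: n.
set S := \sum_(0 <= i < q) _; set t := test _ _ _ => h1 h2.
have : `|t| <= `|t - S| + `|S| by rewrite -{1}[t](subrK S) ler_normD.
lra.
Unshelve. all: by end_near. Qed.

Lemma laguerre_expansion x : 0 < x -> (laguerre_proj alpha h n).[x] @[n --> \oo] --> h x.
Proof.
move=> x0; apply/cvgrPdist_lt => e e0.
pose H1 := posint (fun y => y * dh y ^+ 2 * gweight alpha y).
have H10 : 0 <= H1.
  apply: posint_ge0 => y y0; apply: mulr_ge0; last exact: ltW (gweight_gt0 _ _).
  by apply: mulr_ge0; [exact: ltW|exact: sqr_ge0].
have e20 : 0 < e / 2 by lra.
have [d [d0 dx hd]] := sobolev_modulus a1 x0 e20 H10.
have [r [d' [r0 d'0 d'd hk]]] := peak_kernel x0 d0 dx.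
have xd0 : 0 < x - d' by lra.
have [w w0 hw] := @powexp_lower_bound R alpha 1 0 (x - d') (x + d') xd0.
pose G := posint (gweight alpha).
have G0 : 0 < G := posint_gweight_gt0 a1.
have H00 : 0 <= H0.
  by apply: posint_ge0 => y _; rewrite mulr_ge0 ?sqr_ge0// ltW// gweight_gt0.
have T0 : 0 < e * w * d' / 2 by rewrite divr_gt0// !mulr_gt0.
(* [m] is fixed before [n]. The kernel is at most e^(-m r) at distance more than d from x, and at
   least e^(-m r/2) within d' of x; the ratio e^(-m r/2) must beat the constant H0 + G. *)
have [m hm] : exists m : nat, expR (- (m%:R * (r / 2))) * (H0 + G) <= e * w * d' / 2.
  have [C hC] : exists C : R, 0 < C /\ C = e * w * d' / 2 / (H0 + G).
    by exists (e * w * d' / 2 / (H0 + G)); split => //; rewrite divr_gt0//; lra.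
  case: hC => Cp hC.
  pose m := (Num.truncn (`|ln C| / (r / 2))).+1.
  exists m; rewrite -ler_pdivlMr; last lra.
  rewrite -hC -[leRHS]lnK ?posrE// ler_expR.
  have : `|ln C| / (r / 2) < m%:R by rewrite /m truncnS_gt.
  rewrite ltr_pdivrMr; last lra.
  by have := ler_norm (- ln C); rewrite normrN; lra.
(* This rate puts the maximum of y^m e^(-l y) at x. The rate is then cut into N steps of length at
   most 1/8. *)
pose l := m%:R / x; have l0 : 0 <= l by rewrite divr_ge0// ltW.
pose N := (Num.truncn (8 * l)).+1; pose dd := l / N%:R.
have N0 : 0 < N%:R :> R by rewrite ltr0n.
have dd0 : 0 <= dd by rewrite divr_ge0// ltW.
have dd8 : dd <= 1 / 8.
  by rewrite /dd ler_pdivrMr//; have := @truncnS_gt R (8 * l); rewrite -/N; lra.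
have Ndd : N%:R * dd = l by rewrite /dd mulrC divfK// gt_eqF.
have := laplace_moments_vanish N m dd0 dd8; rewrite Ndd => a0.
(* The normalisation that makes the peak of the kernel equal to 1. *)
pose E := expR (m%:R - m%:R * ln x).
have c0 : 0 < expR (- (m%:R * (r / 2))) * (e * w * d' / 2) / E.
  by rewrite divr_gt0 ?expR_gt0// mulr_gt0 ?expR_gt0.
move/cvgr0Pnorm_lt : a0 => /(_ _ c0) a0; near=> n.
have an : `|test n m%:R l| * E < expR (- (m%:R * (r / 2))) * (e * w * d' / 2).
  rewrite -ltr_pdivlMr; last exact: expR_gt0.
  near: n; exact: a0.
rewrite ltNge; apply/negP; rewrite -/(v n x) => vx.
have vd := hd _ _ (sobolev_v n) (laguerre_bessel_deriv a1 sh n).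
pose s := Num.sg (v n x).
have vx0 : v n x != 0 by rewrite -normr_gt0; lra.
have s1 : `|s| = 1 by rewrite normr_sg vx0.
have svx : s * v n x = `|v n x| by rewrite /s normrEsg.
(* By equicontinuity the remainder keeps the sign of its value at x, and size at least e/2, on the
   whole d-neighbourhood. *)
have near_x y : `|y - x| <= d -> e / 2 <= s * v n y.
  move=> /vd h1; have -> : s * v n y = s * v n x + s * (v n y - v n x) by ring.
  have : `|s * (v n y - v n x)| <= e / 2 by rewrite normrM s1 mul1r.
  by rewrite svx ler_norml => /andP[]; lra.
(* If [v n] stays away from 0 at [x], then [f] is nonnegative, because away from [x] the
   kernel is at most [q], and has an integral bounded below near [x]. *)
pose q := expR (- (m%:R * r)).
pose f y := s * E * (v n y * powexp m%:R l 0 y * gweight alpha y) +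
   (q * (v n y ^+ 2 * gweight alpha y) + q * gweight alpha y).
have jt := posintegrable_test (sobolev_v n) (ler0n R m) l0.
have jV := sobolev_sqr (sobolev_v n).
have jw : posintegrable (gweight alpha) by exact: integrable_powexp.
have jf : posintegrable f.
  by do !apply: posintegrableD; exact: posintegrableZ.
have fE y : 0 < y -> f y = (s * v n y * expR (m%:R * (ln y - ln x + 1 - y / x)) +
    q * (v n y ^+ 2 + 1)) * gweight alpha y.
  move=> y0; have <- : E * powexp m%:R l 0 y = expR (m%:R * (ln y - ln x + 1 - y / x)).
    rewrite /E /powexp -expRD /l; congr expR; rewrite mul0r subr0; field.
    by rewrite gt_eqF.
  rewrite /f; ring.
have f0 y : 0 < y -> 0 <= f y.
  move=> y0; rewrite fE//; apply: mulr_ge0; last exact: ltW (gweight_gt0 _ _).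
  have q1 : 0 <= q * (v n y ^+ 2 + 1) by rewrite mulr_ge0 ?expR_ge0// addr_ge0// sqr_ge0.
  have [yd|yd] := leP `|y - x| d.
    rewrite addr_ge0// mulr_ge0 ?expR_ge0//; have := near_x _ yd; lra.
  have [_ /(_ yd) kr] := hk _ y0.
  set k := expR _; have kq : k <= q by rewrite /k /q ler_expR -(mulrN _ r) ler_wpM2l.
  have k0 : 0 <= k := expR_ge0 _.
  have : `|s * v n y * k| <= q * (v n y ^+ 2 + 1).
    rewrite !normrM s1 mul1r (ger0_norm k0) mulrC.
    apply: ler_pM => //.
    rewrite -[v n y ^+ 2]real_normK ?num_real//; move: (`|v n y|) => z.
    by have := sqr_ge0 (z - 1); have := sqr_ge0 z; rewrite sqrrB; lra.
  by rewrite ler_norml => /andP[]; lra.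
have fm y : y \in `[x - d', x + d'] -> w * (e / 2 * expR (- (m%:R * (r / 2)))) <= f y.
  move=> yI; have := hw _ yI; move: yI; rewrite in_itv /= => /andP[y1 y2] wy.
  have y0 : 0 < y by lra.
  have yd' : `|y - x| <= d' by rewrite ler_distl; apply/andP; split; lra.
  have [/(_ yd') kr _] := hk _ y0.
  rewrite fE// mulrC; apply: ler_pM => //.
  - by rewrite mulr_ge0 ?expR_ge0// ltW.
  - exact: ltW.
  apply: le_trans (_ : s * v n y * expR (m%:R * (ln y - ln x + 1 - y / x)) <= _); last first.
    by rewrite lerDl mulr_ge0 ?expR_ge0// addr_ge0// sqr_ge0.
  apply: ler_pM; rewrite ?expR_ge0 ?(ltW e20)//; first by apply: near_x; lra.
  by rewrite ler_expR -(mulrN _ (r / 2)) ler_wpM2l.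
have xx : x - d' <= x + d' by lra.
have := posint_ge_itv jf xd0 xx f0 fm.
rewrite /f posintD ?posintZ//; [|exact: posintegrableZ|by apply: posintegrableD; exact: posintegrableZ].
rewrite posintD ?posintZ//; [|exact: posintegrableZ|exact: posintegrableZ].
rewrite -/(test n m%:R l) -/G.
have : s * E * test n m%:R l <= `|test n m%:R l| * E.
  apply: le_trans (ler_norm _) _; rewrite !normrM s1 mul1r mulrC.
  by rewrite (ger0_norm (expR_ge0 _)).
have : q * posint (fun y => v n y ^+ 2 * gweight alpha y) <= q * H0.
  by rewrite ler_wpM2l ?expR_ge0//; exact: (laguerre_bessel a1 sh).
have : q * (H0 + G) <= expR (- (m%:R * (r / 2))) * (e * w * d' / 2).
  have -> : q = expR (- (m%:R * (r / 2))) * expR (- (m%:R * (r / 2))).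
    by rewrite /q -expRD; congr expR; field.
  by rewrite -mulrA ler_wpM2l ?expR_ge0.
(* The integral of [f] is at least X e w d' by its lower bound on an interval of length 2d'. It is
   also strictly less: the test integral contributes less than half of this, the terms with factor
   [q] at most half. *)
set X := expR _ in an *.
have -> : w * (e / 2 * X) * (x + d' - (x - d')) = X * (e * w * d') by field.
lra.
Unshelve. all: by end_near. Qed.

End PointwiseConvergence.

(** * The inverse Gaussian density *)

Section NormalCdf.
Context {R : realType}.
Local Notation mu := (@lebesgue_measure R).

(** The limits are those of the distribution function of the identity as a random variable under the
    standard normal law; the derivative is the fundamental theorem of calculus. *)
Lemma normal_cdf : exists Phi : R -> R,
  [/\ forall x : R, is_derive x 1 Phi (normal_pdf 0 1 x),
      Phi x @[x --> -oo] --> (0 : R) & Phi x @[x --> +oo] --> (1 : R)].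
Proof.
have [X XE] : exists X : {RV (normal_prob (0 : R) 1) >-> R}, forall x, X x = x :> R.
  unshelve eexists; first by refine (@mfun_Sub _ _ (measurableTypeR R) R (fun x => x) _); apply/mem_set; exact: measurable_id.
  by [].
have n1 : 1 != 0 :> R by exact: oner_neq0.
have fin x : cdf X x \is a fin_num by exact: fin_num_measure.
exists (fun x => fine (cdf X x)).
have cdfE x : fine (cdf X x) = \int[mu]_(t in `]-oo, x]) normal_pdf 0 1 t.
  transitivity (fine (normal_prob (0 : R) 1 (X @^-1` `]-oo, x]))); first by [].
  rewrite (_ : X @^-1` `]-oo, x] = `]-oo, x]%classic)//.
  by apply/seteqP; split => y; rewrite /preimage /= XE.
split.
- move=> x; have xu : x < x + 1 by rewrite ltrDl.
  have [| | |d1 d2] := @continuous_FTC1 R (normal_pdf 0 1) -oo%O x (x + 1) xu.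
  + apply: (integrableS _ _ (subsetT _)) => //; exact: integrable_normal_pdf.
  + by rewrite ltNyr.
  + exact: continuous_normal_pdf.
  have -> : (fun x => fine (cdf X x)) = fun x => \int[mu]_(t in `]-oo, x]) normal_pdf 0 1 t.
    by apply/funext.
  by apply: DeriveDef; [exact: d1|rewrite -derive1E].
- have := @cvg_cdfNy0 _ _ _ _ X; move=> h.
  exact: (fine_cvg h).
- have := @cvg_cdfy1 _ _ _ _ X; move=> h.
  exact: (fine_cvg h).
Qed.

Lemma normal_pdf01E (x : R) : normal_pdf 0 1 x = (Num.sqrt (2 * pi))^-1 * expR (- (x ^+ 2 / 2)).
Proof.
rewrite normal_pdfE ?oner_neq0// /normal_peak /normal_fun subr0 expr1n mulNr.
by rewrite mul1r mulr_natl.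
Qed.

End NormalCdf.

(** * Laplace transform of the inverse Gaussian density *)

Section InverseGaussianIntegral.
Context {R : realType}.
Implicit Types (r s t a b x y : R).
Local Notation mu := (@lebesgue_measure R).
Local Notation Rp := (`]0%R, +oo[%classic : set R).

(** For t > 0, [p] is the square root and [q] its inverse. *)
Let p t : R := powexp (1 / 2) 0 0 t.
Let q t : R := powexp (- (1 / 2)) 0 0 t.

Let pq t : p t * q t = 1.
Proof. by rewrite powexpM subrr !addr0 /powexp !mul0r !subr0 expR0. Qed.

Let p2 t : 0 < t -> p t ^+ 2 = t.
Proof.
move=> t0; rewrite expr2 powexpM !addr0 (_ : 1 / 2 + 1 / 2 = 1%:R :> R); last by field.
by rewrite powexpX ?expr1.
Qed.

Let q2 t : 0 < t -> q t ^+ 2 = t^-1.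
Proof.
move=> t0; rewrite expr2 powexpM !addr0 (_ : - (1 / 2) - 1 / 2 = - 1 :> R); last by field.
by rewrite powexpV.
Qed.

Let p0 : p t @[t --> 0^'+] --> 0.
Proof. by apply: powexp_cvg0 => //; lra. Qed.

Let qV t : q t = (p t)^-1.
Proof.
have := pq t; have := powexp_gt0 (1 / 2) 0 0 t; rewrite -/(p t) => pt e.
by apply: (mulfI (lt0r_neq0 pt)); rewrite e divff// gt_eqF.
Qed.

Let q0 : q t @[t --> 0^'+] --> +oo.
Proof.
rewrite (_ : q = fun t => (p t)^-1); last by apply/funext => t; rewrite qV.
apply/gtr0_cvgV0; first by apply: nearW => t; rewrite invr_gt0 powexp_gt0.
by apply: (near_cvg0 (v := p)) p0; apply: nearW => t; exact: invrK.
Qed.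

Let py : p t @[t --> +oo] --> +oo.
Proof.
apply/cvgryPge => A; near=> t.
apply: (@le_trans _ _ (expR A)); first by have := @expR_ge1Dx R A; lra.
rewrite /p /powexp !mul0r !subr0 ler_expR.
have t0 : 0 < t by near: t; exact: nbhs_pinfty_gt.
have : expR (2 * A) <= t by near: t; exact: nbhs_pinfty_ge.
rewrite -[X in _ <= X]lnK ?posrE// ler_expR; lra.
Unshelve. all: by end_near. Qed.

(* [F] below is the classical expression of the inverse Gaussian distribution function
   through the normal one. *)
Lemma ige_integral r s : 0 < r -> 0 < s ->
  (\int[mu]_(t in Rp) (powexp (- (3 / 2)) (r ^+ 2 / 2) (s ^+ 2 / 2) t)%:E =
   (Num.sqrt (2 * pi) / s * expR (- (r * s)))%:E)%E.
Proof.
move=> r0 s0; have [Phi [dPhi PhiNy Phiy]] := @normal_cdf R.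
pose c := Num.sqrt (2 * pi) / s : R.
have c0 : 0 < c by rewrite divr_gt0// sqrtr_gt0 mulr_gt0// pi_gt0.
pose u1 t := r * p t - s * q t; pose u2 t := - (r * p t) - s * q t.
pose F t := c * (expR (- (r * s)) * Phi (u1 t) + expR (r * s) * Phi (u2 t)).
have u10 : u1 t @[t --> 0^'+] --> -oo.
  apply/cvgrNyPle => A; near=> t.
  have : p t <= 1.
    near: t; have /cvgr0Pnorm_lt /(_ 1 ltr01) := p0; apply: filterS => t /ltW.
    by apply: le_trans; exact: ler_norm.
  have : (r - A) / s <= q t by near: t; move/cvgryPge: q0; exact.
  rewrite ler_pdivrMr// => h1 h2; have : r * p t <= r * 1 by rewrite ler_wpM2l// ltW.
  by rewrite /u1; lra.
have u20 : u2 t @[t --> 0^'+] --> -oo.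
  apply/cvgrNyPle => A; near=> t.
  have : (- A) / s <= q t by near: t; move/cvgryPge: q0; exact.
  rewrite ler_pdivrMr// => h1; have : 0 <= r * p t by rewrite mulr_ge0 ?powexp_ge0// ltW.
  by rewrite /u2; lra.
have u1y : u1 t @[t --> +oo] --> +oo.
  apply/cvgryPge => A; near=> t.
  have p1 : 1 <= p t by near: t; move/cvgryPge: py; exact.
  have : (s + A) / r <= p t by near: t; move/cvgryPge: py; exact.
  have : s * q t <= s * 1 by rewrite ler_wpM2l ?qV ?invf_le1 ?(ltW s0)//; lra.
  by rewrite ler_pdivrMr// /u1; lra.
have u2y : u2 t @[t --> +oo] --> -oo.
  apply/cvgrNyPle => A; near=> t.
  have : (- A) / r <= p t by near: t; move/cvgryPge: py; exact.
  have : 0 <= s * q t by rewrite mulr_ge0 ?powexp_ge0// ltW.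
  by rewrite ler_pdivrMr// /u2; lra.
have dF t : 0 < t -> is_derive t 1 F (powexp (- (3 / 2)) (r ^+ 2 / 2) (s ^+ 2 / 2) t).
  move=> t0; have tn0 : t != 0 by rewrite gt_eqF.
  have dp := is_derive_powexp (1 / 2) 0 0 t0; have dq := is_derive_powexp (- (1 / 2)) 0 0 t0.
  have d1 := is_deriveB (is_deriveZ r dp) (is_deriveZ s dq).
  have d2 := is_deriveB (is_deriveN (is_deriveZ r dp)) (is_deriveZ s dq).
  have e1 := is_deriveZ (expR (- (r * s))) (is_derive1_comp (dPhi (u1 t)) d1).
  have e2 := is_deriveZ (expR (r * s)) (is_derive1_comp (dPhi (u2 t)) d2).
  apply: is_derive_eq (is_deriveZ c (is_deriveD e1 e2)) _.
  rewrite /GRing.scale /= !normal_pdf01E -/(p t) -/(q t).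
  (* The cross terms cancel the prefactors e^(-rs) and e^(rs), so both Gaussian densities give the
     same exponential. In the sum of the derivatives of [u1] and [u2] the terms from [p] then
     cancel, and those from [q] add up to s q(t)/t. *)
  have sq1 : u1 t ^+ 2 = r ^+ 2 * t + s ^+ 2 / t - 2 * (r * s).
    rewrite -[X in s ^+ 2 * X](q2 t0) -[X in r ^+ 2 * X](p2 t0).
    transitivity (r ^+ 2 * p t ^+ 2 + s ^+ 2 * q t ^+ 2 - 2 * (r * s) * (p t * q t)); first by rewrite /u1; ring.
    by rewrite pq mulr1.
  have sq2 : u2 t ^+ 2 = r ^+ 2 * t + s ^+ 2 / t + 2 * (r * s).
    rewrite -[X in s ^+ 2 * X](q2 t0) -[X in r ^+ 2 * X](p2 t0).
    transitivity (r ^+ 2 * p t ^+ 2 + s ^+ 2 * q t ^+ 2 + 2 * (r * s) * (p t * q t)); first by rewrite /u2; ring.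
    by rewrite pq mulr1.
  pose X := expR (- (r ^+ 2 / 2 * t) - s ^+ 2 / 2 / t).
  have x1 : expR (- (u1 t ^+ 2 / 2)) = X * expR (r * s).
    by rewrite sq1 -expRD; congr expR; field.
  have x2 : expR (- (u2 t ^+ 2 / 2)) = X * expR (- (r * s)).
    by rewrite sq2 -expRD; congr expR; field.
  have -> : powexp (- (3 / 2)) (r ^+ 2 / 2) (s ^+ 2 / 2) t = X * (q t / t).
    rewrite -/(q t) /q powexp_divr// /X /powexp -expRD !mul0r !subr0; congr expR; field.
    by [].
  rewrite x1 x2 expRN /c.
  have en0 : expR (r * s) != 0 by rewrite gt_eqF// expR_gt0.
  have sn0 : s != 0 by rewrite gt_eqF.
  have pn0 : Num.sqrt (2 * pi) != 0 :> R by rewrite gt_eqF// sqrtr_gt0 mulr_gt0// pi_gt0.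
  clear x1 x2 sq1 sq2 e1 e2; move: X => X.
  move: (expR (r * s)) en0 (Num.sqrt _) pn0 X (p t) (q t) => z zn w wn {}X P Q.
  by field; rewrite zn wn sn0 tn0.
have cf : {in `]0, +oo[, continuous (powexp (- (3 / 2)) (r ^+ 2 / 2) (s ^+ 2 / 2))}.
  exact: continuous_powexp.
have F0 : F t @[t --> 0^'+] --> c * (expR (- (r * s)) * 0 + expR (r * s) * 0).
  apply: cvgM; first exact: cvg_cst.
  apply: cvgD; (apply: cvgM; first exact: cvg_cst).
    exact: (cvg_comp u1 Phi u10 PhiNy).
  exact: (cvg_comp u2 Phi u20 PhiNy).
have Fy : F t @[t --> +oo] --> c * (expR (- (r * s)) * 1 + expR (r * s) * 0).
  apply: cvgM; first exact: cvg_cst.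
  apply: cvgD; (apply: cvgM; first exact: cvg_cst).
    exact: (cvg_comp u1 Phi u1y Phiy).
  exact: (cvg_comp u2 Phi u2y PhiNy).
rewrite (ge0_FTC_pos dF cf F0 Fy); first by congr EFin; rewrite -/c; ring.
by move=> t t0; exact: powexp_ge0.
Unshelve. all: by end_near. Qed.

Lemma ig_pdfE a b t : 0 < a -> 0 < b -> 0 < t ->
  ig_pdf a b t = Num.sqrt (a / (2 * pi)) * expR (a / b) *
    powexp (- (3 / 2)) (a / (2 * b ^+ 2)) (a / 2) t.
Proof.
move=> a0 b0 t0; rewrite /ig_pdf.
have bn0 : b != 0 by rewrite gt_eqF.
have tn0 : t != 0 by rewrite gt_eqF.
have pin0 : pi != 0 :> R by rewrite gt_eqF// pi_gt0.
have -> : Num.sqrt (a / (2 * pi * t ^+ 3)) = Num.sqrt (a / (2 * pi)) * powexp (- (3 / 2)) 0 0 t.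
  have -> : a / (2 * pi * t ^+ 3) = a / (2 * pi) * powexp (- (3 / 2)) 0 0 t ^+ 2.
    have -> : powexp (- (3 / 2)) 0 0 t = q t / t.
      by rewrite /q powexp_divr// (_ : - (1 / 2) - 1 = - (3 / 2) :> R)//; field.
    rewrite exprMn q2//; move: (pi : R) pin0 => ppi pin0; field.
    by rewrite tn0 pin0.
  rewrite sqrtrM ?divr_ge0 ?mulr_ge0 ?ltW ?pi_gt0//.
  by rewrite sqrtr_sqr ger0_norm ?powexp_ge0.
rewrite -!mulrA; congr (_ * _); rewrite /powexp -!expRD; congr expR.
by field; rewrite bn0 tn0.
Qed.

(** The factor e^(-x t) merely shifts the linear rate, so the previous integral applies with r^2 =
    a/b^2 + 2x and s^2 = a. The case x = 0 says that the density has total mass 1. *)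
Lemma ig_laplace a b x : 0 < a -> 0 < b -> 0 <= x ->
  (\int[mu]_(t in Rp) (expR (- (x * t)) * ig_pdf a b t)%:E =
   (expR (a / b - Num.sqrt a * Num.sqrt (a / b ^+ 2 + 2 * x)))%:E)%E.
Proof.
move=> a0 b0 x0.
have bn0 : b != 0 by rewrite gt_eqF.
set r := Num.sqrt (a / b ^+ 2 + 2 * x); set s := Num.sqrt a.
have ab0 : 0 < a / b ^+ 2 by rewrite divr_gt0// exprn_gt0.
have r0 : 0 < r by rewrite sqrtr_gt0; lra.
have s0 : 0 < s by rewrite sqrtr_gt0.
have rr : r ^+ 2 = a / b ^+ 2 + 2 * x by rewrite sqr_sqrtr//; lra.
have ss : s ^+ 2 = a by rewrite sqr_sqrtr// ltW.
have ek : x + a / (2 * b ^+ 2) = r ^+ 2 / 2 by rewrite rr; field.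
pose C := Num.sqrt (a / (2 * pi)) * expR (a / b) : R.
transitivity (\int[mu]_(t in Rp) (C%:E * (powexp (- (3 / 2)) (r ^+ 2 / 2) (s ^+ 2 / 2) t)%:E))%E.
  apply: eq_integral => t; rewrite inE /= in_itv /= andbT => t0.
  rewrite -EFinM; congr EFin; rewrite ig_pdfE// mulrCA; congr (_ * _).
  by rewrite expR_powexp powexpM !add0r ek ss.
rewrite ge0_integralZl//; first last.
- by rewrite lee_fin mulr_ge0 ?sqrtr_ge0 ?expR_ge0.
- by move=> t _; rewrite lee_fin powexp_ge0.
- by apply/measurable_EFinP; exact: measurable_powexp.
rewrite ige_integral// -EFinM; congr EFin.
rewrite /C expRD [s * r]mulrC.
have w0 : 0 < Num.sqrt (2 * pi) :> R by rewrite sqrtr_gt0 mulr_gt0// pi_gt0.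
have -> : Num.sqrt (a / (2 * pi)) = s / Num.sqrt (2 * pi).
  by rewrite sqrtrM ?ltW// sqrtrV// ltW// mulr_gt0// pi_gt0.
move: (expR _) (expR _) => E1 E2; field.
by rewrite !gt_eqF.
Qed.

End InverseGaussianIntegral.

(** * Laguerre series of the inverse Gaussian density at rate one *)

Section InverseGaussianSeries.
Context {R : realType}.
Implicit Types (a b alpha x y t : R).

Lemma integrable_powexp_pos (p k c : R) : 0 < c -> 0 <= k -> (k = 0 -> p < -1) ->
  posintegrable (powexp p k c).
Proof.
move=> c0; rewrite le_eqVlt => /predU1P[<- /(_ erefl) p1|k0 _].
  exact: integrable_powexp_tail.
exact: integrable_powexp_ess.
Qed.

(** At the endpoint k = -1/2 the exponentials in h^2 w cancel at infinity and leave x^(-3-alpha);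
    the expansion of x h'^2 w starts with x^(-2-alpha), still integrable as alpha > -1. At 0 the
    factor e^(-2c/x) dominates any power. *)
Lemma sobolev_powexp alpha (C k c : R) : -1 < alpha -> - (1 / 2) <= k -> 0 < c ->
  let h := fun x => C * powexp (- (3 / 2) - alpha) k c x in
  let dh := fun x => C * ((- (3 / 2) - alpha) / x - k + c / x ^+ 2) *
    powexp (- (3 / 2) - alpha) k c x in
  sobolev alpha h dh.
Proof.
move=> a1 k1 c0 h dh; set p := - (3 / 2) - alpha.
have j (q : R) : q < -1 -> posintegrable (powexp q (k + k + 1) (c + c)).
  by move=> q1; apply: integrable_powexp_pos => //; lra.
have e2 x : powexp p k c x ^+ 2 * gweight alpha x = powexp (p + p + alpha) (k + k + 1) (c + c) x.
  by rewrite expr2 powexpM powexpM addr0.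
split.
- move=> x x0; apply: is_derive_eq (is_deriveZ C (is_derive_powexp p k c x0)) _.
  by rewrite /dh /GRing.scale /= mulrA.
- apply: (continuous_derivative_pos (df := fun x => C * (((- (p * x^-1 ^+ 2)) - (2 * c) * x^-1 ^+ 3) * powexp p k c x +
    (p / x - k + c / x ^+ 2) * ((p / x - k + c / x ^+ 2) * powexp p k c x)))) => x x0.
  have xn0 : x != 0 by rewrite gt_eqF.
  have dV := is_deriveV xn0 (is_derive_id x (1 : R)).
  have d1 := is_deriveD (is_deriveB (is_deriveZ p dV) (@is_derive_cst R R R k x 1))
    (is_deriveZ c (is_deriveX 2 dV)).
  have d2 := is_deriveZ C (is_deriveM d1 (is_derive_powexp p k c x0)).
  have -> : dh = C \*: ((p \*: (fun y => y^-1) - cst k + c \*: (fun y : R => y^-1) ^+ 2) * powexp p k c).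
    by apply/funext => y; rewrite /dh -mulrA -exprVn.
  apply: is_derive_eq d2 _.
  have -> : (p \*: (fun y => y^-1) - cst k + c \*: (fun y : R => y^-1) ^+ 2) x = p / x - k + c / x ^+ 2.
    by rewrite -exprVn.
  move: (powexp p k c x) => u.
  transitivity (C * ((p / x - k + c / x ^+ 2) * ((p / x - k + c / x ^+ 2) * u) +
    u * (p * (- (x ^+ 2)^-1 * 1) - 0 + c * ((2 * x^-1) * (- (x ^+ 2)^-1 * 1))))); first by [].
  by field.
- apply: (eq_posintegrable _ (posintegrableZ (C ^+ 2) (j (p + p + alpha) _))); last by rewrite /p; lra.
  by move=> x x0; rewrite -e2 /h exprMn mulrA.
- pose P n x := powexp (p + p + alpha + 1 - n%:R) (k + k + 1) (c + c) x.
  have jP n : posintegrable (P n) by apply: j; rewrite /p; have := ler0n R n; lra.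
  have PE n x : 0 < x -> P n x = P 0%N x / x ^+ n.
    move=> x0; rewrite -(@mulfK _ (x ^+ n) _ (P n x)) ?expf_neq0 ?gt_eqF//; congr (_ / _).
    by rewrite powexp_mulXr// /P subrK subr0.
  apply: (eq_posintegrable _ (posintegrableZ (C ^+ 2) (posintegrableD
    (posintegrableD (posintegrableZ (k ^+ 2) (jP 0%N)) (posintegrableZ (- (2 * p * k)) (jP 1%N)))
    (posintegrableD (posintegrableZ (p ^+ 2 - 2 * k * c) (jP 2%N))
     (posintegrableD (posintegrableZ (2 * p * c) (jP 3%N)) (posintegrableZ (c ^+ 2) (jP 4%N))))))).
  move=> x x0; rewrite (PE 1%N x x0) (PE 2%N x x0) (PE 3%N x x0) (PE 4%N x x0) /dh -/p.
  have -> : P 0%N x = x * (powexp p k c x ^+ 2 * gweight alpha x).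
    by rewrite e2 mulrC -[X in _ * X]expr1 powexp_mulXr// /P subr0.
  move: (powexp p k c x) (gweight alpha x) => u w; rewrite expr1; field.
  by rewrite gt_eqF.
- move=> n; apply: (near_cvg0 (v := fun x => C * powexp (p + n.+1%:R + alpha) (k + 1) c x)).
    near=> x; have x0 : 0 < x by near: x; exact: nbhs_right_gt.
    by rewrite /h -!mulrA [X in C * X]mulrA powexp_mulXr// powexpM addr0.
  have h0 : powexp (p + n.+1%:R + alpha) (k + 1) c x @[x --> 0^'+] --> 0.
    by apply: powexp_cvg0_ess => //; lra.
  apply: (near_cvg0 (v := fun x => 0 + C * powexp (p + n.+1%:R + alpha) (k + 1) c x)).
    by apply: nearW => x; rewrite add0r.
  by apply: cvg0_lin h0; exact: cvg_cst.
- move=> n; apply: (near_cvg0 (v := fun x => C * powexp (p + n.+1%:R + alpha) (k + 1) c x)).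
    near=> x; have x0 : 0 < x by near: x; exact: nbhs_pinfty_gt.
    by rewrite /h -!mulrA [X in C * X]mulrA powexp_mulXr// powexpM addr0.
  have h0 : powexp (p + n.+1%:R + alpha) (k + 1) c x @[x --> +oo] --> 0.
    by apply: powexp_cvg_pinfty; [lra|exact: ltW].
  apply: (near_cvg0 (v := fun x => 0 + C * powexp (p + n.+1%:R + alpha) (k + 1) c x)).
    by apply: nearW => x; rewrite add0r.
  by apply: cvg0_lin h0; exact: cvg_cst.
Unshelve. all: by end_near. Qed.

Lemma falling_split x m n : falling x (m + n) = falling x m * falling (x - m%:R) n.
Proof.
elim: n => [|n IH]; first by rewrite addn0 {3}/falling big_ord0 mulr1.
by rewrite addnS !fallingS IH natrD; ring.
Qed.

(** Splitting the falling factorial (k+alpha)_k after k-i factors cancels the one in the coefficient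
    and leaves (alpha+i)_i. *)
Lemma lagpoly_coef_ratio alpha k i : -1 < alpha -> (i <= k)%N ->
  (lagpoly alpha k)`_i / gbinom (k%:R + alpha) k =
  'C(k, i)%:R * ((- 1) ^+ i / falling (alpha + i%:R) i).
Proof.
move=> a1 ik; rewrite coef_poly ltnS ik /gbinom.
have -> : falling (k%:R + alpha) k = falling (k%:R + alpha) (k - i) * falling (alpha + i%:R) i.
  rewrite -{2}(subnK ik) falling_split; congr (_ * falling _ _).
  by rewrite natrB//; ring.
have f1 : (k - i)`!%:R != 0 :> R by rewrite pnatr_eq0 -lt0n fact_gt0.
have f2 : i`!%:R != 0 :> R by rewrite pnatr_eq0 -lt0n fact_gt0.
have f3 : k`!%:R != 0 :> R by rewrite pnatr_eq0 -lt0n fact_gt0.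
have f4 : falling (alpha + i%:R) i != 0 by rewrite gt_eqF// addrC falling_gt0.
have f5 : falling (k%:R + alpha) (k - i) != 0.
  rewrite gt_eqF//; apply: prodr_gt0 => j _.
  have : j.+1%:R <= k%:R :> R by rewrite ler_nat (leq_trans (ltn_ord j))// leq_subr.
  by rewrite -natr1; lra.
have -> : 'C(k, i)%:R = k`!%:R / (i`!%:R * (k - i)`!%:R) :> R.
  by rewrite -(bin_fact ik) !natrM mulfK// mulf_neq0.
move: f1 f2 f3 f4 f5; move: (falling _ _) (falling _ _) => u v.
move: ((k - i)`!%:R) (i`!%:R) (k`!%:R) => x1 x2 x3 f1 f2 f3 f4 f5.
by field; rewrite f1 f2 f3 f4 f5.
Qed.

(** At rate one the coefficient is the linear functional x^i -> m_i applied to the Laguerre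
    polynomial, divided by its value at 0. The isolated 1 in the definition is the term i = 0. *)
Lemma laguerre_coef_poly alpha (m : nat -> R) k : -1 < alpha -> m 0%N = 1 ->
  laguerre_coef alpha 1 m k =
  (\sum_(i < k.+1) (lagpoly alpha k)`_i * m i) / gbinom (k%:R + alpha) k.
Proof.
move=> a1 m0; rewrite big_distrl /= -(big_mkord xpredT (fun i => (lagpoly alpha k)`_i * m i / _)).
rewrite big_ltn// /laguerre_coef; congr (_ + _).
  rewrite m0 mulr1 lagpoly_coef_ratio// bin0 mul1r expr0 /falling big_ord0.
  by rewrite divr1.
apply: eq_big_nat => i /andP[_ ik].
by rewrite [RHS]mulrAC lagpoly_coef_ratio// -[RHS]mulrA; congr (_ * _); rewrite mulrAC.
Qed.

Theorem ig_laguerre_series a b alpha (m : nat -> R) y : 0 < a -> 0 < b -> -1 < alpha ->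
  1 <= a / b ^+ 2 -> 0 < y ->
  (forall j, m j = posint (fun x => x ^+ j * ig_pdf a b x)) ->
  \sum_(0 <= k < n) laguerre_coef alpha 1 m k * laguerre alpha k y @[n --> \oo] -->
  posint (gweight alpha) * ig_pdf a b y / gweight alpha y.
Proof.
move=> a0 b0 a1 ab y0 mE.
pose C := Num.sqrt (a / (2 * pi)) * expR (a / b) : R.
pose p := - (3 / 2) - alpha : R.
(* Dividing the density by the weight lowers its linear rate by 1; the hypothesis on a/b^2 is
   precisely that the result is at least -1/2. *)
pose k0 := a / (2 * b ^+ 2) - 1; have k01 : - (1 / 2) <= k0.
  have : a / (2 * b ^+ 2) = a / b ^+ 2 / 2 by field; rewrite gt_eqF.
  by rewrite /k0 => ->; lra.
have c0 : 0 < a / 2 by lra.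
pose h x := C * powexp p k0 (a / 2) x.
have sh : sobolev alpha h (fun x => C * (p / x - k0 + (a / 2) / x ^+ 2) * powexp p k0 (a / 2) x).
  exact: (sobolev_powexp C a1 k01 c0).
have hw x : 0 < x -> h x * gweight alpha x = ig_pdf a b x.
  move=> x0; rewrite ig_pdfE// /h -mulrA powexpM addr0 -/C.
  by rewrite /k0 !subrK.
have jx i : posintegrable (fun x => x ^+ i * ig_pdf a b x).
  have [j1 _] := posintegrable_sobolev_poly 'X^i a1 sh.
  by apply: eq_posintegrable j1 => x x0; rewrite -hw// hornerXn; ring.
have m0 : m 0%N = 1.
  rewrite mE /posint /Rintegral.
  under eq_integral => x _ do rewrite expr0 mul1r -[ig_pdf a b x]mul1r -expR0 -oppr0 -(mul0r x).
  rewrite ig_laplace// mulr0 addr0 sqrtrM ?ltW// sqrtrV ?sqr_ge0// sqrtr_sqr gtr0_norm//.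
  by rewrite mulrA -expr2 sqr_sqrtr ?ltW// subrr expR0.
have G0 := posint_gweight_gt0 a1.
(* The squared norm is the value at 0 times the integral of the weight, so the Fourier coefficients
   of [h] agree with those of the series up to that integral. *)
have S n : \sum_(0 <= k < n) laguerre_coef alpha 1 m k * laguerre alpha k y =
   posint (gweight alpha) * (laguerre_proj alpha h n).[y].
  rewrite big_mkord /laguerre_proj horner_sum big_distrr /=; apply: eq_bigr => k _.
  rewrite hornerZ laguerreE mulrA; congr (_ * _).
  rewrite laguerre_coef_poly// lagnormE//.
  have -> : posint (fun x => h x * (lagpoly alpha k).[x] * gweight alpha x) =
     \sum_(i < k.+1) (lagpoly alpha k)`_i * m i.
    rewrite -(big_mkord xpredT (fun i => (lagpoly alpha k)`_i * m i)).
    have [_ es] := posint_sum k.+1 (fun i => posintegrableZ (lagpoly alpha k)`_i (jx i)).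
    transitivity (posint (fun x => \sum_(0 <= i < k.+1) (lagpoly alpha k)`_i * (x ^+ i * ig_pdf a b x))).
      apply: eq_posint => x x0.
      rewrite mulrAC hw// (horner_coef_wide x (size_lagpoly alpha k)) big_distrr big_mkord /=.
      by apply: eq_bigr => i _; ring.
    by rewrite es; apply: eq_bigr => i _; rewrite posintZ// mE.
  have g0 : gbinom (k%:R + alpha) k != 0.
    by rewrite gt_eqF// divr_gt0 ?falling_gt0// ltr0n fact_gt0.
  move: (\sum_(i < _) _) (gbinom _ _) g0 (posint _) (lt0r_neq0 G0) => s g g0 G Gn0.
  by field; rewrite g0 Gn0.
under eq_fun do rewrite S.
rewrite -mulrA -(hw _ y0) mulfK ?gt_eqF ?gweight_gt0//.
by apply: cvgM; [exact: cvg_cst|exact: (laguerre_expansion a1 sh y0)].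
Qed.

End InverseGaussianSeries.

(** * Moments from Laplace transforms *)

Section LaplaceTransform.
Context {d : measure_display} {T : measurableType d} {R : realType}.
Variables (mu : {measure set T -> \bar R}) (D : set T) (X q : T -> R).
Hypotheses (mD : measurable D) (mX : measurable_fun D X) (mq : measurable_fun D q).
Hypotheses (X0 : forall w, D w -> 0 <= X w) (q0 : forall w, D w -> 0 <= q w).
Implicit Types (l : R).

(** The factor [q] lets one statement cover both sides: a density for Lebesgue measure on the
    half-line, and the constant 1 for the probability on Omega. *)
Definition laplace_integrand (j : nat) l (w : T) : R := X w ^+ j * expR (- (l * X w)) * q w.

Hypothesis fin : forall l, 0 < l -> (\int[mu]_(w in D) (laplace_integrand 0 l w)%:E < +oo)%E.

Let I j l := \int[mu]_(w in D) laplace_integrand j l w.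

Lemma measurable_laplace_integrand j l : measurable_fun D (laplace_integrand j l).
Proof.
apply: measurable_funM => //; apply: measurable_funM.
  exact: measurable_funX.
apply: measurableT_comp => //; apply: measurableT_comp => //.
exact: measurable_funM.
Qed.

Lemma laplace_integrand_ge0 j l w : D w -> 0 <= laplace_integrand j l w.
Proof. by move=> Dw; rewrite !mulr_ge0 ?expR_ge0 ?exprn_ge0 ?X0 ?q0. Qed.

Let integrable0 l : 0 < l -> mu.-integrable D (EFin \o laplace_integrand 0 l).
Proof.
move=> l0; apply/integrableP; split.
  by apply/measurable_EFinP; exact: measurable_laplace_integrand.
under eq_integral => w /[!inE] Dw do rewrite /= ger0_norm ?laplace_integrand_ge0//.
exact: fin.
Qed.

(** Half of the rate dominates the power X^j; the other half is an integrable Laplace integrand with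
    j = 0. *)
Lemma integrable_laplace_integrand j l : 0 < l ->
  mu.-integrable D (EFin \o laplace_integrand j l).
Proof.
move=> l0; case: j => [|j]; first exact: integrable0.
have l20 : 0 < l / 2 by lra.
pose C := j.+1`!%:R / (l / 2) ^+ j.+1.
have iC := integrableZl mD C (integrable0 l20).
apply: le_integrable iC => //.
  by apply/measurable_EFinP; exact: measurable_laplace_integrand.
move=> w Dw; rewrite /= lee_fin ger0_norm ?laplace_integrand_ge0//.
apply: le_trans (ler_norm _); rewrite /laplace_integrand expr0 mul1r mulrA.
apply: ler_wpM2r; first exact: q0.
have e : expR (- (l * X w)) = expR (- (l / 2 * X w)) * expR (- (l / 2 * X w)).
  by rewrite -expRD; congr expR; field.
rewrite e mulrA; apply: ler_wpM2r; first exact: expR_ge0.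
rewrite expRN ler_pdivrMr ?expR_gt0//.
have l2X : 0 <= l / 2 * X w by rewrite mulr_ge0 ?X0// ltW.
have := @expR_ge1Dxn R _ j l2X; rewrite exprMn => h.
have f0 : 0 < j.+1`!%:R :> R by rewrite ltr0n fact_gt0.
have p0 : 0 < (l / 2) ^+ j.+1 by rewrite exprn_gt0.
have -> : X w ^+ j.+1 = C * ((l / 2) ^+ j.+1 * X w ^+ j.+1 / j.+1`!%:R).
  by rewrite /C; field; rewrite !gt_eqF.
by apply: ler_wpM2l; [rewrite /C divr_ge0// ltW|lra].
Qed.

(** Minus the derivative in the rate, as a limit of forward difference quotients: their rates stay
    positive, and they lie between 0 and the limit integrand, which therefore dominates them. *)
Lemma laplace_derivative j l : 0 < l ->
  n.+1%:R * (I j l - I j (l + n.+1%:R^-1)) @[n --> \oo] --> I j.+1 l.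
Proof.
move=> l0.
pose g n w := n.+1%:R * (laplace_integrand j l w - laplace_integrand j (l + n.+1%:R^-1) w).
have ln n : 0 < l + n.+1%:R^-1 by rewrite addr_gt0// invr_gt0.
have ig n : mu.-integrable D (EFin \o g n).
  have iB := integrableB mD (integrable_laplace_integrand j l0) (integrable_laplace_integrand j (ln n)).
  exact: (integrableZl mD (n.+1%:R) iB).
have gE n : \int[mu]_(w in D) g n w = n.+1%:R * (I j l - I j (l + n.+1%:R^-1)).
  rewrite /g RintegralZl//; last first.
    exact: (integrableB mD (integrable_laplace_integrand j l0) (integrable_laplace_integrand j (ln n))).
  by rewrite RintegralB//; exact: integrable_laplace_integrand.
(* With u = X/(n+1), everything follows from u - u^2 <= 1 - e^(-u) <= u. *)
have bound n w : D w -> `|g n w - laplace_integrand j.+1 l w| <=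
    X w * laplace_integrand j.+1 l w / n.+1%:R /\ 0 <= g n w <= laplace_integrand j.+1 l w.
  move=> Dw; have Xw := X0 Dw; pose u := X w / n.+1%:R.
  have n0 : 0 < n.+1%:R :> R by rewrite ltr0n.
  have u0 : 0 <= u by rewrite divr_ge0// ltW.
  have gu : g n w = laplace_integrand j l w * (n.+1%:R * (1 - expR (- u))).
    rewrite /g /laplace_integrand mulrDl opprD expRD [n.+1%:R^-1 * _]mulrC -/u; ring.
  have iS : laplace_integrand j.+1 l w = laplace_integrand j l w * X w.
    by rewrite /laplace_integrand exprS; ring.
  have Xu : X w = n.+1%:R * u by rewrite /u mulrC divfK// gt_eqF.
  have i0 := laplace_integrand_ge0 j l Dw.
  have e1 : 1 - expR (- u) <= u by have := @expR_ge1Dx R (- u); lra.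
  have e2 : u - u * u <= 1 - expR (- u).
    have h1 := @expR_ge1Dx R u; have h2 := expR_gt0 (- u).
    have : expR (- u) * expR u = 1 by rewrite -expRD addNr expR0.
    have h3 : expR (- u) * (1 + u) <= expR (- u) * expR u by rewrite ler_wpM2l// ltW.
    move=> h4; have h5 : expR (- u) <= 1 by rewrite -[leRHS]expR0 ler_expR; lra.
    have : 1 - u <= expR (- u) by have := @expR_ge1Dx R (- u); lra.
    move=> h6; have : (1 - u) * u <= expR (- u) * u by rewrite ler_wpM2r.
    lra.
  have e3 : 0 <= 1 - expR (- u).
    by rewrite subr_ge0 -[leRHS]expR0 ler_expR oppr_le0.
  split; last first.
    rewrite gu iS mulr_ge0//=; last by rewrite mulr_ge0// ltW.
    by rewrite ler_wpM2l// Xu ler_wpM2l// ltW.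
  have -> : X w * laplace_integrand j.+1 l w / n.+1%:R = laplace_integrand j l w * (n.+1%:R * (u * u)).
    by rewrite iS {1 2}Xu; field; rewrite gt_eqF.
  rewrite gu iS Xu -mulrBr -mulrBr normrM (ger0_norm i0) normrM (ger0_norm (ltW n0)).
  do 2!(apply: ler_wpM2l => //; rewrite ?(ltW n0)//).
  by rewrite ler_norml; apply/andP; split; lra.
have [| | |_ _] := @dominated_convergence _ _ R mu D mD (fun n w => (g n w)%:E)
  (fun w => (laplace_integrand j.+1 l w)%:E) (fun w => (laplace_integrand j.+1 l w)%:E)
  (fun n => measurable_int _ (ig n)) (measurable_int _ (integrable_laplace_integrand j.+1 l0)).
- apply/aeW => w Dw; apply: cvg_EFin; first exact: nearW.
  apply/cvgrPdist_le => e e0.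
  pose M := X w * laplace_integrand j.+1 l w.
  near=> n; rewrite distrC; apply: le_trans (proj1 (bound n w Dw)) _.
  rewrite -/M ler_pdivrMr// mulrC -ler_pdivrMr//.
  apply: (@le_trans _ _ n%:R); last by rewrite ler_nat.
  by near: n; exact: nbhs_infty_ger.
- exact: integrable_laplace_integrand.
- apply/aeW => w n Dw; rewrite /= lee_fin.
  by have [_ /andP[h1 h2]] := bound n w Dw; rewrite ger0_norm.
move=> h; under eq_fun do rewrite -gE.
apply: (fine_cvg (f := fun n => \int[mu]_(w in D) (g n w)%:E)%E).
rewrite /I /Rintegral fineK//.
by apply: integrable_fin_num => //; exact: integrable_laplace_integrand.
Unshelve. all: by end_near. Qed.

(** Along the rates 1/(n+1) the integrands increase, so the limit holds in the extended reals,
    whether or not the moment is finite. *)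
Lemma laplace_monotone j :
  (\int[mu]_(w in D) (laplace_integrand j n.+1%:R^-1 w)%:E @[n --> \oo] -->
   \int[mu]_(w in D) (X w ^+ j * q w)%:E)%E.
Proof.
have mg n : measurable_fun D (fun w => (laplace_integrand j n.+1%:R^-1 w)%:E).
  by apply/measurable_EFinP; exact: measurable_laplace_integrand.
have g0 n w : D w -> (0 <= (laplace_integrand j n.+1%:R^-1 w)%:E)%E.
  by move=> Dw; rewrite lee_fin laplace_integrand_ge0.
have nd w : D w -> nondecreasing_seq (fun n => (laplace_integrand j n.+1%:R^-1 w)%:E).
  move=> Dw m n mn; rewrite lee_fin /laplace_integrand ler_wpM2r ?q0//.
  rewrite ler_wpM2l ?exprn_ge0 ?X0// ler_expR lerN2 ler_wpM2r ?X0//.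
  by rewrite lef_pV2 ?posrE// ler_nat.
have := @cvg_monotone_convergence _ T R mu D mD _ mg g0 nd.
suff -> : (\int[mu]_(w in D) limn (fun n => (laplace_integrand j n.+1%:R^-1 w)%:E) =
   \int[mu]_(w in D) (X w ^+ j * q w)%:E)%E by [].
apply: eq_integral => w _; apply/cvg_lim => //; apply: cvg_EFin; first exact: nearW.
rewrite /laplace_integrand; apply: cvgM; last exact: cvg_cst.
rewrite -[X in _ --> X]mulr1; apply: cvgM; first exact: cvg_cst.
suff : expR (- (n.+1%:R^-1 * X w)) @[n --> \oo] --> expR (- (0 * X w)).
  by rewrite mul0r oppr0 expR0.
apply: (cvg_comp (fun n => - (n.+1%:R^-1 * X w))); last exact: continuous_expR.
by apply: cvgN; apply: cvgM; [exact: cvg_harmonic|exact: cvg_cst].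
Qed.

End LaplaceTransform.

(** Equality of the transforms at all positive rates passes to their successive derivatives, by
    induction on the order, and then to rate 0 by monotone convergence. *)
Lemma moments_of_laplace {R : realType} d1 d2 (T1 : measurableType d1) (T2 : measurableType d2)
    (mu1 : {measure set T1 -> \bar R}) (mu2 : {measure set T2 -> \bar R})
    (D1 : set T1) (D2 : set T2) (X1 q1 : T1 -> R) (X2 q2 : T2 -> R) :
  measurable D1 -> measurable_fun D1 X1 -> measurable_fun D1 q1 ->
  (forall w, D1 w -> 0 <= X1 w) -> (forall w, D1 w -> 0 <= q1 w) ->
  measurable D2 -> measurable_fun D2 X2 -> measurable_fun D2 q2 ->
  (forall w, D2 w -> 0 <= X2 w) -> (forall w, D2 w -> 0 <= q2 w) ->
  (forall l : R, (0 < l)%R -> \int[mu1]_(w in D1) (expR (- (l * X1 w)) * q1 w)%:E < +oo)%E ->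
  (forall l : R, (0 < l)%R -> \int[mu1]_(w in D1) (expR (- (l * X1 w)) * q1 w)%:E =
     \int[mu2]_(w in D2) (expR (- (l * X2 w)) * q2 w)%:E)%E ->
  forall j, (\int[mu1]_(w in D1) (X1 w ^+ j * q1 w)%:E =
    \int[mu2]_(w in D2) (X2 w ^+ j * q2 w)%:E)%E.
Proof.
move=> mD1 mX1 mq1 X10 q10 mD2 mX2 mq2 X20 q20 fin eq12 j.
have E0 d (T : measurableType d) (mu : {measure set T -> \bar R}) D X q l :
    (\int[mu]_(w in D) (laplace_integrand X q 0 l w)%:E =
     \int[mu]_(w in D) (expR (- (l * X w)) * q w)%:E)%E.
  by apply: eq_integral => w _; rewrite /laplace_integrand expr0 mul1r.
have fin1 l : 0 < l -> (\int[mu1]_(w in D1) (laplace_integrand X1 q1 0 l w)%:E < +oo)%E.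
  by move=> l0; rewrite E0 fin.
have fin2 l : 0 < l -> (\int[mu2]_(w in D2) (laplace_integrand X2 q2 0 l w)%:E < +oo)%E.
  by move=> l0; rewrite E0 -eq12// fin.
have eqj i : forall l, 0 < l -> \int[mu1]_(w in D1) laplace_integrand X1 q1 i l w =
    \int[mu2]_(w in D2) laplace_integrand X2 q2 i l w.
  elim: i => [|i IH] l l0; first by rewrite /Rintegral !E0 eq12.
  have h1 := laplace_derivative mD1 mX1 mq1 X10 q10 fin1 (j := i) l0.
  have h2 := laplace_derivative mD2 mX2 mq2 X20 q20 fin2 (j := i) l0.
  apply: (cvg_unique _ h1) => //; move: h2; apply: cvg_trans; apply: near_eq_cvg.
  by apply: nearW => n; rewrite !IH// addr_gt0// invr_gt0.
have m1 := laplace_monotone (mu := mu1) mD1 mX1 mq1 X10 q10 (j := j).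
have m2 := laplace_monotone (mu := mu2) mD2 mX2 mq2 X20 q20 (j := j).
apply: (cvg_unique _ m1) => //; move: m2; apply: cvg_trans; apply: near_eq_cvg.
apply: nearW => n; have n0 : 0 < n.+1%:R^-1 :> R by rewrite invr_gt0.
have f1 := integrable_fin_num mD1 (integrable_laplace_integrand mD1 mX1 mq1 X10 q10 fin1 j n0).
have f2 := integrable_fin_num mD2 (integrable_laplace_integrand mD2 mX2 mq2 X20 q20 fin2 j n0).
rewrite -(fineK f1) -(fineK f2); congr EFin; apply/esym; exact: eqj.
Qed.

(** * The stopped exponential martingale on a grid *)

Section Independence.
Context {d : measure_display} {Omega : measurableType d} {R : realType}.
Variable (P : probability Omega R).

(** The joint law is the product law, by uniqueness on rectangles, and Tonelli applies. [T1] is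
    arbitrary so that [X] may be the identity into Omega with a smaller sigma-algebra. *)
Lemma indep_integral d1 d2 (T1 : measurableType d1) (T2 : measurableType d2)
    (X : Omega -> T1) (Y : Omega -> T2) (f : T1 -> R) (g : T2 -> R) :
  measurable_fun setT X -> measurable_fun setT Y ->
  (forall A B, measurable A -> measurable B ->
    P (X @^-1` A `&` Y @^-1` B) = (P (X @^-1` A) * P (Y @^-1` B))%E) ->
  measurable_fun setT f -> measurable_fun setT g ->
  (forall x, 0 <= f x) -> (forall y, 0 <= g y) ->
  (\int[P]_w (f (X w) * g (Y w))%:E = \int[P]_w (f (X w))%:E * \int[P]_w (g (Y w))%:E)%E.
Proof.
move=> mX mY indep mf mg f0 g0.
have mZ := measurable_fun_pair mX mY.
pose X' : {RV P >-> T1} := mfun_Sub (mem_set mX).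
pose Y' : {RV P >-> T2} := mfun_Sub (mem_set mY).
pose Z' : {RV P >-> (T1 * T2)%type} := mfun_Sub (mem_set mZ).
pose PX : probability T1 R := distribution P X'.
pose PY : probability T2 R := distribution P Y'.
pose PZ : probability (T1 * T2)%type R := distribution P Z'.
have PZE A : measurable A -> (PX \x PY)%E A = PZ A.
  apply: product_measure_unique => B C mB mC; rewrite -[RHS]indep//.
have mfg : measurable_fun setT (fun z : T1 * T2 => (f z.1 * g z.2)%:E).
  by apply/measurable_EFinP; apply: measurable_funM; exact: measurableT_comp.
have fg0 z : (0 <= (f z.1 * g z.2)%:E)%E by rewrite lee_fin mulr_ge0.
transitivity (\int[PZ]_z (f z.1 * g z.2)%:E)%E.
  by rewrite ge0_integral_distribution.
rewrite (eq_measure_integral (PX \x PY)%E); last by move=> A mA _; symmetry; exact: PZE.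
rewrite (fubini_tonelli1 (fun z : T1 * T2 => (f z.1 * g z.2)%:E))//.
have EY : (\int[PY]_y (g y)%:E = \int[P]_w (g (Y w))%:E)%E.
  rewrite ge0_integral_distribution//; first exact/measurable_EFinP.
transitivity (\int[PX]_x ((f x)%:E * \int[P]_w (g (Y w))%:E))%E.
  apply: eq_integral => x _; rewrite -EY /fubini_F /=.
  under eq_integral do rewrite EFinM.
  rewrite ge0_integralZl//; first exact/measurable_EFinP.
    by move=> y _; rewrite lee_fin.
  by rewrite lee_fin.
rewrite ge0_integralZr//; first last.
- by apply: integral_ge0 => w _; rewrite lee_fin.
- by move=> x _; rewrite lee_fin.
- exact/measurable_EFinP.
by congr (_ * _)%E; rewrite ge0_integral_distribution//; exact/measurable_EFinP.
Qed.

Lemma integral_law d1 (T1 : measurableType d1) (Q : probability T1 R) (X : Omega -> T1)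
    (f : T1 -> \bar R) :
  measurable_fun setT X -> (forall A, measurable A -> P (X @^-1` A) = Q A) ->
  measurable_fun setT f -> (forall x, 0 <= f x)%E ->
  (\int[P]_w f (X w) = \int[Q]_x f x)%E.
Proof.
move=> mX PQ mf f0; pose X' : {RV P >-> T1} := mfun_Sub (mem_set mX).
transitivity (\int[distribution P X']_x f x)%E; first by rewrite ge0_integral_distribution.
by apply: eq_measure_integral => A mA _; exact: PQ.
Qed.

(** P(A & E) and P(A) P(E) are finite measures in A that agree on a generating pi-system. *)
Lemma indep_sigma_algebra (C : set (set Omega)) (E : set Omega) :
  C `<=` measurable -> setI_closed C -> C setT -> measurable E ->
  (forall A, C A -> P (A `&` E) = (P A * P E)%E) ->
  forall A, <<s C >> A -> P (A `&` E) = (P A * P E)%E.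
Proof.
move=> Cm CI CT mE indep A sA.
have PE0 : 0 <= fine (P E) by exact: fine_ge0.
have PEE : P E = (fine (P E))%:E by rewrite fineK// fin_num_measure.
pose m1 := mrestr P mE; pose m2 := mscale (NngNum PE0) P.
have e2 B : m2 B = (P B * P E)%E by rewrite /m2 /mscale /= -PEE muleC.
have := @g_sigma_algebra_measure_unique _ _ _ C Cm (fun=> setT) (fun=> CT) _ m1 m2 CI.
move=> h; rewrite -e2; apply: h => //.
- by rewrite bigcup_const//; exists 0%N.
- by move=> B CB; transitivity (P B * P E)%E; [exact: indep|rewrite -e2].
- move=> _; suff : (P (setT `&` E) < +oo)%E by [].
  by rewrite setTI PEE ltry.
Qed.

(** The Radon-Nikodym derivative of the normal law and the explicit density have the same integral
    over every measurable set, hence agree almost everywhere. *)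
Lemma ge0_integral_normal_prob (s : R) (f : R -> \bar R) : s != 0 ->
  measurable_fun setT f -> (forall x, 0 <= f x)%E ->
  (\int[normal_prob 0 s]_x f x = \int[@lebesgue_measure R]_x (f x * (normal_pdf 0 s x)%:E))%E.
Proof.
move=> s0 mf f0; have dom := @normal_prob_dominates R 0 s.
rewrite -(Radon_Nikodym_SigmaFinite.change_of_variables dom f0)//.
set g := Radon_Nikodym_SigmaFinite.f _ _.
have ig := Radon_Nikodym_SigmaFinite.f_integrable dom; rewrite -/g in ig.
have ip := @integrable_normal_pdf R 0 s.
have gp : ae_eq (@lebesgue_measure R) setT g (EFin \o normal_pdf 0 s).
  apply: integral_ae_eq => //; first exact: measurable_int ip.
  by move=> E _ mE; rewrite -Radon_Nikodym_SigmaFinite.f_integral.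
apply: ae_eq_integral => //.
- by apply: emeasurable_funM => //; exact: measurable_int ig.
- by apply: emeasurable_funM => //; exact: measurable_int ip.
- exact: ae_eqe_mul2l.
Qed.

(** Completing the square: e^(c x) times the centred density is a constant times the density with
    mean c s^2. *)
Lemma normal_mgf (s c : R) : 0 < s ->
  (\int[normal_prob 0 s]_x (expR (c * x))%:E = (expR (c ^+ 2 * s ^+ 2 / 2))%:E)%E.
Proof.
move=> s0; have sn0 : s != 0 by rewrite gt_eqF.
rewrite ge0_integral_normal_prob//; last first.
  by apply/measurable_EFinP; apply: measurableT_comp => //; exact: measurable_funM.
transitivity (\int[@lebesgue_measure R]_x ((expR (c ^+ 2 * s ^+ 2 / 2))%:E * (normal_pdf (c * s ^+ 2) s x)%:E))%E.
  apply: eq_integral => x _; rewrite -!EFinM; congr EFin.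
  rewrite !normal_pdfE// [LHS]mulrCA [RHS]mulrCA; congr (_ * _).
  rewrite /normal_fun -!expRD; congr expR.
  rewrite -mulr_natl; field; by rewrite sn0.
rewrite ge0_integralZl//; first last.
- by move=> x _; rewrite lee_fin normal_pdf_ge0.
- by apply/measurable_EFinP; exact: measurable_normal_pdf.
by rewrite integral_normal_pdf mule1.
Qed.

End Independence.

Section StoppedExponential.
Context {d : measure_display} {Omega : measurableType d} {R : realType}.
Variables (P : probability Omega R) (W : R -> {RV P >-> R}).
Hypotheses (Windep : independent_increments W) (Wgauss : gaussian_increments W).
Variables (nu sigma l dt : R).
Hypothesis dt0 : 0 < dt.

Definition grid_inc (i : nat) (w : Omega) : R := increment W (i%:R * dt) (i.+1%:R * dt) w.

(** Built from increments rather than from values of [W], so that it depends visibly on the first k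
    increments; it is the drifted path on the grid wherever W 0 = 0. *)
Definition grid_walk (k : nat) (w : Omega) : R :=
  nu * (k%:R * dt) + sigma * \sum_(i < k) grid_inc i w.

(** The exponent psi: E e^(c X_t) = e^(psi(c) t) for X_t = nu t + sigma W_t. *)
Definition cumulant (c : R) : R := nu * c + sigma ^+ 2 * c ^+ 2 / 2.

Definition expmart (c : R) (k : nat) (w : Omega) : R :=
  expR (c * grid_walk k w - cumulant c * (k%:R * dt)).

(* [below k] is the indicator of the event that the walk has not exceeded [l] up to index
   [k]; [stop_index k] is the first index at which it has, or [k]. *)
Fixpoint below (k : nat) (w : Omega) : R :=
  \1_(`]-oo, l]) (grid_walk k w) * (if k is k'.+1 then below k' w else 1).

Fixpoint stop_index (k : nat) (w : Omega) : nat :=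
  if k is k'.+1 then if below k' w == 1 then k else stop_index k' w else 0%N.

(** A recursion affine in [expmart], so that the martingale step reduces to linearity of the
    integral. *)
Fixpoint stopped (c : R) (k : nat) (w : Omega) : R :=
  if k is k'.+1 then below k' w * expmart c k w + (1 - below k' w) * stopped c k' w
  else expmart c 0 w.

Let indic_itv_le (x : R) : \1_(`]-oo, l]) x = ((x <= l)%R : bool)%:R :> R.
Proof. by rewrite indicE mem_setE in_itv. Qed.

Lemma below01 k w : below k w = 0 \/ below k w = 1.
Proof.
elim: k => [|k IH] /=; rewrite indicE; case: (_ \in _); rewrite ?mul0r ?mul1r; try by left.
  by right.
exact: IH.
Qed.

Lemma below_sqr k w : below k w * below k w = below k w.
Proof. by case: (below01 k w) => ->; rewrite ?mulr0 ?mulr1. Qed.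

Lemma stopped_expmart c k w : stopped c k w = expmart c (stop_index k w) w.
Proof.
elim: k => [|k IH] //=; case: (below01 k w) => ->.
  by rewrite eq_sym oner_eq0 mul0r add0r subr0 mul1r.
by rewrite eqxx subrr mul0r addr0 mul1r.
Qed.

Lemma stop_index_le k w : (stop_index k w <= k)%N.
Proof. by elim: k => [|k IH] //=; case: ifP => // _; exact: leqW. Qed.

(** While the walk is still running, the stopped value is the current one; this puts the outcome of
    the martingale step back in stopped form. *)
Lemma below_stopped c k w : below k w * stopped c k w = below k w * expmart c k w.
Proof.
case: k => [|k] //=; set u := \1_ _ _; rewrite -!mulrA; congr (_ * _).
by rewrite mulrDr !mulrA below_sqr mulrBr mulr1 below_sqr subrr mul0r addr0.
Qed.

Lemma grid_walk_gt_stop k w : (stop_index k w < k)%N -> l < grid_walk (stop_index k w) w.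
Proof.
elim: k => [|k IH] //=; case: (below01 k w) => bk; rewrite bk ?eqxx ?ltnn// eq_sym oner_eq0.
rewrite ltnS leq_eqVlt => /predU1P[e|]; last exact: IH.
rewrite e; move: bk e; case: k {IH} => [|k] /=; rewrite indic_itv_le.
  by case: leP => // _; rewrite mul1r => /eqP; rewrite oner_eq0.
case: (below01 k w) => ->; rewrite ?mulr0 ?mulr1.
  by rewrite eq_sym oner_eq0 => _ e; have := stop_index_le k w; rewrite e ltnn.
by case: leP => // _ /eqP; rewrite oner_eq0.
Qed.

Lemma below_walk k w : below k w = 1 -> forall j, (j <= k)%N -> grid_walk j w <= l.
Proof.
elim: k => [|k IH] /=; rewrite indic_itv_le; case: leP => h;
  rewrite ?mul0r ?mul1r; try by move/eqP; rewrite eq_sym oner_eq0.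
  by move=> _ j; rewrite leqn0 => /eqP ->.
by move=> b1 j; rewrite leq_eqVlt => /predU1P[->//|]; rewrite ltnS; exact: IH.
Qed.

Lemma grid_walk_le_before k w j : (j < stop_index k w)%N -> grid_walk j w <= l.
Proof.
elim: k => [|k IH] //=; case: eqP => [b1|_]; last exact: IH.
by rewrite ltnS => jk; exact: below_walk b1 _ jk.
Qed.

Section PastMeasurability.
Variables (d' : measure_display) (T : measurableType d') (inc : nat -> T -> R) (k : nat).
Hypothesis minc : forall i, (i < k)%N -> measurable_fun setT (inc i).

(** Stated for any measurable type, for use both on Omega and on Omega with the sigma-algebra of the
    past. *)
Lemma measurable_partial_sum j : (j <= k)%N ->
  measurable_fun setT (fun w => \sum_(i < j) inc i w).
Proof.
elim: j => [_|j IH jk].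
  by under eq_fun do rewrite big_ord0; exact: measurable_cst.
under eq_fun do rewrite big_ord_recr /=.
by apply: measurable_funD; [exact/IH/ltnW|exact: minc].
Qed.

End PastMeasurability.

(** A pi-system generating the sigma-algebra of the first k increments. *)
Definition past_cylinders (k : nat) : set (set Omega) :=
  [set G | exists A : nat -> set R, (forall i, measurable (A i)) /\
    G = \bigcap_(i in `I_k) (grid_inc i @^-1` A i)].

Lemma measurable_grid_inc i : measurable_fun setT (grid_inc i).
Proof. by apply: measurable_funB; exact: measurable_funPT. Qed.

Lemma past_cylinders_measurable k : past_cylinders k `<=` measurable.
Proof.
move=> _ [A [mA ->]]; apply: bigcap_measurableType => i _.
by rewrite -[X in measurable X]setTI; exact: measurable_grid_inc.
Qed.

Lemma past_cylinders_setI k : setI_closed (past_cylinders k).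
Proof.
move=> _ _ [A [mA ->]] [B [mB ->]]; exists (fun i => A i `&` B i); split.
  by move=> i; exact: measurableI.
by rewrite -bigcapI; apply: eq_bigcapr => i _; rewrite preimage_setI.
Qed.

Lemma past_cylinders_setT k : past_cylinders k setT.
Proof.
exists (fun=> setT); split => //.
by apply/seteqP; split => // w _ i _.
Qed.

Lemma past_independent k (B : set R) : measurable B -> forall A, <<s past_cylinders k >> A ->
  P (A `&` grid_inc k @^-1` B) = (P A * P (grid_inc k @^-1` B))%E.
Proof.
move=> mB; apply: indep_sigma_algebra.
- exact: past_cylinders_measurable.
- exact: past_cylinders_setI.
- exact: past_cylinders_setT.
- by rewrite -[X in measurable X]setTI; exact: measurable_grid_inc.
move=> _ [A [mA ->]].
(* Index k carries [B]: the product rule for k+1 increments is then the one for k increments times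
   the last factor. *)
pose A' i := if (i < k)%N then A i else B.
have mA' i : measurable (A' i) by rewrite /A'; case: ifP.
have t0 : 0 <= 0%:R * dt by rewrite mul0r.
have tn : nondecreasing_seq (fun i : nat => i%:R * dt).
  by move=> i j ij; rewrite ler_wpM2r ?ler_nat// ltW.
have h1 := Windep k.+1 t0 tn mA'; have h0 := Windep k t0 tn mA'.
have e0 : \bigcap_(i in `I_k) (grid_inc i @^-1` A i) =
    \bigcap_(i in `I_k) (increment W (i%:R * dt) (i.+1%:R * dt) @^-1` A' i).
  by apply: eq_bigcapr => i /= ik; rewrite /A' ik.
have e1 : \bigcap_(i in `I_k) (grid_inc i @^-1` A i) `&` grid_inc k @^-1` B =
    \bigcap_(i in `I_k.+1) (increment W (i%:R * dt) (i.+1%:R * dt) @^-1` A' i).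
  rewrite e0; apply/seteqP; split => [w [h hk] i /=|w h].
    rewrite ltnS leq_eqVlt => /predU1P[->|ik]; last exact: h.
    by rewrite /A' ltnn.
  split; first by move=> i /= ik; apply: h; rewrite /= ltnS ltnW.
  by have := h k (ltnSn k); rewrite /A' ltnn.
rewrite e1 e0 h1 h0 big_ord_recr /=; congr (_ * P _)%E.
by rewrite /A' ltnn.
Qed.

Lemma grid_inc_mgf (c : R) k :
  (\int[P]_w (expR (c * (nu * dt + sigma * grid_inc k w) - cumulant c * dt))%:E = 1)%E.
Proof.
have sd0 : 0 < Num.sqrt dt by rewrite sqrtr_gt0.
have mi := measurable_grid_inc k.
pose C := expR (c * (nu * dt) - cumulant c * dt).
transitivity (\int[P]_w (C%:E * (expR (c * sigma * grid_inc k w))%:E))%E.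
  by apply: eq_integral => w _; rewrite -EFinM -expRD; congr (expR _)%:E; ring.
rewrite ge0_integralZl//; first last.
- by rewrite lee_fin expR_ge0.
- apply/measurable_EFinP; apply: measurableT_comp => //.
  by apply: measurable_funM => //; exact: measurable_grid_inc.
have -> : (\int[P]_w (expR (c * sigma * grid_inc k w))%:E =
    \int[normal_prob 0 (Num.sqrt dt)]_x (expR (c * sigma * x))%:E)%E.
  apply: (@integral_law _ _ _ P _ (measurableTypeR R) (normal_prob 0 (Num.sqrt dt)) (grid_inc k)
    (fun x => (expR (c * sigma * x))%:E)) => //.
  - move=> A mA; have kdt : k.+1%:R * dt - k%:R * dt = dt by rewrite -mulrBl -natr1 addrAC subrr add0r mul1r.
    rewrite -[in RHS]kdt; apply: Wgauss => //; first by rewrite mulr_ge0// ltW.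
    by rewrite ltr_pM2r// ltr_nat.
  - by apply/measurable_EFinP; apply: measurableT_comp => //; exact: measurable_funM.
rewrite normal_mgf// -EFinM /C -expRD sqr_sqrtr ?ltW// /cumulant.
by rewrite [X in expR X](_ : _ = 0) ?expR0//; field.
Qed.

Lemma measurable_grid_walk k : measurable_fun setT (grid_walk k).
Proof.
apply: measurable_funD => //; apply: measurable_funM => //.
by apply: (measurable_partial_sum (k := k)) => // i _; exact: measurable_grid_inc.
Qed.

Lemma measurable_below k : measurable_fun setT (below k).
Proof.
elim: k => [|k IH] /=; apply: measurable_funM => //;
  by apply: measurableT_comp; [exact: measurable_indic|exact: measurable_grid_walk].
Qed.

Lemma measurable_expmart c k : measurable_fun setT (expmart c k).
Proof.
apply: measurableT_comp => //; apply: measurable_funB => //.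
by apply: measurable_funM => //; exact: measurable_grid_walk.
Qed.

Lemma measurable_stopped c k : measurable_fun setT (stopped c k).
Proof.
elim: k => [|k IH] /=; first exact: measurable_expmart.
apply: measurable_funD; apply: measurable_funM => //; try exact: measurable_below.
  exact: measurable_expmart.
by apply: measurable_funB => //; exact: measurable_below.
Qed.

(** The martingale step: the next value is the present one times a factor of mean 1 that depends
    only on the next increment, and the event of still running belongs to the past. *)
Lemma expectation_below_expmart c k :
  (\int[P]_w (below k w * expmart c k.+1 w)%:E = \int[P]_w (below k w * expmart c k w)%:E)%E.
Proof.
(* [T1] is Omega with the sigma-algebra of the past, so measurability of [f] on [T1] expresses
   adaptedness. *)
pose G := past_cylinders k; pose T1 := g_sigma_algebraType G.
pose f : T1 -> R := fun w => below k w * expmart c k w.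
pose g (y : R) := expR (c * (nu * dt + sigma * y) - cumulant c * dt).
have minc i : (i < k)%N -> measurable_fun (setT : set T1) (grid_inc i : T1 -> R).
  move=> ik _ A mA; rewrite setTI; apply: sub_sigma_algebra.
  exists (fun j => if j == i then A else setT); split => [j|]; first by case: ifP.
  apply/seteqP; split => [w Aw j /= jk|w h].
    by case: eqP => // ->.
  by have := h i ik; rewrite eqxx.
have mwalk j : (j <= k)%N -> measurable_fun (setT : set T1) (grid_walk j : T1 -> R).
  move=> jk; apply: measurable_funD => //; apply: measurable_funM => //.
  exact: (measurable_partial_sum minc).
have mbelow j : (j <= k)%N -> measurable_fun (setT : set T1) (below j : T1 -> R).
  elim: j => [|j IH] jk /=; apply: measurable_funM => //; try (by apply: IH; exact: ltnW);
  by apply: measurableT_comp; [exact: measurable_indic|exact: mwalk].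
have mf : measurable_fun setT f.
  apply: measurable_funM; first exact: mbelow.
  apply: measurableT_comp => //; apply: measurable_funB => //.
  by apply: measurable_funM => //; exact: mwalk.
have mg : measurable_fun setT g.
  apply: measurableT_comp => //; apply: measurable_funB => //.
  by do 2!(apply: measurable_funM => //; apply: measurable_funD => //).
have f0 w : 0 <= f w.
  by rewrite /f mulr_ge0 ?expR_ge0//; case: (below01 k w) => ->.
have mid : measurable_fun setT (fun w : Omega => w : T1).
  move=> _ A mA; rewrite setTI.
  exact: (smallest_sub (@sigma_algebra_measurable _ Omega) (@past_cylinders_measurable k)).
have := @indep_integral _ _ _ P _ _ T1 R (fun w => w) (grid_inc k) f g mid (measurable_grid_inc k).
move=> /(_ (fun A B mA mB => past_independent mB mA) mf mg f0 (fun=> expR_ge0 _)) h.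
transitivity (\int[P]_w (f w * g (grid_inc k w))%:E)%E.
  apply: eq_integral => w _; congr EFin; rewrite /f -mulrA; congr (_ * _).
  rewrite /expmart /g -expRD; congr expR; rewrite /grid_walk big_ord_recr /= -natr1; ring.
by rewrite h grid_inc_mgf mule1.
Qed.

Lemma stopped_ge0 c k w : 0 <= stopped c k w.
Proof. by rewrite stopped_expmart expR_ge0. Qed.

Lemma stopped_expectation c k : (\int[P]_w (stopped c k w)%:E = 1)%E.
Proof.
elim: k => [|k IH].
  rewrite /= (eq_integral (fun=> 1%E)) => [|w _]; last first.
    by rewrite /expmart /grid_walk big_ord0 !mul0r !mulr0 addr0 mulr0 subrr expR0.
  by rewrite integral_cst// mul1e; exact: probability_setT.
have b0 j w : 0 <= below j w by case: (below01 j w) => ->.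
have b1 j w : 0 <= 1 - below j w by case: (below01 j w) => ->; rewrite ?subr0 ?subrr.
have mB : measurable_fun setT (fun w => (1 - below k w) * stopped c k w).
  by apply: measurable_funM; [apply: measurable_funB => //; exact: measurable_below|exact: measurable_stopped].
have split_int (u : Omega -> R) : measurable_fun setT u -> (forall w, 0 <= u w) ->
   (\int[P]_w (below k w * u w + (1 - below k w) * stopped c k w)%:E =
    \int[P]_w (below k w * u w)%:E + \int[P]_w ((1 - below k w) * stopped c k w)%:E)%E.
  move=> mu u0; under eq_integral do rewrite EFinD.
  rewrite ge0_integralD//.
  - by move=> w _; rewrite lee_fin mulr_ge0.
  - by apply/measurable_EFinP; apply: measurable_funM => //; exact: measurable_below.
  - by move=> w _; rewrite lee_fin mulr_ge0// stopped_ge0.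
  - exact/measurable_EFinP.
rewrite /= split_int; [|exact: (measurable_expmart c k.+1)|by move=> w; exact: expR_ge0].
rewrite expectation_below_expmart -split_int; [|exact: measurable_expmart|by move=> w; exact: expR_ge0].
rewrite -IH; apply: eq_integral => w _; congr EFin.
by rewrite -below_stopped; ring.
Qed.

(** Squaring doubles c and costs psi(2c) - 2 psi(c) = sigma^2 c^2 per unit of time, over a time of
    at most k dt. As the process with parameter 2c has mean 1, second moments are bounded
    independently of the mesh. *)
Lemma stopped_sqr c k w :
  stopped c k w ^+ 2 <= expR (sigma ^+ 2 * c ^+ 2 * (k%:R * dt)) * stopped (2 * c) k w.
Proof.
rewrite !stopped_expmart /expmart -expRM_natl -expRD ler_expR /cumulant.
have := stop_index_le k w; rewrite -(ler_nat R) => kk.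
set n := (stop_index k w)%:R in kk *; set X := grid_walk _ _.
have : sigma ^+ 2 * c ^+ 2 * (n * dt) <= sigma ^+ 2 * c ^+ 2 * (k%:R * dt).
  apply: ler_wpM2l; first by rewrite mulr_ge0 ?sqr_ge0.
  by apply: ler_wpM2r => //; exact: ltW.
rewrite -subr_ge0 => h; rewrite -subr_ge0; apply: le_trans h _.
rewrite le_eqVlt; apply/orP; left; apply/eqP; by field.
Qed.

End StoppedExponential.

(** * The first passage time *)

Section PathHitting.
Context {R : realType}.
Variables (x : R -> R) (l : R).
Hypotheses (xc : {within `[0, +oo[, continuous x}) (x0 : x 0 = 0) (l0 : 0 < l).

Lemma path_modulus t e : 0 <= t -> 0 < e ->
  exists2 dl, 0 < dl & forall u, 0 <= u -> `|u - t| < dl -> `|x t - x u| < e.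
Proof.
move=> t0 e0; have ht : (`[0, +oo[%classic : set R) t by rewrite /= in_itv /= t0.
have /subspace_continuousP/(_ t ht)/cvgrPdist_lt/(_ e e0) := xc.
rewrite near_withinE => /nbhs_ballP[dl /= dl0 h]; exists dl => // u u0 ut.
by apply: h; rewrite /= ?in_itv /= ?u0// /ball /= distrC.
Qed.

Definition hit : \bar R := ereal_inf [set t%:E | t in [set t : R | 0 <= t /\ l < x t]].

Lemma hit_ge0 : (0 <= hit)%E.
Proof. by apply: le_ereal_inf_tmp => _ [t [t0 _] <-]; rewrite lee_fin. Qed.

Lemma hit_le t : 0 <= t -> l < x t -> (hit <= t%:E)%E.
Proof. by move=> t0 lt; apply: ereal_inf_lbound; exists t. Qed.

Lemma lt_hit r : (hit < r%:E)%E -> exists t, [/\ 0 <= t, l < x t & t < r].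
Proof.
by move=> /ereal_inf_lt[_ [t [t0 lt] <-]]; rewrite lte_fin => tr; exists t.
Qed.

(** By continuity, exceeding [l] at t would force it slightly earlier; the time 0 is excluded by x 0
    = 0 < l. *)
Lemma path_le_before_hit t : 0 <= t -> (t%:E <= hit)%E -> x t <= l.
Proof.
move=> t0 th; rewrite leNgt; apply/negP => lt.
have tpos : 0 < t.
  by rewrite lt_neqAle t0 andbT; apply: contraTneq lt => <-; rewrite x0 -leNgt ltW.
have lt' : 0 < x t - l by lra.
have [dl dl0 h] := path_modulus t0 lt'.
pose u := Num.max 0 (t - dl / 2).
have u0 : 0 <= u by rewrite le_max lexx.
have ut : u < t by rewrite gt_max tpos /= ltrBlDr ltrDl divr_gt0.
have tu : t - dl / 2 <= u by rewrite le_max lexx orbT.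
have /h : `|u - t| < dl.
  by rewrite ler0_norm; [lra|rewrite subr_le0 ltW].
move=> /(_ u0) /ltr_normlW hx.
have /(hit_le u0) : l < x u by lra.
by move=> /(le_trans th); rewrite lee_fin leNgt ut.
Qed.

(** A strict deficit would persist on a neighbourhood, while times of exceedance accumulate at the
    infimum from the right. *)
Lemma path_at_hit t : hit = t%:E -> x t = l.
Proof.
move=> ht; have t0 : 0 <= t by rewrite -lee_fin -ht hit_ge0.
apply/eqP; rewrite eq_le path_le_before_hit ?ht//= leNgt; apply/negP => lt.
have lt' : 0 < l - x t by lra.
have [dl dl0 h] := path_modulus t0 lt'.
have [|s [s0 ls st]] := @lt_hit (t + dl); first by rewrite ht lte_fin ltrDl.
have ts : t <= s by rewrite -lee_fin -ht hit_le.
have := h s s0; rewrite ger0_norm ?subr_ge0// ltrBlDl => /(_ st).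
rewrite ltr_norml => /andP[]; lra.
Qed.

Definition hit_min (K : R) : R := fine (mine hit K%:E).

Lemma hit_minE K : 0 <= K -> (hit_min K)%:E = mine hit K%:E.
Proof.
move=> K0; rewrite fineK// fin_real//; apply/andP; split.
  by rewrite lt_min (lt_le_trans _ hit_ge0)// ltNyr.
by rewrite gt_min ltry orbT.
Qed.

Lemma hit_min_ge0 K : 0 <= K -> 0 <= hit_min K.
Proof. by move=> K0; rewrite -lee_fin hit_minE// le_min hit_ge0 lee_fin. Qed.

Lemma hit_min_le K : 0 <= K -> ((hit_min K)%:E <= hit)%E.
Proof. by move=> K0; rewrite hit_minE// ge_min lexx. Qed.

Lemma hit_min_leK K : 0 <= K -> hit_min K <= K.
Proof. by move=> K0; rewrite -lee_fin hit_minE// ge_min lexx orbT. Qed.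

Lemma hit_min_lt K : 0 <= K -> (hit < K%:E)%E -> hit = (hit_min K)%:E.
Proof. by move=> K0 hK; rewrite hit_minE// min_l// ltW. Qed.

Lemma hit_min_ge K : 0 <= K -> (K%:E <= hit)%E -> hit_min K = K.
Proof. by move=> K0 hK; apply: EFin_inj; rewrite hit_minE// min_r. Qed.

(** The grid sees an exceedance only after it has occurred, so its stopping time is at least
    [hit_min]. Conversely the path stays above [l] near some s just after the hitting time, and a
    fine enough grid has a point there. *)
Lemma grid_stop_cvg (K : R) (n : nat -> nat) : 0 < K ->
  (forall m, n m <= m.+1)%N ->
  (forall m j, (j < n m)%N -> x (j%:R * (K / m.+1%:R)) <= l) ->
  (forall m, (n m < m.+1)%N -> l < x ((n m)%:R * (K / m.+1%:R))) ->
  (n m)%:R * (K / m.+1%:R) @[m --> \oo] --> hit_min K.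
Proof.
move=> K0 nm before after; have K0' := ltW K0.
have dt0 m : 0 < K / m.+1%:R by rewrite divr_gt0.
have stepK m : m.+1%:R * (K / m.+1%:R) = K by rewrite mulrC divfK.
have leK m : (n m)%:R * (K / m.+1%:R) <= K.
  by rewrite -[leRHS](stepK m) ler_pM2r// ler_nat.
have geh m : hit_min K <= (n m)%:R * (K / m.+1%:R).
  have := nm m; rewrite leq_eqVlt => /predU1P[->|/after h].
    by rewrite stepK hit_min_leK.
  rewrite -lee_fin; apply: le_trans (hit_min_le K0') _; apply: hit_le => //.
  by rewrite mulr_ge0// ltW.
have [hK|hK] := ltP hit K%:E; last first.
  rewrite hit_min_ge//; apply: cvg_near_cst; near=> m.
  by apply/eqP; rewrite eq_le leK -{1}(hit_min_ge K0' hK) geh.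
apply/cvgrPdist_lt => e e0.
have e20 : 0 < e / 2 by rewrite divr_gt0.
have [|s [s0 ls se]] := @lt_hit (hit_min K + e / 2).
  by rewrite (hit_min_lt K0' hK) lte_fin ltrDl.
have ls' : 0 < x s - l by lra.
have [dl dl0 h] := path_modulus s0 ls'.
have r0 : 0 < Num.min dl (e / 2) / K by rewrite divr_gt0// lt_min dl0.
have := near_infty_natSinv_lt (PosNum r0); apply: filterS => m /= mr.
have {mr} : K / m.+1%:R < Num.min dl (e / 2) by rewrite mulrC -ltr_pdivlMr.
rewrite lt_min => /andP[mdl me].
(* The first grid index strictly after s, hence within one mesh of it. *)
pose j := (Num.truncn (s / (K / m.+1%:R))).+1.
have /andP[j1 j2] : s < j%:R * (K / m.+1%:R) <= s + K / m.+1%:R.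
  have sq : 0 <= s / (K / m.+1%:R) by rewrite divr_ge0// ltW.
  have /andP[h1 h2] := truncn_itv sq.
  rewrite -ltr_pdivrMr// h2 /= /j -natr1 mulrDl mul1r lerD2r.
  by rewrite -ler_pdivlMr.
have nj : (n m <= j)%N.
  rewrite leqNgt; apply/negP => /before; rewrite leNgt => /negP; apply.
  have j0 : 0 <= j%:R * (K / m.+1%:R) by rewrite mulr_ge0// ltW.
  have /(h _ j0)/ltr_normlW : `|j%:R * (K / m.+1%:R) - s| < dl.
    rewrite ger0_norm ?subr_ge0 1?ltW// ltrBlDl (le_lt_trans j2)// ltrD2l//.
  by rewrite ltrD2l ltrN2.
have g : (n m)%:R * (K / m.+1%:R) <= j%:R * (K / m.+1%:R) by rewrite ler_pM2r// ler_nat.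
rewrite distrC ger0_norm ?subr_ge0 ?geh// ltrBlDl (le_lt_trans g)// (le_lt_trans j2)//.
by rewrite [ltRHS](_ : _ = hit_min K + e / 2 + e / 2) ?ltrD//; field.
Unshelve. all: by end_near. Qed.

Lemma path_cvg (s : nat -> R) (t : R) : (forall m, 0 <= s m) -> 0 <= t ->
  s m @[m --> \oo] --> t -> x (s m) @[m --> \oo] --> x t.
Proof.
move=> s0 t0 st; apply/cvgrPdist_lt => e e0.
have [dl dl0 h] := path_modulus t0 e0.
have /cvgrPdist_lt/(_ dl dl0) := st; apply: filterS => m mt.
by apply: h => //; rewrite distrC.
Qed.

Lemma hit_min_near t : hit = t%:E -> \forall m \near \oo, hit_min m.+1%:R = t.
Proof.
move=> ht; have := nbhs_infty_gtr t; apply: filterS => m tm.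
apply: EFin_inj; rewrite -ht; symmetry; apply: hit_min_lt => //.
by rewrite ht lte_fin (lt_trans tm)// ltr_nat.
Qed.

End PathHitting.

(** * Limits on a set of full measure *)

Section ConullConvergence.
Import HBNNSimple.
Context {d : measure_display} {Omega : measurableType d} {R : realType}.
Variables (P : probability Omega R) (D : set Omega).
Hypotheses (mD : measurable D) (PD : P (~` D) = 0%E).

Let ge0_integral_conull_fun (f : Omega -> \bar R) : measurable_fun setT f ->
  (forall w, 0 <= f w)%E -> (\int[P]_w f w = \int[P]_(w in D) f w)%E.
Proof.
move=> mf f0; have mDC : measurable (~` D) by exact: measurableC.
by rewrite (ge0_negligible_integral (N := ~` D))// setDE setTI setCK.
Qed.

(* [f] need not be measurable outside [D]: the integral of a nonnegative
   function is the supremum of the integrals of the simple functions below it. *)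
Lemma ge0_integral_conull (f : Omega -> \bar R) : measurable_fun D f ->
  (forall w, 0 <= f w)%E -> (\int[P]_w f w = \int[P]_(w in D) f w)%E.
Proof.
move=> mf f0; apply/eqP; rewrite eq_le; apply/andP; split.
  rewrite ge0_integralTE//; apply: ge_ereal_sup => _ [h hf <-].
  have mh : measurable_fun setT (EFin \o h) by exact/measurable_EFinP.
  rewrite -integralT_nnsfun ge0_integral_conull_fun//; last first.
    by move=> w; rewrite lee_fin.
  apply: ge0_le_integral => //; last by exact: (measurable_funS measurableT).
  by move=> w _; rewrite lee_fin.
rewrite ge0_integralTE// ge0_integralE//; apply: ereal_sup_le => _ [h hf <-].
exists h => // w; apply: le_trans (hf w) _; rewrite /patch; case: ifPn => // _.
Qed.

Variable V_ : nat -> Omega -> R.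
Hypotheses (mV_ : forall m, measurable_fun D (V_ m)) (V0_ : forall m w, D w -> 0 <= V_ m w).
Variable V : Omega -> R.
Hypothesis cvgV : forall w, D w -> V_ m w @[m --> \oo] --> V w.

Lemma measurable_conull_limit : measurable_fun D V.
Proof. exact: measurable_fun_cvg mV_ cvgV. Qed.

Lemma conull_limit_ge0 w : D w -> 0 <= V w.
Proof. by move=> Dw; apply: (cvgr_to_ge (cvgV Dw)); apply: nearW => m; exact: V0_. Qed.

Lemma conull_bounded_convergence (c : R) : (forall m w, D w -> V_ m w <= c) ->
  (\int[P]_(w in D) (V_ m w)%:E)%E @[m --> \oo] --> (\int[P]_(w in D) (V w)%:E)%E.
Proof.
move=> Vc.
have mE m : measurable_fun D (EFin \o V_ m) by exact/measurable_EFinP.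
have mVE : measurable_fun D (EFin \o V) by apply/measurable_EFinP; exact: measurable_conull_limit.
have [| | |_ _] := @dominated_convergence _ _ R P D mD (fun m => EFin \o V_ m) (EFin \o V)
  (cst c%:E) mE mVE.
- apply/aeW => w Dw; apply: cvg_EFin; first exact: nearW.
  exact: cvgV.
- exact: finite_measure_integrable_cst.
- by apply/aeW => w m Dw; rewrite /= lee_fin ger0_norm ?V0_ ?Vc.
by [].
Qed.

End ConullConvergence.

(* Mass cannot escape to infinity when the second moments stay bounded:
   [V - min V c <= V ^ 2 / c]. *)
Lemma integral_limit_of_sqr {d : measure_display} {Omega : measurableType d} {R : realType}
    (P : probability Omega R) (D : set Omega) (V_ : nat -> Omega -> R) (V : Omega -> R) (C : R) :
  measurable D -> (forall m, measurable_fun D (V_ m)) -> (forall m w, D w -> 0 <= V_ m w) ->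
  (forall w, D w -> V_ m w @[m --> \oo] --> V w) -> 0 <= C ->
  (forall m, \int[P]_(w in D) (V_ m w)%:E = 1)%E ->
  (forall m, \int[P]_(w in D) (V_ m w ^+ 2)%:E <= C%:E)%E ->
  (\int[P]_(w in D) (V w)%:E = 1)%E.
Proof.
move=> mD mV_ V0_ cvgV C0 int1 int2.
have mV := measurable_conull_limit mV_ cvgV; have V0 := conull_limit_ge0 V0_ cvgV.
apply/eqP; rewrite eq_le; apply/andP; split.
  (* Fatou gives the upper bound 1. For the lower bound the functions are cut off at c, where
     bounded convergence applies. *)
  have := @fatou _ _ _ P D mD (fun m w => (V_ m w)%:E).
  have mE m : measurable_fun D (fun w => (V_ m w)%:E) by exact/measurable_EFinP.
  move=> /(_ mE) /(_ (fun m w Dw => V0_ m w Dw)).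
  rewrite (_ : (fun n => \int[P]_(x in D) (V_ n x)%:E)%E = cst 1%E); last by apply/funext => m; rewrite int1.
  rewrite is_cvg_limn_einfE; last exact: is_cvg_cst.
  rewrite lim_cst//; apply: le_trans; rewrite le_eqVlt; apply/orP; left; apply/eqP.
  apply: eq_integral => w; rewrite inE => Dw.
  have h : (V_ m w)%:E @[m --> \oo] --> (V w)%:E.
    by apply: cvg_EFin; [exact: nearW|exact: cvgV].
  by rewrite is_cvg_limn_einfE; [rewrite (cvg_lim _ h)|apply/cvg_ex; exists (V w)%:E].
(* With this level the loss by truncation, at most C/c, stays below e. *)
apply/lee_addgt0Pr => e e0; pose c := (C + 1) / e.
have C1 : 0 < C + 1 by lra.
have c0 : 0 < c by rewrite divr_gt0.
pose U_ m w := Num.min (V_ m w) c; pose U w := Num.min (V w) c.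
have mU_ m : measurable_fun D (U_ m) by exact: measurable_minr.
have mU : measurable_fun D U by exact: measurable_minr.
have U0_ m w : D w -> 0 <= U_ m w by move=> Dw; rewrite le_min V0_//= ltW.
have cvgU w : D w -> U_ m w @[m --> \oo] --> U w.
  move=> Dw; apply/cvgrPdist_lt => r r0; have /cvgrPdist_lt/(_ r r0) := cvgV w Dw.
  apply: filterS => m; apply: le_lt_trans; rewrite /U_ /U.
  have := ler_norm (V w - V_ m w); have := ler_norm (V_ m w - V w); rewrite distrC.
  move: (V w) (V_ m w) => u v h1 h2; rewrite ler_norml.
  by case: (leP u c) => ?; case: (leP v c) => ?; apply/andP; split; lra.
have Uc m w : D w -> U_ m w <= c by move=> _; rewrite ge_min lexx orbT.
have h := conull_bounded_convergence mD mU_ U0_ cvgU Uc.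
have bound m : (1 - e%:E <= \int[P]_(w in D) (U_ m w)%:E)%E.
  rewrite leeBlDr// -(int1 m).
  have sqr0 : (\int[P]_(w in D) ((V_ m w ^+ 2)%:E * c^-1%:E) <= e%:E)%E.
    rewrite ge0_integralZr//.
    - apply: (@le_trans _ _ (C%:E * c^-1%:E)%E).
        by apply: lee_wpmul2r; rewrite ?lee_fin ?invr_ge0 ?(ltW c0).
      rewrite -EFinM lee_fin /c invf_div mulrA ler_pdivrMr//.
      by rewrite mulrC ler_wpM2l ?ltW//; lra.
    - by apply/measurable_EFinP; exact: measurable_funX.
    - by move=> w _; rewrite lee_fin sqr_ge0.
    - by rewrite lee_fin invr_ge0 ltW.
  apply: le_trans (leeD2l _ sqr0).
  rewrite -ge0_integralD//; first last.
  - apply/measurable_EFinP; apply: measurable_funM => //; exact: measurable_funX.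
  - by move=> w _; rewrite lee_fin mulr_ge0 ?sqr_ge0 ?invr_ge0 ?ltW.
  - exact/measurable_EFinP.
  - by move=> w Dw; rewrite lee_fin U0_.
  apply: ge0_le_integral => //.
  - by move=> w Dw; rewrite lee_fin V0_.
  - exact/measurable_EFinP.
  - apply/measurable_EFinP; apply: measurable_funD => //.
    by apply: measurable_funM => //; exact: measurable_funX.
  move=> w Dw; rewrite -EFinM -EFinD lee_fin /U_; have v0 := V0_ m w Dw.
  have [vc|vc] := leP (V_ m w) c; first by rewrite lerDl mulr_ge0 ?sqr_ge0 ?invr_ge0 ?ltW.
  apply: (@le_trans _ _ (V_ m w ^+ 2 * c^-1)); last by rewrite lerDr ltW.
  by rewrite ler_pdivlMr// expr2 ler_wpM2l// ltW.
rewrite -leeBlDr//; apply: (@le_trans _ _ (\int[P]_(w in D) (U w)%:E)%E).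
  by apply: (cvge_to_ge (h P)); exact: nearW.
apply: ge0_le_integral => //; try exact/measurable_EFinP.
- by move=> w Dw; rewrite lee_fin le_min V0//= ltW.
by move=> w Dw; rewrite lee_fin ge_min lexx.
Qed.

(** * Hitting times of Brownian motion with drift *)

Section BrownianHitting.
Context {d : measure_display} {Omega : measurableType d} {R : realType}.
Variables (P : probability Omega R) (W : R -> {RV P >-> R}).

(** The exceptional sets need not be measurable; [D] is the complement of measurable null sets that
    contain them. *)
Lemma regular_paths : standard_brownian_motion W -> exists D : set Omega,
  [/\ measurable D, P (~` D) = 0%E, (forall w, D w -> W 0 w = 0) &
      forall w, D w -> {within `[0, +oo[, continuous (fun t => W t w)}].
Proof.
case=> -[A [mA PA sA]] _ _ [B [mB PB sB]]; exists (~` (A `|` B)); split.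
- by apply: measurableC; exact: measurableU.
- by rewrite setCK; apply: null_set_setU.
- by move=> w; apply: contra_notP => h; left; exact: sA.
- by move=> w; apply: contra_notP => h; right; exact: sB.
Qed.

Hypotheses (Windep : independent_increments W) (Wgauss : gaussian_increments W).
Variable D : set Omega.
Hypotheses (mD : measurable D) (PD : P (~` D) = 0%E) (W0 : forall w, D w -> W 0 w = 0).
Hypothesis Wc : forall w, D w -> {within `[0, +oo[, continuous (fun t => W t w)}.
Variables (nu sigma l : R).
Hypotheses (nu0 : 0 < nu) (sigma0 : 0 < sigma) (l0 : 0 < l).

Definition drifted (w : Omega) (t : R) : R := nu * t + sigma * W t w.

Lemma drifted0 w : D w -> drifted w 0 = 0.
Proof. by move=> Dw; rewrite /drifted W0// !mulr0 addr0. Qed.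

Lemma continuous_drifted w : D w -> {within `[0, +oo[, continuous (drifted w)}.
Proof.
move=> Dw; have cW := Wc Dw; apply/subspace_continuousP => x hx.
have /subspace_continuousP/(_ x hx) h := cW.
apply: cvgD; last by apply: cvgM; [exact: cvg_cst|exact: h].
apply: cvg_within_filter; apply: cvgM; [exact: cvg_cst|exact: cvg_id].
Qed.

Lemma grid_walk_drifted dt k w : D w -> grid_walk W nu sigma dt k w = drifted w (k%:R * dt).
Proof.
move=> Dw; rewrite /grid_walk /drifted; congr (_ + _ * _).
elim: k => [|k IH]; first by rewrite big_ord0 mul0r W0.
by rewrite big_ord_recr /= IH /grid_inc /increment addrC subrK.
Qed.

Section Horizon.
Variable K : R.
Hypothesis K0 : 0 < K.

Let dt m : R := K / m.+1%:R.
Let dt0 m : 0 < dt m. Proof. by rewrite divr_gt0. Qed.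

Let stop_time m w : R := (stop_index W nu sigma l (dt m) m.+1 w)%:R * dt m.

Let stop_time_ge0 m w : 0 <= stop_time m w.
Proof. by rewrite mulr_ge0// ltW. Qed.

Let stop_time_cvg w : D w -> stop_time m w @[m --> \oo] --> hit_min (drifted w) l K.
Proof.
move=> Dw; apply: (grid_stop_cvg (continuous_drifted Dw) K0).
- by move=> m; exact: stop_index_le.
- by move=> m j /grid_walk_le_before; rewrite grid_walk_drifted.
- by move=> m /grid_walk_gt_stop; rewrite grid_walk_drifted.
Qed.

Lemma measurable_stop_index delta k :
  measurable_fun setT (fun w => (stop_index W nu sigma l delta k w)%:R : R).
Proof.
elim: k => [|k IH]; first exact: measurable_cst.
rewrite (_ : (fun w => _) = (fun w => below W nu sigma l delta k w * k.+1%:R +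
  (1 - below W nu sigma l delta k w) * (stop_index W nu sigma l delta k w)%:R)).
  apply: measurable_funD; apply: measurable_funM => //; first exact: measurable_below.
  by apply: measurable_funB => //; exact: measurable_below.
apply/funext => w /=; case: (below01 W nu sigma l delta k w) => ->.
  by rewrite eq_sym oner_eq0 mul0r add0r subr0 mul1r.
by rewrite eqxx subrr mul0r addr0 mul1r.
Qed.

(** An infimum over uncountably many times, measurable as the limit of the grid stopping times. *)
Lemma measurable_hit_min : measurable_fun D (fun w => hit_min (drifted w) l K).
Proof.
apply: (measurable_fun_cvg (h := stop_time)); last exact: stop_time_cvg.
move=> m; apply: measurable_funM => //; apply: (measurable_funS measurableT) => //.
exact: measurable_stop_index.
Qed.

Definition hit_expmart (c : R) (w : Omega) : R :=
  expR (c * drifted w (hit_min (drifted w) l K) - cumulant nu sigma c * hit_min (drifted w) l K).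

Let stopped_cvg c w : D w ->
  stopped W nu sigma l (dt m) c m.+1 w @[m --> \oo] --> hit_expmart c w.
Proof.
move=> Dw; under eq_fun do rewrite stopped_expmart /expmart (grid_walk_drifted _ _ Dw).
have sc := stop_time_cvg Dw.
suff h : c * drifted w (stop_time m w) - cumulant nu sigma c * stop_time m w @[m --> \oo] -->
    c * drifted w (hit_min (drifted w) l K) - cumulant nu sigma c * hit_min (drifted w) l K.
  exact: (cvg_comp _ _ h (@continuous_expR R _)).
apply: cvgB; apply: cvgM; try exact: cvg_cst; last exact: sc.
by apply: (path_cvg (continuous_drifted Dw) _ _ sc) => [m|]; [exact: stop_time_ge0|exact/hit_min_ge0/ltW].
Qed.

Let stopped_cvg_measurable c m :
  measurable_fun D (stopped W nu sigma l (dt m) c m.+1).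
Proof. by apply: (measurable_funS measurableT) => //; exact: measurable_stopped. Qed.

Lemma measurable_hit_expmart c : measurable_fun D (hit_expmart c).
Proof. by apply: (measurable_fun_cvg (stopped_cvg_measurable c)) => w; exact: stopped_cvg. Qed.

(** Means equal to 1 pass to the limit of the grids because, for a fixed horizon K, the second
    moments are at most e^(sigma^2 c^2 K) for every mesh. *)
Lemma expectation_hit_expmart c : (\int[P]_(w in D) (hit_expmart c w)%:E = 1)%E.
Proof.
have int1 c' m : (\int[P]_(w in D) (stopped W nu sigma l (dt m) c' m.+1 w)%:E = 1)%E.
  rewrite -(ge0_integral_conull mD PD); first exact: (stopped_expectation Windep Wgauss).
    by apply/measurable_EFinP; exact: stopped_cvg_measurable.
  by move=> w; rewrite lee_fin stopped_ge0.
apply: (integral_limit_of_sqr (C := expR (sigma ^+ 2 * c ^+ 2 * K)) mD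
  (stopped_cvg_measurable c) _ (@stopped_cvg c) _ (int1 c)) => [m w _|//|m].
- exact: stopped_ge0.
have -> : (expR (sigma ^+ 2 * c ^+ 2 * K))%:E =
    ((expR (sigma ^+ 2 * c ^+ 2 * K))%:E *
     \int[P]_(w in D) (stopped W nu sigma l (dt m) (2 * c) m.+1 w)%:E)%E.
  by rewrite int1 mule1.
rewrite -ge0_integralZl//; first last.
- by move=> w _; rewrite lee_fin stopped_ge0.
- by apply/measurable_EFinP; exact: stopped_cvg_measurable.
apply: ge0_le_integral => //.
- by move=> w _; rewrite lee_fin sqr_ge0.
- by apply/measurable_EFinP; apply: measurable_funX; exact: stopped_cvg_measurable.
- by apply/measurable_EFinP; apply: measurable_funM => //; exact: stopped_cvg_measurable.
move=> w _; rewrite -EFinM lee_fin; apply: le_trans (stopped_sqr _ _ _ _ (dt0 m) _ _ _) _.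
by rewrite [_ * dt m](_ : _ = K)// /dt mulrC divfK.
Qed.

End Horizon.

Lemma cumulant_gt0 c : 0 < c -> 0 < cumulant nu sigma c.
Proof.
move=> c0; rewrite /cumulant addr_gt0 ?mulr_gt0// divr_gt0 ?mulr_gt0//; exact: exprn_gt0.
Qed.

Let T w := hit (drifted w) l.
Let Tfin : set Omega := [set w | (T w < +oo)%E].

Let T_fin w : Tfin w -> T w = (fine (T w))%:E.
Proof.
move=> Tw; rewrite fineK// fin_real// (lt_le_trans _ (hit_ge0 _ _)) ?ltNyr//.
Qed.

(** The hitting time is finite exactly when its truncation at some integer horizon lies strictly
    below that horizon. *)
Let measurable_fin_hit : measurable (D `&` Tfin).
Proof.
suff -> : D `&` Tfin = \bigcup_m (D `&` [set w | hit_min (drifted w) l m.+1%:R < m.+1%:R]).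
  apply: bigcup_measurable => m _.
  have := measurable_fun_ltr (measurable_hit_min (ltr0Sn R m)) (measurable_cst (m.+1%:R : R)).
  by move=> /(_ mD [set true] I); rewrite (_ : _ @^-1` _ = [set w | hit_min (drifted w) l m.+1%:R < m.+1%:R]).
apply/seteqP; split => [w [Dw /T_fin Tw]|w [m _ [Dw /= h]]].
  have [m _ h] := hit_min_near Tw; have [k _ hk] := nbhs_infty_gtr (fine (T w)).
  exists (maxn m k) => //; split => //=.
  rewrite (h (maxn m k)) /=; last exact: leq_maxl.
  have := hk (maxn m k) (leq_maxr _ _); move=> /lt_trans; apply; by rewrite ltr_nat.
split => //; apply: contraPT h; rewrite -leNgt leye_eq => /eqP Tw.
by apply/negP; rewrite -leNgt (hit_min_ge (x := drifted w)) ?[hit _ _]Tw ?leey.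
Qed.

(** If the level is hit, the value is eventually constant, with the path at [l]. If not, the path
    stays below [l] and the factor e^(-psi(c) K), with psi(c) > 0, drives the value to 0. *)
Let hit_expmart_cvg c w : 0 < c -> D w ->
  hit_expmart m.+1%:R c w @[m --> \oo] -->
  (if (T w < +oo)%E then expR (c * l - cumulant nu sigma c * fine (T w)) else 0).
Proof.
move=> c0 Dw; case: ifPn => [/T_fin Tw|Tw].
  apply: cvg_near_cst; have := hit_min_near Tw; apply: filterS => m hm.
  by rewrite /hit_expmart hm (path_at_hit (continuous_drifted Dw) (drifted0 Dw) l0 Tw).
have {}Tw : hit (drifted w) l = +oo%E by apply/eqP; rewrite -leye_eq leNgt.
pose q := expR (- cumulant nu sigma c).
have q1 : `|q| < 1 by rewrite ger0_norm ?expR_ge0// expR_lt1 oppr_lt0 cumulant_gt0.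
apply: (@squeeze_cvgr _ _ _ _ (cst 0) (fun m => expR (c * l) * q ^+ m)); last 2 first.
- exact: cvg_cst.
- by rewrite -[X in _ --> X](mulr0 (expR (c * l))); apply: cvgM; [exact: cvg_cst|exact: cvg_expr].
apply: nearW => m; rewrite /= expR_ge0 /= /hit_expmart (hit_min_ge (x := drifted w)) ?Tw ?leey//.
rewrite /q -expRM_natl -expRD ler_expR; apply: lerD.
  by rewrite ler_pM2l// (path_le_before_hit (continuous_drifted Dw) (drifted0 Dw))// Tw leey.
by rewrite mulrN lerN2 mulrC ler_pM2l ?cumulant_gt0// ler_nat.
Qed.

Let hit_expmart_le c m w : 0 < c -> D w -> hit_expmart m.+1%:R c w <= expR (c * l).
Proof.
move=> c0 Dw; have m0 : 0 <= m.+1%:R :> R by [].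
rewrite ler_expR lerBlDr ler_wpDr//.
  by rewrite mulr_ge0 ?hit_min_ge0// ltW// cumulant_gt0.
rewrite ler_pM2l// (path_le_before_hit (continuous_drifted Dw) (drifted0 Dw))//.
  exact: hit_min_ge0.
exact: hit_min_le.
Qed.

Let measurable_fine_hit : measurable_fun (D `&` Tfin) (fun w => fine (T w)).
Proof.
apply: (measurable_fun_cvg (h := fun m w => hit_min (drifted w) l m.+1%:R)) => [m|w [_ /T_fin Tw]].
  by apply: (measurable_funS mD); [exact: subIsetl|exact: measurable_hit_min].
by apply: cvg_near_cst; exact: (hit_min_near Tw).
Qed.

(** Letting the horizon grow, with bound e^(c l), gives mean 1 for e^(c l - psi(c) T) restricted to
    finite T; whether T is almost surely finite is still open at this point. *)
Let laplace_fin_hit c : 0 < c ->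
  (\int[P]_(w in D `&` Tfin) (expR (- (cumulant nu sigma c * fine (T w))))%:E = (expR (- (c * l)))%:E)%E.
Proof.
move=> c0.
pose V w := if (T w < +oo)%E then expR (c * l - cumulant nu sigma c * fine (T w)) else 0.
have mX := measurable_hit_expmart.
have h := conull_bounded_convergence mD (fun m => mX _ (ltr0Sn R m) c)
  (fun m w _ => expR_ge0 _) (fun w => @hit_expmart_cvg c w c0)
  (fun m w => @hit_expmart_le c m w c0).
have {}h : (\int[P]_(w in D) (V w)%:E = 1)%E.
  have {}h := h P; apply/esym/(cvg_unique _ _ h) => //.
  rewrite (_ : (fun m => _) = cst 1%E); first exact: cvg_cst.
  by apply/funext => m; rewrite expectation_hit_expmart.
have mE : measurable_fun (D `&` Tfin) (fun w => (expR (- (cumulant nu sigma c * fine (T w))))%:E).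
  apply/measurable_EFinP; apply: measurableT_comp => //; apply: measurableT_comp => //.
  exact: measurable_funM.
have : (\int[P]_(w in D `&` Tfin) ((expR (c * l))%:E * (expR (- (cumulant nu sigma c * fine (T w))))%:E) = 1)%E.
  rewrite integral_mkcondr -h; apply: eq_integral => w _; rewrite patchE /V.
  case: ifPn => [|]; rewrite ?inE ?notin_setE /Tfin /=.
    by move=> ->; rewrite -EFinM -expRD.
  by move=> /negP/negbTE ->.
rewrite ge0_integralZl//.
move=> e; rewrite -[LHS]mul1e -[X in (X * _)%E](_ : (expR (- (c * l)))%:E * (expR (c * l))%:E = _)%E.
  by rewrite -muleA e mule1.
by rewrite -EFinM -expRD addNr expR0.
Qed.

(* The null set where the hitting time is infinite is removed by letting [c] tend to 0. *)
Lemma first_passage_laplace : exists D' : set Omega,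
  [/\ measurable D', P (~` D') = 0%E,
    (forall w, D' w -> hit (drifted w) l = (fine (hit (drifted w) l))%:E),
    measurable_fun D' (fun w => fine (hit (drifted w) l)) &
    forall c, 0 < c -> (\int[P]_(w in D') (expR (- (cumulant nu sigma c * fine (hit (drifted w) l))))%:E
      = (expR (- (c * l)))%:E)%E].
Proof.
exists (D `&` Tfin); split.
- exact: measurable_fin_hit.
- rewrite probability_setC//; suff -> : P (D `&` Tfin) = 1%E by rewrite subee.
  apply/eqP; rewrite eq_le probability_le1//=; apply/lee_addgt0Pr => e e0.
  (* With c = e/l, 1 - e <= e^(-e), which is the transform at psi(c) and so at most the probability
     that T is finite. *)
  have c0 : 0 < e / l by rewrite divr_gt0.
  apply: (@le_trans _ _ ((expR (- (e / l * l)))%:E + e%:E)%E).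
    rewrite -EFinD lee_fin -lerBlDr divfK ?gt_eqF//; exact: expR_ge1Dx.
  rewrite leeD2r// -(laplace_fin_hit c0) -[X in (_ <= X)%E]mul1e -integral_cst//.
  apply: ge0_le_integral => //.
  - apply/measurable_EFinP; apply: measurableT_comp => //; apply: measurableT_comp => //.
    exact: measurable_funM.
  move=> w [Dw Tw]; rewrite lee_fin -[leRHS]expR0 ler_expR oppr_le0 mulr_ge0//.
    by rewrite ltW// cumulant_gt0.
  by rewrite fine_ge0// hit_ge0.
- by move=> w [_]; exact: T_fin.
- exact: measurable_fine_hit.
- exact: laplace_fin_hit.
Qed.

End BrownianHitting.

(** * Moments of the first passage time and reduction to rate one *)

Section FirstPassage.
Context {R : realType}.

Lemma ig_pdf_ge0 (a b t : R) : 0 <= ig_pdf a b t.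
Proof. by rewrite mulr_ge0 ?sqrtr_ge0 ?expR_ge0. Qed.

(** If T has parameters a and b, then c T has parameters c a and c b; with c = beta this reduces the
    expansion to rate one. *)
Lemma ig_pdf_scale (a b c t : R) : 0 < a -> 0 < b -> 0 < c -> 0 < t ->
  ig_pdf a b t = c * ig_pdf (c * a) (c * b) (c * t).
Proof.
move=> a0 b0 c0 t0; rewrite /ig_pdf [RHS]mulrA; congr (_ * _).
  rewrite -[X in _ = X * _](gtr0_norm c0) -sqrtr_sqr -sqrtrM ?sqr_ge0//; congr Num.sqrt.
  move: pi (pi_gt0 R) => q q0.
  by field; rewrite !gt_eqF.
by congr (expR (- _)); field; rewrite !gt_eqF.
Qed.

Lemma measurable_ig_pdf (a b : R) : 0 < a -> 0 < b ->
  measurable_fun (`]0%R, +oo[%classic : set R) (ig_pdf a b).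
Proof.
move=> a0 b0; apply: eq_measurable_fun => [x|].
  by rewrite inE /= in_itv /= andbT => x0; rewrite ig_pdfE.
by apply: measurable_funM => //; exact: measurable_powexp.
Qed.

Lemma laguerre_coef_scale (alpha beta : R) (m : nat -> R) k :
  laguerre_coef alpha beta m k = laguerre_coef alpha 1 (fun j => beta ^+ j * m j) k.
Proof.
rewrite /laguerre_coef; congr (1 + _); apply: eq_bigr => j _; congr (_ * (_ / _)).
by rewrite exprNn mulrA.
Qed.

Lemma laguerre_coef0 (alpha beta : R) (m : nat -> R) : laguerre_coef alpha beta m 0 = 1.
Proof. by rewrite /laguerre_coef big_geq// addr0. Qed.

Lemma laguerre0 (alpha x : R) : laguerre alpha 0 x = 1.
Proof.
by rewrite /laguerre big_ord1 /gbinom /falling big_ord0 fact0 expr0 !divr1 mulr1.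
Qed.

Lemma Gamma_gweight (alpha : R) : Gamma (alpha + 1) = posint (gweight alpha).
Proof.
apply: eq_Rintegral => x; rewrite inE /= in_itv /= andbT => x0.
rewrite addrK powR_powexp// -[x in expR (- x)]mul1r expR_powexp powexpM.
by rewrite !addr0 add0r.
Qed.

Lemma gamma_pdf_gweight (alpha beta t : R) : 0 < beta -> 0 < t ->
  gamma_pdf alpha beta t = beta * gweight alpha (beta * t) / posint (gweight alpha).
Proof.
move=> beta0 t0; have bt0 : 0 < beta * t by rewrite mulr_gt0.
rewrite /gamma_pdf Gamma_gweight -(mulrA beta); congr (_ * _ / _).
by rewrite powR_powexp// -[X in expR (- X)]mul1r expR_powexp powexpM !addr0 add0r.
Qed.

(** If A < 0, the growth of e^(-A t) beats the power, and the integrand is bounded below on ]1, +oo[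
    by a positive constant. *)
Lemma exp_rate_ge0 (p A a : R) : 0 < p -> 0 < a ->
  (\int[@lebesgue_measure R]_(t in `]0%R, +oo[) (t `^ (- p) * expR (- A * t - a / t))%:E < +oo)%E ->
  0 <= A.
Proof.
move=> p0 a0; rewrite leNgt; apply: contraTN => A0; rewrite -leNgt leye_eq.
have k0 : 0 < - A by rewrite oppr_gt0.
(* From ln u <= u at u = -A t/p one gets -p ln t - A t >= -p ln (p/(-A)); the term -a comes from t
   >= 1. *)
pose kappa := expR (- (p * ln (p / - A)) - a).
have mg : measurable_fun (`]0%R, +oo[%classic : set R)
    (fun t : R => (t `^ (- p) * expR (- A * t - a / t))%:E).
  apply/measurable_EFinP; apply: (eq_measurable_fun (powexp (- p) A a)).
    move=> t; rewrite inE /= in_itv /= andbT => t0.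
    by rewrite powR_powexp// /powexp -expRD; congr expR; ring.
  exact: measurable_powexp.
rewrite -leye_eq; apply: (@le_trans _ _ (\int[@lebesgue_measure R]_(t in `]1%R, +oo[) (cst kappa%:E t))%E).
  rewrite integral_cst// [X in (_ * X)%E]lebesgue_measure_itv /= ltry.
  by rewrite addye// gt0_muley// lte_fin expR_gt0.
apply: (@le_trans _ _ (\int[@lebesgue_measure R]_(t in `]1%R, +oo[)
    (t `^ (- p) * expR (- A * t - a / t))%:E)%E); last first.
  apply: ge0_subset_integral => //.
  - by move=> t _; rewrite lee_fin mulr_ge0 ?powR_ge0 ?expR_ge0.
  - by move=> t /=; rewrite !in_itv /= !andbT; exact: lt_trans.
apply: ge0_le_integral => //.
- by move=> t _; rewrite lee_fin expR_ge0.
- apply: measurable_funS mg => // t /=; rewrite !in_itv /= !andbT; exact: lt_trans.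
move=> t /=; rewrite in_itv /= andbT => t1; have t0 : 0 < t by apply: lt_trans t1.
rewrite lee_fin powR_powexp// /powexp !mul0r !subr0 -expRD ler_expR.
have u0 : 0 < t * (- A / p) by rewrite mulr_gt0// divr_gt0.
have v0 : 0 < p / - A by rewrite divr_gt0.
have lnt : ln t <= t * (- A / p) + ln (p / - A).
  have {1}-> : t = t * (- A / p) * (p / - A) by field; rewrite ?oppr_eq0 (gt_eqF p0) (lt_eqF A0).
  by rewrite lnM ?posrE// lerD2r ltW// ln_sublinear.
have at1 : a / t <= a by rewrite ler_pdivrMr// ler_peMr// ltW.
have : p * ln t <= p * (t * (- A / p) + ln (p / - A)) by rewrite ler_pM2l.
have -> : p * (t * (- A / p) + ln (p / - A)) = - A * t + p * ln (p / - A).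
  by field; rewrite gt_eqF.
lra.
Qed.

Context {d : measure_display} {Omega : measurableType d}.
Variables (P : probability Omega R) (W : R -> {RV P >-> R}).

Lemma first_passage_hit (y0 mu sigma S : R) w : 0 < y0 -> y0 < S ->
  first_passage_time (geometric_brownian_motion y0 mu sigma W) S w =
  hit (drifted W (mu - sigma ^+ 2 / 2) sigma w) (ln S - ln y0).
Proof.
move=> y00 yS; have S0 : 0 < S by apply: lt_trans yS.
have key x : (S < y0 * expR x) = (ln S - ln y0 < x).
  by rewrite -[LHS]ltr_ln ?posrE ?mulr_gt0 ?expR_gt0// lnM ?posrE ?expR_gt0// expRK ltrBlDl.
congr ereal_inf; apply/seteqP; split => _ [t [t0 h] <-]; exists t => //; split => //;
  by move: h; rewrite /geometric_brownian_motion key.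
Qed.

Lemma first_passage_moments (y0 mu sigma S beta : R) (a := (ln S - ln y0) ^+ 2 / sigma ^+ 2)
    (b := (ln S - ln y0) / (mu - sigma ^+ 2 / 2)) j :
  standard_brownian_motion W -> 0 < sigma -> sigma ^+ 2 / 2 < mu -> 0 < y0 -> y0 < S -> 0 < beta ->
  beta ^+ j * moment P (first_passage_time (geometric_brownian_motion y0 mu sigma W) S) j =
  posint (fun x => x ^+ j * ig_pdf (beta * a) (beta * b) x).
Proof.
move=> hW sigma0 hmu y00 yS beta0; have [_ Windep Wgauss _] := hW.
have [D0 [mD0 PD0 W0 Wc]] := regular_paths hW.
set nu := mu - sigma ^+ 2 / 2 in b *; set l := ln S - ln y0 in a b *.
have nu0 : 0 < nu by rewrite subr_gt0.
have l0 : 0 < l by rewrite subr_gt0 ltr_ln ?posrE// (lt_trans y00).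
have [D [mD PD TE mT laplaceT]] := first_passage_laplace Windep Wgauss mD0 PD0 W0 Wc nu0 sigma0 l0.
have -> : first_passage_time (geometric_brownian_motion y0 mu sigma W) S =
    fun w => hit (drifted W nu sigma w) l.
  by apply/funext => w; rewrite first_passage_hit.
set T := fun w => hit _ l in TE mT laplaceT *; pose X w := beta * fine (T w).
have T0 w : 0 <= fine (T w) by rewrite fine_ge0// hit_ge0.
have s2 : 0 < sigma ^+ 2 by rewrite exprn_gt0.
have a0 : 0 < a by rewrite divr_gt0// exprn_gt0.
have b0 : 0 < b by rewrite divr_gt0.
have a0' : 0 < beta * a by rewrite mulr_gt0.
have b0' : 0 < beta * b by rewrite mulr_gt0.
have laplaceX x : 0 < x -> (\int[P]_(w in D) (expR (- (x * X w)) * 1)%:E =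
    \int[@lebesgue_measure R]_(t in (`]0%R, +oo[%classic : set R)) (expR (- (x * t)) * ig_pdf (beta * a) (beta * b) t)%:E)%E.
  move=> x0; rewrite ig_laplace// ?(ltW x0)//.
  (* [c] is the positive root of [cumulant nu sigma c = x * beta]. *)
  pose r := Num.sqrt (nu ^+ 2 + 2 * sigma ^+ 2 * (x * beta)).
  have xb0 : 0 < 2 * sigma ^+ 2 * (x * beta) by rewrite !mulr_gt0.
  have r2 : r ^+ 2 = nu ^+ 2 + 2 * sigma ^+ 2 * (x * beta).
    by rewrite sqr_sqrtr// addr_ge0 ?sqr_ge0// ltW.
  have nur : nu < r.
    rewrite -(@ltr_pXn2r _ 2) ?nnegrE ?sqrtr_ge0 ?(ltW nu0)// r2 ltrDl//.
  pose c := (r - nu) / sigma ^+ 2.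
  have c0 : 0 < c by rewrite divr_gt0// subr_gt0.
  have cE : cumulant nu sigma c = x * beta.
    have -> : x * beta = (r ^+ 2 - nu ^+ 2) / (2 * sigma ^+ 2).
      by rewrite r2; field; rewrite gt_eqF.
    by rewrite /cumulant /c; field; rewrite gt_eqF.
  have := laplaceT c c0; rewrite cE => h.
  transitivity (expR (- (c * l)))%:E.
    by rewrite -h; apply: eq_integral => w _; rewrite mulr1 /X mulrA.
  congr (expR _)%:E.
  rewrite -sqrtrM; last exact: ltW.
  have -> : beta * a * (beta * a / (beta * b) ^+ 2 + 2 * x) = (l / sigma ^+ 2 * r) ^+ 2.
    rewrite [RHS]exprMn r2 /a /b; field; by rewrite !gt_eqF.
  rewrite sqrtr_sqr ger0_norm; last by rewrite mulr_ge0 ?sqrtr_ge0// divr_ge0 ?ltW.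
  by rewrite /c /a /b; field; rewrite !gt_eqF.
have mX : measurable_fun D X by exact: measurable_funM.
have X0 w : 0 <= X w by rewrite mulr_ge0// ltW.
have := moments_of_laplace (mu1 := P) (mu2 := @lebesgue_measure R) (D1 := D)
  (D2 := (`]0%R, +oo[%classic : set R)) (X1 := X) (q1 := cst 1) (X2 := id)
  (q2 := ig_pdf (beta * a) (beta * b)) mD mX (measurable_cst _) (fun w _ => X0 w) (fun _ _ => ler01).
move=> /(_ (measurable_itv _) (@measurable_id _ _ _) (measurable_ig_pdf a0' b0')).
move=> /(_ _ (fun t _ => ig_pdf_ge0 _ _ t) _ laplaceX j) h.
rewrite /posint /Rintegral -h; first last.
- move=> x x0; rewrite laplaceX// ig_laplace// ?ltry//; exact: ltW.
- by move=> t /=; rewrite in_itv /= andbT => /ltW.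
rewrite /moment (ge0_integral_conull mD PD); first last.
- by move=> w; rewrite expe_ge0// hit_ge0.
- apply: (eq_measurable_fun (fun w => (fine (T w) ^+ j)%:E)).
    by move=> w; rewrite inE => /TE Tw; rewrite EFin_expe -Tw.
  by apply/measurable_EFinP; exact: measurable_funX.
have -> : (\int[P]_(w in D) (X w ^+ j * cst 1 w)%:E =
    (beta ^+ j)%:E * \int[P]_(w in D) (T w ^+ j))%E.
  rewrite -ge0_integralZl//; first last.
  - by rewrite lee_fin exprn_ge0// ltW.
  - by move=> w _; rewrite expe_ge0// hit_ge0.
  - apply: (eq_measurable_fun (fun w => (fine (T w) ^+ j)%:E)).
      by move=> w; rewrite inE => /TE Tw; rewrite EFin_expe -Tw.
    by apply/measurable_EFinP; exact: measurable_funX.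
  apply: eq_integral => w; rewrite inE => /TE Tw.
  by rewrite (Tw : T w = _) -EFin_expe -EFinM /= mulr1 /X exprMn.
have bj : 0 < beta ^+ j by rewrite exprn_gt0.
have : (0 <= \int[P]_(w in D) (T w ^+ j))%E.
  by apply: integral_ge0 => w _; rewrite expe_ge0// hit_ge0.
(* On both sides [fine] turns an infinite moment into 0, so the identity holds in that case as
   well. *)
case: (\int[P]_(w in D) _)%E => [r| |]//= _.
by rewrite gt0_muley ?lte_fin//= mulr0.
Qed.

End FirstPassage.

Theorem proposition3p1 (R : realType) (d : measure_display)
    (Omega : measurableType d) (P : probability Omega R)
    (W : R -> {RV P >-> R}) (mu sigma y0 S alpha beta : R)
    (hW : standard_brownian_motion W)
    (hsigma : 0 < sigma) (hmu : sigma ^+ 2 / 2 < mu)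
    (hy0 : 0 < y0) (hS : y0 < S)
    (halpha : -1 < alpha) (hbeta : 0 < beta) :
  let Y := geometric_brownian_motion y0 mu sigma W in
  let T := first_passage_time Y S in
  let a := (ln S - ln y0) ^+ 2 / sigma ^+ 2 in
  let b := (ln S - ln y0) / (mu - sigma ^+ 2 / 2) in
  let A := a / b ^+ 2 - beta in
  let B := laguerre_coef alpha beta (moment P T) in
  (\int[@lebesgue_measure R]_(t in `]0%R, +oo[)
     (t `^ (- (alpha + 3)) * expR (- A * t - a / t))%:E < +oo)%E ->
  forall t : R, 0 < t ->
    cvgn (fun n => \sum_(1 <= k < n) B k * laguerre alpha k (beta * t)) /\
    ig_pdf a b t = gamma_pdf alpha beta t *
      (1 + \big[+%R/0]_(1 <= k <oo) (B k * laguerre alpha k (beta * t))).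
Proof.
move=> Y T a b A B Ifin t t0.
have s20 : 0 < sigma ^+ 2 by rewrite exprn_gt0.
have nu0 : 0 < mu - sigma ^+ 2 / 2 by rewrite subr_gt0.
have l0 : 0 < ln S - ln y0 by rewrite subr_gt0 ltr_ln ?posrE// (lt_trans hy0).
have a0 : 0 < a by rewrite divr_gt0// exprn_gt0.
have b0 : 0 < b by rewrite divr_gt0.
have p0 : 0 < alpha + 3 by lra.
have A0 : 0 <= A := exp_rate_ge0 p0 a0 Ifin.
(* The condition A >= 0 expressed with the scaled parameters. *)
have rate : 1 <= beta * a / (beta * b) ^+ 2.
  have -> : beta * a / (beta * b) ^+ 2 = (a / b ^+ 2) / beta by field; rewrite !gt_eqF.
  by rewrite ler_pdivlMr// mul1r -subr_ge0.
have bt0 : 0 < beta * t by rewrite mulr_gt0.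
have hm j : beta ^+ j * moment P T j = posint (fun x => x ^+ j * ig_pdf (beta * a) (beta * b) x).
  exact: first_passage_moments.
have := ig_laguerre_series (mulr_gt0 hbeta a0) (mulr_gt0 hbeta b0) halpha rate bt0 hm.
set s := posint _ * _ / _ => series_cvg.
(* The term k = 0 of the full series equals 1 and is the 1 written separately in the conclusion,
   hence the limit s - 1. *)
have {}series_cvg : \sum_(1 <= k < n) B k * laguerre alpha k (beta * t) @[n --> \oo] --> s - 1.
  have : \sum_(0 <= k < n) laguerre_coef alpha 1 (fun j => beta ^+ j * moment P T j) k *
      laguerre alpha k (beta * t) - 1 @[n --> \oo] --> s - 1.
    by apply: cvgB; [exact: series_cvg|exact: cvg_cst].
  apply: cvg_trans; apply: near_eq_cvg; near=> n.
  have n0 : (0 < n)%N by near: n; exact: nbhs_infty_gt.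
  rewrite big_ltn// laguerre_coef0 laguerre0 mulr1 addrC addKr.
  by apply: eq_bigr => k _; rewrite /B (laguerre_coef_scale _ beta).
split; first by apply/cvg_ex; exists (s - 1).
rewrite (cvg_lim _ series_cvg)// addrC subrK gamma_pdf_gweight// (ig_pdf_scale a0 b0 hbeta t0) /s.
by field; rewrite !gt_eqF ?gweight_gt0 ?posint_gweight_gt0.
Unshelve. all: by end_near. Qed.
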